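(* Let $G$ be a finitely generated nilpotent group and let $\pi$ be a faithful irreducible unitary representation of $G$. Then there exist a torsion free, finite index subgroup $N\leq Z(G)$ of the center $Z(G)$ of $G$, a 2-cocycle $\sigma: G/N\times G/N\to\mathbb{T}$, and a central projection $p\in C^*(G/N,\sigma)$ such that $$C^*_\pi(G)\cong p\,C^*(G/N,\sigma).$$ Moreover, $\sigma$ is homotopic to the trivial cocycle.
   Context: $G$ is regarded as a discrete group. A representation $\pi$ is faithful if it is injective on $G$; $C^*_\pi(G)$ denotes the C*-algebra generated by $\pi(G)$. $\mathbb{T}$ is the unit circle in $\mathbb{C}$. A 2-cocycle on a discrete group $K$ is a map $\sigma:K\times K\to\mathbb{T}$ with $\sigma(x,y)\sigma(xy,z)=\sigma(x,yz)\sigma(y,z)$ for all $x,y,z\in K$; the trivial cocycle is the constant function $1$. $C^*(K,\sigma)$ denotes the twisted group C*-algebra, i.e. the universal C*-algebra generated by unitaries $u_x$, $x\in K$, with $u_xu_y=\sigma(x,y)u_{xy}$. Two 2-cocycles $\sigma_0,\sigma_1$ on $K$ are homotopic if there is a family $(\sigma_t)_{t\in[0,1]}$ of $\mathbb{T}$-valued 2-cocycles on $K$ with the given endpoints such that $t\mapsto\sigma_t(x,y)$ is continuous for all $x,y\in K$. *)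

(* Defs.v *)
From HB Require Import structures.
From mathcomp Require Import all_boot all_order all_algebra.
From mathcomp Require Import sesquilinear generic_quotient.
From mathcomp Require Import all_classical all_reals all_analysis.
From mathcomp Require Import complex.

Set Implicit Arguments.
Unset Strict Implicit.
Unset Printing Implicit Defensive.

Import Order.TTheory GRing.Theory Num.Theory.
Import numFieldNormedType.Exports.

Local Open Scope classical_set_scope.
Local Open Scope ring_scope.
Local Open Scope complex_scope.
Local Open Scope quotient_scope.

Section Groups.
Variable G : groupType.
Implicit Types (A H : set G).

Definition is_subgroup H : Prop :=
  H 1%g /\ forall x y, H x -> H y -> H (x / y)%g.

Definition generated_subgroup A : set G :=
  \bigcap_(H in [set H | is_subgroup H /\ A `<=` H]) H.

Definition finitely_generated : Prop :=
  exists A, finite_set A /\ generated_subgroup A = [set: G].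

Fixpoint lower_central n : set G :=
  if n is m.+1
  then generated_subgroup [set [~ x, y]%g | x in lower_central m & y in [set: G]]
  else [set: G].

Definition nilpotent_group : Prop := exists n, lower_central n = [set 1%g].

Definition group_center : set G := [set z | forall x, (z * x = x * z)%g].

Definition torsion_free H : Prop :=
  forall x n, H x -> (0 < n)%N -> (x ^+ n = 1)%g -> x = 1%g.

(* For subgroups A <= H: there are finitely many left cosets of A in H. *)
Definition finite_index A H : Prop :=
  finite_set [set [set (x * a)%g | a in A] | x in H].

Record normal_subgroup := NormalSubgroup {
  nsub_set :> set G;
  nsub_subgroup : is_subgroup nsub_set;
  nsub_normal : forall x y, nsub_set x -> nsub_set (x ^ y)%g }.

End Groups.

Arguments lower_central G n : clear implicits.
Arguments group_center G : clear implicits.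

Section QuotientGroup.
Variables (G : groupType) (N : normal_subgroup G).

Definition coset_rel : rel G := fun x y => `[< nsub_set N (x^-1 * y)%g >].

Let NF x y : nsub_set N x -> nsub_set N y -> nsub_set N (x / y)%g.
Proof. by case: (nsub_subgroup N) => _; exact. Qed.

Let NV x : nsub_set N x -> nsub_set N x^-1%g.
Proof.
by move=> Nx; rewrite -[x^-1%g]mul1g; apply: NF => //; case: (nsub_subgroup N).
Qed.

Let NM x y : nsub_set N x -> nsub_set N y -> nsub_set N (x * y)%g.
Proof. by move=> Nx Ny; rewrite -[y]invgK; apply: NF => //; exact: NV. Qed.

Let NJ x y : nsub_set N x -> nsub_set N (x ^ y)%g.
Proof. exact: nsub_normal. Qed.

Fact coset_relP : equiv_class_of coset_rel.
Proof.
split=> [x|x y|y x z]; rewrite /coset_rel.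
- by apply/asboolP; rewrite mulVg; case: (nsub_subgroup N).
- by apply/asboolP/asboolP => /NV; rewrite invgM invgK.
- move=> /asboolP Nxy /asboolP Nyz; apply/asboolP.
  by have := NM Nxy Nyz; rewrite mulgA mulgK.
Qed.

Canonical coset_equiv := EquivRelPack coset_relP.

Definition quotient_group := {eq_quot coset_equiv}.

HB.instance Definition _ := Choice.on quotient_group.
HB.instance Definition _ := EqQuotient.on quotient_group.

Definition quotient_map : G -> quotient_group := \pi_quotient_group.

Let mulq : quotient_group -> quotient_group -> quotient_group :=
  fun a b => quotient_map (repr a * repr b)%g.
Let oneq : quotient_group := quotient_map 1%g.
Let invq : quotient_group -> quotient_group :=
  fun a => quotient_map (repr a)^-1%g.

Let quotient_mapK a : quotient_map (repr a) = a.
Proof. exact: reprK. Qed.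

Let quotient_mapP x y : quotient_map x = quotient_map y <-> nsub_set N (x^-1 * y)%g.
Proof.
split; first by move/eqmodP => /asboolP.
by move=> Nxy; apply/eqmodP/asboolP.
Qed.

Let repr_quotient_map x : nsub_set N ((repr (quotient_map x))^-1 * x)%g.
Proof. by apply/quotient_mapP; rewrite quotient_mapK. Qed.

Let mulqE x y : mulq (quotient_map x) (quotient_map y) = quotient_map (x * y)%g.
Proof.
apply/quotient_mapP; set r := repr _; set s := repr _.
have Nx : nsub_set N (r^-1 * x)%g := repr_quotient_map x.
have Ny : nsub_set N (s^-1 * y)%g := repr_quotient_map y.
suff -> : ((r * s)^-1 * (x * y) = (r^-1 * x) ^ s * (s^-1 * y))%g.
  exact: NM (NJ s Nx) Ny.
by rewrite /conjg invgM !mulgA mulgK.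
Qed.

Let invqE x : invq (quotient_map x) = quotient_map x^-1%g.
Proof.
apply/quotient_mapP; set r := repr _.
have Nx : nsub_set N (r^-1 * x)%g := repr_quotient_map x.
suff -> : (r^-1^-1 * x^-1 = ((r^-1 * x)^-1) ^ r^-1)%g.
  exact: NJ (NV Nx).
by rewrite /conjg invgM !invgK !mulgA mulgK.
Qed.

Let mulqA : associative mulq.
Proof.
move=> a b c; rewrite -[a]quotient_mapK -[b]quotient_mapK -[c]quotient_mapK.
by rewrite !mulqE mulgA.
Qed.

Let mul1q : left_id oneq mulq.
Proof. by move=> a; rewrite -[a]quotient_mapK mulqE mul1g. Qed.

Let mulq1 : right_id oneq mulq.
Proof. by move=> a; rewrite -[a]quotient_mapK mulqE mulg1. Qed.

Let mulVq : left_inverse oneq invq mulq.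
Proof. by move=> a; rewrite -[a]quotient_mapK invqE mulqE mulVg. Qed.

Let mulqV : right_inverse oneq invq mulq.
Proof. by move=> a; rewrite -[a]quotient_mapK invqE mulqE mulgV. Qed.

HB.instance Definition _ :=
  isGroup.Build quotient_group mulqA mul1q mulq1 mulVq mulqV.

Lemma quotient_mapM x y :
  quotient_map (x * y)%g = (quotient_map x * quotient_map y)%g.
Proof. by rewrite -mulqE. Qed.

Lemma quotient_map_eq x y :
  quotient_map x = quotient_map y <-> nsub_set N (x^-1 * y)%g.
Proof. exact: quotient_mapP. Qed.

Lemma quotient_map_surj a : exists x, quotient_map x = a.
Proof. by exists (repr a); exact: quotient_mapK. Qed.

End QuotientGroup.

Section Cocycles.
Variables (R : realType) (K : groupType).
Implicit Types sigma : K -> K -> R[i].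

Definition cocycle sigma : Prop :=
  (forall x y, `|sigma x y| = 1) /\
  forall x y z, sigma x y * sigma (x * y)%g z = sigma x (y * z)%g * sigma y z.

Definition trivial_cocycle : K -> K -> R[i] := fun _ _ => 1.

(* Only the values of tau on [0, 1] matter. *)
Definition cocycle_homotopic sigma0 sigma1 : Prop :=
  exists tau : R -> K -> K -> R[i],
    [/\ forall t, 0 <= t <= 1 -> cocycle (tau t),
        tau 0 = sigma0, tau 1 = sigma1 &
        forall x y, {within `[0, 1], continuous
          (fun t => tau t x y : (R[i] : numFieldType))}].

End Cocycles.

Arguments trivial_cocycle R K : clear implicits.

(* Unital C*-algebras; like every [algType], they are nonzero. The norm takes
   its values in the nonnegative reals of [R[i]], as for a normed module over
   [R[i]]. It is a field of its own because Hierarchy Builder rejects a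
   structure extending both [algType] and [normedModType]: [numDomainType]
   already joins a ring with a norm. *)
HB.mixin Record isCStarAlgebra (R : realType) A of GRing.Algebra R[i] A := {
  star : A -> A;
  starK : involutive star;
  starD : forall a b, star (a + b) = star a + star b;
  starZ : forall (k : R[i]) a, star (k *: a) = Num.conj k *: star a;
  starM : forall a b, star (a * b) = star b * star a;
  cnorm : A -> R[i];
  cnorm_eq0 : forall a, cnorm a = 0 -> a = 0;
  cnormD : forall a b, cnorm (a + b) <= cnorm a + cnorm b;
  cnormZ : forall (k : R[i]) a, cnorm (k *: a) = `|k| * cnorm a;
  cnormM : forall a b, cnorm (a * b) <= cnorm a * cnorm b;
  cnorm_star : forall a, cnorm (star a * a) = cnorm a ^+ 2;
  cnorm_complete : forall a_ : nat -> A,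
    (forall e : R[i], 0 < e -> exists n0, forall m n,
      (n0 <= m)%N -> (n0 <= n)%N -> cnorm (a_ m - a_ n) < e) ->
    exists a, forall e : R[i], 0 < e -> exists n0, forall n,
      (n0 <= n)%N -> cnorm (a_ n - a) < e }.

#[short(type="cstarAlgType")]
HB.structure Definition CStarAlgebra (R : realType) :=
  {A of isCStarAlgebra R A & GRing.Algebra R[i] A}.

Section CStarAlgebras.
Variables (R : realType).
Implicit Types A B : cstarAlgType R.

Definition unitary A (a : A) : Prop := star a * a = 1 /\ a * star a = 1.

Definition star_homomorphism A B (f : {lrmorphism A -> B}) : Prop :=
  forall a, f (star a) = star (f a).

Definition norm_closed A (S : set A) : Prop :=
  forall a, (forall e : R[i], 0 < e -> exists2 b, S b & cnorm (a - b) < e) -> S a.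

Definition cstar_subalgebra A (S : set A) : Prop :=
  [/\ norm_closed S, S 0,
      forall (k : R[i]) a b, S a -> S b -> S (k *: a + b),
      forall a b, S a -> S b -> S (a * b) &
      forall a, S a -> S (star a)].

Definition cstar_generates A (X : set A) : Prop :=
  forall S, cstar_subalgebra S -> X `<=` S -> S = [set: A].

Definition central_projection A (p : A) : Prop :=
  [/\ p * p = p, star p = p & forall a, p * a = a * p].

Definition twisted_unitaries (K : groupType) (sigma : K -> K -> R[i])
    A (u : K -> A) : Prop :=
  (forall x, unitary (u x)) /\
  forall x y, u x * u y = sigma x y *: u (x * y)%g.

(* [(A, u)] is the universal C*-algebra generated by a family of unitaries
   [u x] with [u x * u y = sigma x y *: u (x * y)]; the morphism [f] below is
   unique because the [u x] generate [A]. *)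
Definition is_twisted_group_cstar_algebra (K : groupType)
    (sigma : K -> K -> R[i]) A (u : K -> A) : Prop :=
  [/\ twisted_unitaries sigma u,
      cstar_generates (range u) &
      forall B (v : K -> B), twisted_unitaries sigma v ->
        exists f : {lrmorphism A -> B},
          star_homomorphism f /\ forall x, f (u x) = v x].

End CStarAlgebras.

Section Operators.
Variables (R : realType) (H : completeNormedModType R[i]).
Variable dot : {dot H for (@Num.conj R[i])}.
Implicit Types (S T : H -> H) (X : set (H -> H)).

Definition norm_of_dot : Prop := forall v, `|v| ^+ 2 = dot v v.

Definition bounded_operator T : Prop := linear T /\ continuous T.

(* [S] is the adjoint of [T]. *)
Definition adjoint_of T S : Prop := forall v w, dot (T v) w = dot v (S w).

Definition unitary_operator T : Prop :=
  [/\ linear T, set_surj [set: H] [set: H] T & forall v w, dot (T v) (T w) = dot v w].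

(* [T] is a limit of elements of [X] in operator norm. *)
Definition op_norm_adherent X T : Prop :=
  forall e : R[i], 0 < e ->
    exists2 S, X S & forall v, `|T v - S v| <= e * `|v|.

(* A nonempty such [X] is a norm-closed *-subalgebra of the algebra of bounded
   operators on [H]. *)
Definition operator_cstar_algebra X : Prop :=
  [/\ X `<=` bounded_operator,
      forall (k : R[i]) S T, X S -> X T -> X (fun v => k *: S v + T v),
      forall S T, X S -> X T -> X (S \o T),
      forall S T, X T -> bounded_operator S -> adjoint_of T S -> X S &
      forall T, bounded_operator T -> op_norm_adherent X T -> X T].

Definition cstar_generated X : set (H -> H) :=
  \bigcap_(Y in [set Y | operator_cstar_algebra Y /\ X `<=` Y]) Y.

Section Representations.
Variables (G : groupType) (pi : G -> H -> H).

Definition unitary_representation : Prop :=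
  (forall g, unitary_operator (pi g)) /\
  forall g h, pi (g * h)%g = pi g \o pi h.

Definition irreducible_representation : Prop :=
  (exists v : H, v != 0) /\
  forall V : set H, closed V -> V 0 ->
    (forall (k : R[i]) v w, V v -> V w -> V (k *: v + w)) ->
    (forall g v, V v -> V (pi g v)) ->
    V = [set 0] \/ V = [set: H].

Definition representation_cstar_algebra : set (H -> H) :=
  cstar_generated (range pi).

End Representations.

(* A *-isomorphism from a *-subalgebra [E] of [A], possibly with another unit
   than [A], onto a *-algebra [X] of operators. *)
Definition star_isomorphic (A : cstarAlgType R) (E : set A) X : Prop :=
  exists2 f : A -> H -> H, set_bij E X f &
    [/\ forall (k : R[i]) a b, E a -> E b ->
          f (k *: a + b) = (fun v => k *: f a v + f b v),
        forall a b, E a -> E b -> f (a * b) = f a \o f b &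
        forall a, E a -> adjoint_of (f a) (f (star a))].

End Operators.

(* Main.v *)
Require Import Defs.
From HB Require Import structures.
From mathcomp Require Import all_boot all_order all_algebra.
From mathcomp Require Import sesquilinear generic_quotient.
From mathcomp Require Import all_classical all_reals all_analysis.
From mathcomp Require Import complex.
From mathcomp Require Import ring lra zify.

Set Implicit Arguments.
Unset Strict Implicit.
Unset Printing Implicit Defensive.

Import Order.TTheory GRing.Theory Num.Theory.
Import numFieldNormedType.Exports.

Local Open Scope classical_set_scope.
Local Open Scope ring_scope.
Local Open Scope quotient_scope.

(** Let [N] be a free abelian subgroup of finite index in the center [Z] of [G];
    it exists because the subgroups of a finitely generated nilpotent group are
    finitely generated ([center_free_finite_index]). By Schur's lemma [pi] is
    given on [N] by a character [w], and a section of [G -> G/N] turns [w] into a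
    cocycle [sigma] on [G/N]: the [sigma]-representations of [G/N] are the
    representations of [G] that restrict to [w] on [N]. Since [N] is free
    abelian, [w = exp (i theta)] with [theta] a homomorphism to the reals, and
    scaling [theta] down to zero deforms [sigma] into the trivial cocycle
    ([section_cocycle_homotopic]).

    So [C*(G/N, sigma)] maps onto [C*_pi(G)], and it must be shown that a central
    projection splits this map. The projection comes from a trace. As [G] has
    polynomial growth ([nilpotent_poly_growth]), word balls contain a Folner
    sequence; averaging the state of a unit vector over it, in a generalized
    limit, gives a trace [chi] with [|chi a| <= |pi a|] ([rep_trace]). If some
    commutator [[x, y]] is central and nontrivial, then [pi [x, y]] is a scalar
    other than 1, because [pi] is faithful, and conjugation invariance forces
    [chi x = 0]. By descending induction along the lower central series, [chi]
    vanishes at every [x] with infinitely many conjugates ([rep_trace_support]):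
    otherwise infinitely many translates would be orthogonal for [chi], against
    Bessel's inequality. The elements with finitely many conjugates form a finite
    extension of [Z] ([finite_conj_finite_mod]), so [chi] is supported on
    finitely many cosets of [N].

    Let [P] be the sum of [chi x * x^-1] over representatives [x] of these cosets,
    and let [tau] be the canonical trace of [C*(G/N, sigma)], which is zero off
    [N]. Then [tau (P a) = chi a]; hence [P] is central because [chi] is a trace,
    and by Schur's lemma [pi P] is a scalar [s], equal to the sum of the
    [|chi x|^2] and thus positive. It follows that [p = P / s] is a central
    projection with [pi p = 1].

    Finally [pi] is isometric on the corner cut out by [p]. An element [a] with
    [m] terms satisfies [|a|^2 <= m tau (a^* a)] in every representation with
    character [w] ([cnorm_le_trace]), and [tau ((P a)^* (P a)) = s chi (a^* a) <= s |pi a|^2].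
    Applied to high powers of [a^* a], whose supports grow polynomially, this
    gives [|p a| <= |pi a|] on taking roots ([trace_projection_norm]). The image
    of the corner is therefore complete, and it is [C*_pi(G)]
    ([corner_isomorphism]). *)

(** * Lower central series and polynomial growth *)

Section LowerCentral.
Variable G : groupType.
Local Open Scope group_scope.
Implicit Types (H K A : set G) (x y z : G).

Lemma subgroup1 H : is_subgroup H -> H 1.
Proof. by case. Qed.

Lemma subgroupV H x : is_subgroup H -> H x -> H x^-1.
Proof. by move=> [H1 HF] Hx; rewrite -[x^-1]mul1g; exact: HF. Qed.

Lemma subgroupM H x y : is_subgroup H -> H x -> H y -> H (x * y).
Proof.
move=> sH Hx Hy; rewrite -[y]invgK; case: (sH) => _; apply => //.
exact: subgroupV.
Qed.

Lemma subgroupX H x n : is_subgroup H -> H x -> H (x ^+ n).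
Proof.
move=> sH Hx; elim: n => [|n IH]; first by rewrite expg0; exact: subgroup1.
by rewrite expgS; exact: subgroupM.
Qed.

Lemma generated_is_subgroup A : is_subgroup (generated_subgroup A).
Proof.
split; first by move=> H [[]].
by move=> x y Ax Ay H [sH AH]; case: (sH) => _; apply; [exact: Ax|exact: Ay].
Qed.

Lemma sub_generated A : A `<=` generated_subgroup A.
Proof. by move=> x Ax H [_]; exact. Qed.

Lemma generated_sub A H : is_subgroup H -> A `<=` H -> generated_subgroup A `<=` H.
Proof. by move=> sH AH x; apply. Qed.

Lemma lower_central_subgroup n : is_subgroup (lower_central G n).
Proof. by case: n => [|n]; [split | exact: generated_is_subgroup]. Qed.

Lemma lower_central_commr n x y :
  lower_central G n x -> lower_central G n.+1 [~ x, y].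
Proof. by move=> Lx; apply: sub_generated; exists x => //; exists y. Qed.

Lemma lower_centralJ n x y : lower_central G n x -> lower_central G n (x ^ y).
Proof.
elim: n x => [//|n IH] x; pose H := [set x | lower_central G n.+1 (x ^ y)].
suff : lower_central G n.+1 `<=` H by exact.
apply: generated_sub.
  split; first by rewrite /H /= conj1g; exact: (subgroup1 (lower_central_subgroup n.+1)).
  move=> u v; rewrite /H /= conjMg conjVg => Hu Hv.
  by case: (lower_central_subgroup n.+1) => _; exact.
by move=> _ [u Lu [v _ <-]]; rewrite /H /= conjRg; apply: lower_central_commr; exact: IH.
Qed.

Lemma lower_centralS n : lower_central G n.+1 `<=` lower_central G n.
Proof.
apply: generated_sub; first exact: lower_central_subgroup.
move=> _ [u Lu [v _ <-]]; rewrite commgEl.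
have sL := lower_central_subgroup n.
by apply: (subgroupM sL); [exact: (subgroupV sL) | exact: lower_centralJ].
Qed.

Lemma lower_central_leq m n : (m <= n)%N -> lower_central G n `<=` lower_central G m.
Proof.
move=> /subnKC <-; elim: (n - m)%N => [|k IH]; first by rewrite addn0.
by rewrite addnS => x /lower_centralS; exact: IH.
Qed.

Lemma center_subgroup : is_subgroup (group_center G).
Proof.
split=> [x|x y Zx Zy z]; first by rewrite mul1g mulg1.
by rewrite -mulgA (_ : y^-1 * z = z * y^-1) ?mulgA ?Zx// -{1}(mulgK y z) -Zy -!mulgA mulKg.
Qed.

Lemma center_conj z y : group_center G z -> z ^ y = z.
Proof. by move=> Zz; rewrite conjgE Zz mulKg. Qed.

Lemma centerP z : group_center G z <-> forall y, [~ z, y] = 1.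
Proof.
split=> [Zz y|Zz y]; first by apply/eqP/commgP; exact: Zz.
by apply/commgP/eqP.
Qed.

End LowerCentral.

Lemma leq_expl m n e : (m <= n)%N -> (m ^ e <= n ^ e)%N.
Proof. by case: e => // e mn; rewrite leq_exp2r. Qed.

Section Growth.
Variable G : groupType.
Local Open Scope group_scope.
Implicit Types (A w : seq G) (a b : G).

Definition word_of A n w := all (mem A) w && (size w <= n)%N.

Definition poly_growth A := exists C d, forall n, exists L : seq G,
  (size L <= C * n.+1 ^ d)%N /\
  forall w, word_of A n w -> \prod_(x <- w) x \in L.

Lemma poly_growth_sub A A' : {subset A <= A'} -> poly_growth A' -> poly_growth A.
Proof.
move=> sAA' [C [d H]]; exists C, d => n; have [L [sL HL]] := H n.
exists L; split=> // w /andP[/allP Aw nw]; apply: HL; rewrite /word_of nw andbT.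
by apply/allP => x /Aw; exact: sAA'.
Qed.

(** Since [b ^ a = b * [~ b, a]], conjugating [m] times by [a] spreads [b] over
    its iterated commutators like a row of Pascal's triangle; only the first
    [c] of them are nontrivial, so the length is polynomial in [m]. *)
Lemma conj_pow_word a b c m :
  iter c (fun x => [~ x, a]) b = 1 ->
  exists2 w, word_of [seq iter j (fun x => [~ x, a]) b | j <- iota 0 c] (m.+1 ^ c) w &
    b ^ (a ^+ m) = \prod_(x <- w) x.
Proof.
elim: c b m => [|c IHc] b m /=.
  by move=> ->; exists [::]; rewrite ?big_nil ?conj1g.
move=> itc0; have itc : iter c (fun x => [~ x, a]) [~ b, a] = 1 by rewrite -iterSr.
have sub x : x \in [seq iter j (fun x => [~ x, a]) [~ b, a] | j <- iota 0 c] ->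
    x \in b :: [seq iter j (fun x => [~ x, a]) b | j <- iota 1 c].
  case/mapP=> j; rewrite mem_iota add0n => /andP[_ jc] ->; rewrite inE; apply/orP; right.
  by apply/mapP; exists j.+1; rewrite ?mem_iota ?add1n ?ltnS // iterSr.
elim: m => [|m [w /andP[/allP Aw sw] IHm]].
  by exists [:: b]; rewrite /word_of ?big_seq1 ?expg0 ?conjg1 //= !inE eqxx !exp1n.
have [w' /andP[/allP Aw' sw'] Ew'] := IHc _ m itc.
exists (w ++ w').
  apply/andP; split.
    by rewrite all_cat; apply/andP; split; apply/allP => x; [exact: Aw|move=> /Aw' /sub].
  rewrite size_cat (leq_trans (leq_add sw sw'))// expnS -mulSnr.
  by rewrite [leqRHS]expnS leq_mul// leq_expl.
rewrite big_cat/= -IHm -Ew' -conjMg expgS conjgM; congr (_ ^ _).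
by rewrite commgEl mulVKg.
Qed.

(** Moving [b] past [a ^+ k] replaces it by [b ^ (a ^+ k)], whose length is
    polynomial in [k]; so all occurrences of [a] can be pulled to the front at
    a polynomial cost. *)
Lemma collect_word a A c n w :
  (forall b, b \in A -> iter c (fun x => [~ x, a]) b = 1) ->
  word_of (a :: A) n w ->
  exists k w', [/\ (k <= n)%N,
    word_of (flatten [seq [seq iter j (fun x => [~ x, a]) b | j <- iota 0 c] | b <- A])
            (n * n.+1 ^ c) w' &
    \prod_(x <- w) x = a ^+ k * \prod_(x <- w') x].
Proof.
move=> itc; rewrite /word_of => /andP[].
elim: w n => [|x w IHw] n /=.
  by exists 0%N, [::]; split=> //; rewrite !big_nil expg0 mul1g.
case/andP=> Ax Aw; case: n => // n; rewrite ltnS => wn.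
have [k [w' [kn /andP[Aw' sw'] E]]] := IHw n Aw wn.
have le1 : (n * n.+1 ^ c <= n * n.+2 ^ c)%N by rewrite leq_mul// leq_expl.
move: Ax; rewrite inE => /predU1P[->|Ax].
  exists k.+1, w'; split; rewrite ?big_cons ?E ?mulgA ?expgS//.
  by rewrite Aw' (leq_trans sw')// (leq_trans le1)// leq_mul2r leqnSn orbT.
have [v /andP[/allP Av sv] Ev] := conj_pow_word k (itc x Ax).
exists k, (v ++ w'); split; first exact: leq_trans kn _.
  rewrite all_cat Aw' andbT size_cat; apply/andP; split.
    by apply/allP => y /Av Ay; apply/flattenP; exists [seq iter j (fun x => [~ x, a]) x | j <- iota 0 c] => //; apply/mapP; exists x.
  rewrite mulSn leq_add// ?(leq_trans sw')// (leq_trans sv)//.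
  by rewrite leq_expl // ltnS leqW.
by rewrite big_cons E big_cat/= -Ev 2!mulgA -conjgC.
Qed.

(** Once the letter [a] is collected, the remaining word has one letter fewer in
    [lower_central G k] but additional commutator letters, which lie in the next
    term; hence the two alphabets and the nested induction. *)
Lemma poly_growth_lower_central k m A1 A2 :
  (forall x, lower_central G (k + m) x -> x = 1) ->
  (forall x, x \in A1 -> lower_central G k x) ->
  (forall x, x \in A2 -> lower_central G k.+1 x) -> poly_growth (A1 ++ A2).
Proof.
elim: m k A1 A2 => [|m IHm] k A1 A2 triv.
  rewrite addn0 in triv => H1 H2; exists 1%N, 0%N => n; exists [:: 1]; split=> // w /andP[/allP Aw _].
  rewrite big_seq big1 ?inE// => x /Aw /=; rewrite mem_cat => /orP[/H1/triv//|/H2].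
  by move/lower_centralS/triv.
elim: A1 A2 => [|a A1 IHA] A2 H1 H2.
  by rewrite cat0s -[A2]cats0; apply: (IHm k.+1) => // x; rewrite addSnnS; exact: triv.
have La : lower_central G k a by apply: H1; rewrite inE eqxx.
have LA b : b \in A1 ++ A2 -> lower_central G k b.
  by rewrite mem_cat => /orP[bA|/H2 /lower_centralS//]; apply: H1; rewrite inE bA orbT.
have Lit b j : b \in A1 ++ A2 -> lower_central G (k + j) (iter j (fun x => [~ x, a]) b).
  move=> /LA Lb; elim: j => [|j IHj] /=; first by rewrite addn0.
  by rewrite addnS; exact: lower_central_commr.
have itc b : b \in A1 ++ A2 -> iter m.+1 (fun x => [~ x, a]) b = 1 by move/Lit/triv.
pose T := flatten [seq [seq iter j (fun x => [~ x, a]) b | j <- iota 1 m] | b <- A1 ++ A2].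
have [||C [d Hg]] := IHA (A2 ++ T).
- by move=> x xA; apply: H1; rewrite inE xA orbT.
- move=> x; rewrite mem_cat => /orP[/H2//|/flattenP[s /mapP[b bA ->] /mapP[j]]].
  rewrite mem_iota => /andP[j1 _] ->; have := Lit b j bA.
  by apply: lower_central_leq; rewrite -addn1 leq_add2l.
exists C, ((m.+2 * d).+1)%N => n; have [L [sL HL]] := Hg (n * n.+1 ^ m.+1)%N.
exists [seq a ^+ i * y | i <- iota 0 n.+1, y <- L]; split.
  rewrite size_allpairs size_iota expnS mulnCA leq_mul2l; apply/orP; right.
  rewrite (leq_trans sL)// leq_mul2l expnM; apply/orP; right.
  have le2 : (n * n.+1 ^ m.+1 < n.+1 ^ m.+2)%N.
    by rewrite [ltnRHS]expnS mulSnr -addn1 leq_add2l expn_gt0.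
  exact: leq_expl.
move=> w /(collect_word itc)[i [w' [leq_in Ww' ->]]].
apply/allpairsP; exists (i, \prod_(x <- w') x); split=> //=.
  by have := mem_iota 0 n.+1 i; rewrite ltnS leq_in.
apply: HL; case/andP: Ww' => /allP Aw' sw'; rewrite /word_of sw' andbT.
apply/allP => x /Aw' /= /flattenP[s /mapP[b bA ->]]; rewrite inE => /predU1P[->|/mapP[j jm ->]].
  by move: bA; rewrite !mem_cat => /orP[->|->]; rewrite ?orbT.
rewrite !mem_cat; do 2 (apply/orP; right); apply/flattenP.
by exists [seq iter j (fun x => [~ x, a]) b | j <- iota 1 m]; apply/mapP; [exists b | exists j].
Qed.

Theorem nilpotent_poly_growth A : nilpotent_group G -> poly_growth A.
Proof.
case=> n Ln; apply: (@poly_growth_sub _ (A ++ [::])).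
  by move=> x; rewrite cats0.
by apply: (@poly_growth_lower_central 0 n) => // x; rewrite add0n Ln.
Qed.

End Growth.

Section ExponentialVersusPolynomial.
Variable R : archiRealFieldType.

Lemma bernoulli (h : R) n : 0 <= h -> 1 + h *+ n <= (1 + h) ^+ n.
Proof.
move=> h0; elim: n => [|n IH]; first by rewrite mulr0n addr0 expr0.
rewrite exprS (le_trans _ (ler_wpM2l _ IH)) ?addr_ge0//.
rewrite mulrS -subr_ge0 (_ : _ - _ = h * (h *+ n)); last by ring.
by rewrite mulr_ge0// mulrn_wge0.
Qed.

Lemma exp2_unbounded (r M : R) : 1 < r -> exists k, M < r ^+ (2 ^ k).
Proof.
move=> r1; have h0 : 0 < r - 1 by rewrite subr_gt0.
pose k := Num.bound `|M / (r - 1)|; exists k.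
have Mk : M < (r - 1) *+ k.
  rewrite -mulr_natl -ltr_pdivrMr//; exact: le_lt_trans (ler_norm _) (archi_boundP (normr_ge0 _)).
rewrite -[r](subrK 1) [_ + 1]addrC (lt_le_trans _ (bernoulli _ (ltW h0)))//.
apply: (lt_le_trans Mk); rewrite -subr_ge0 -addrA -mulrnBr ?(ltnW (ltn_expl _ _))//.
by rewrite addr_ge0// mulrn_wge0 ?ltW.
Qed.

(** Stated along powers of two because the C*-identity iterates by squaring. *)
Lemma exp_beats_poly (r C : R) d : 1 < r -> 0 <= C ->
  exists k, C * (2 ^ k).+1%:R ^+ d < r ^+ (2 ^ k).
Proof.
(* At [k = j + i] the left side is at most a constant times [2 ^ (i * d)], while
   the right side is at least [2 ^ ((i + 1) * (d + 1))]. *)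
move=> r1 C0; have [j Hj] := exp2_unbounded (2 ^+ d.+1) r1.
have two_gt1 : 1 < 2 :> R by rewrite ltr1n.
have [i Hi] : exists i, C * (2 ^+ j.+1) ^+ d < 2 ^+ i :> R.
  by have [i Hi] := exp2_unbounded (C * (2 ^+ j.+1) ^+ d) two_gt1; exists (2 ^ i)%N.
exists (j + i)%N.
have le1 : (2 ^ (j + i)).+1%:R <= 2 ^+ j.+1 * 2 ^+ i :> R.
  rewrite -exprD -natrX ler_nat addSn expnS mul2n -addnn -addn1 leq_add2l.
  by rewrite expn_gt0.
have r1' : 1 < r ^+ (2 ^ j) by apply: lt_trans Hj; exact: exprn_egt1.
have le2 : (2 ^+ d.+1) ^+ i.+1 <= r ^+ (2 ^ (j + i)).
  rewrite expnD exprM; apply: (@le_trans _ _ ((r ^+ (2 ^ j)) ^+ i.+1)).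
    by rewrite lerXn2r ?nnegrE ?exprn_ge0 ?(ltW Hj)// ltW// (lt_trans ltr01 r1).
  by rewrite ler_eXn2l// ltn_expl.
apply: lt_le_trans le2; apply: (@le_lt_trans _ _ (C * (2 ^+ j.+1 * 2 ^+ i) ^+ d)).
  by rewrite ler_wpM2l// lerXn2r ?nnegrE// mulr_ge0.
have -> : (2 ^+ d.+1) ^+ i.+1 = 2 ^+ i * (2 ^+ i) ^+ d * 2 ^+ d.+1 :> R.
  by rewrite -!exprM -!exprD; congr (_ ^+ _); lia.
rewrite exprMn mulrA (@lt_le_trans _ _ (2 ^+ i * (2 ^+ i) ^+ d))//.
  by rewrite ltr_pM2r ?exprn_gt0// ?exprn_gt0.
by rewrite ler_peMr ?mulr_ge0 ?exprn_ge0// exprn_ege1// ltW.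
Qed.

End ExponentialVersusPolynomial.

Section Balls.
Variables (G : groupType) (S : seq G).
Local Open Scope group_scope.

Fixpoint ball n : seq G :=
  if n is m.+1 then undup (ball m ++ [seq x * s | x <- ball m, s <- S]) else [:: 1].

Lemma ball_uniq n : uniq (ball n).
Proof. by case: n => // n; exact: undup_uniq. Qed.

Lemma ball_sub n : {subset ball n <= ball n.+1}.
Proof. by move=> x Bx /=; rewrite mem_undup mem_cat Bx. Qed.

Lemma ball_mul n x s : x \in ball n -> s \in S -> x * s \in ball n.+1.
Proof.
move=> Bx Ss /=; rewrite mem_undup mem_cat; apply/orP; right.
by apply/allpairsP; exists (x, s).
Qed.

Lemma ball_word n x : x \in ball n ->
  exists2 w, word_of S n w & x = \prod_(y <- w) y.
Proof.
elim: n x => [|n IH] x /=.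
  by rewrite inE => /eqP ->; exists [::]; rewrite ?big_nil.
rewrite mem_undup mem_cat => /orP[/IH[w /andP[Aw sw] ->]|].
  by exists w; rewrite // /word_of Aw ltnW.
case/allpairsP=> -[y s] /= [/IH[w /andP[Aw sw] ->] Ss ->].
exists (rcons w s); first by rewrite /word_of all_rcons Aw size_rcons /= Ss.
by rewrite -cats1 big_cat big_seq1.
Qed.

Lemma size_ball_gt0 n : (0 < size (ball n))%N.
Proof.
elim: n => // n IH; rewrite (leq_trans IH)//.
exact: uniq_leq_size (ball_uniq n) (@ball_sub n).
Qed.

(** Polynomially growing balls cannot all grow by a factor [(k + 2) / (k + 1)],
    so some of them are almost invariant under right translation. *)
Lemma ball_folner : poly_growth S ->
  forall k, exists n, (k.+1 * size (ball n.+1) <= k.+2 * size (ball n))%N.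
Proof.
move=> [C [d Hg]] k; apply: contrapT => /forallNP Hn.
have grow n : (k.+2 ^ n <= k.+1 ^ n * size (ball n))%N.
  elim: n => // n IH; rewrite [(k.+1 ^ _)%N]expnSr -mulnA.
  have := Hn n; move/negP; rewrite -ltnNge => /ltnW Hn'.
  rewrite (leq_trans _ (leq_mul (leqnn _) Hn'))// expnS mulnCA leq_mul//.
have r1 : (1 < k.+2%:R / k.+1%:R :> rat)%R.
  by rewrite ltr_pdivlMr ?ltr0n// mul1r ltr_nat.
have [j] := exp_beats_poly d r1 (ler0n _ C).
rewrite expr_div_n ltr_pdivlMr ?exprn_gt0 ?ltr0n// -!natrX -!natrM ltr_nat ltnNge.
move=> /negP; apply; set n := (2 ^ j)%N.
rewrite (leq_trans (grow n))// mulnC leq_mul2r; apply/orP; right.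
have [L [sL HL]] := Hg n; apply: leq_trans sL; apply: uniq_leq_size; first exact: ball_uniq.
by move=> x /ball_word[w Ww ->]; exact: HL.
Qed.

End Balls.

Lemma sum_const_seq (V : nmodType) (I : Type) (s : seq I) (c : V) :
  \sum_(x <- s) c = c *+ size s.
Proof. by rewrite big_const_seq count_predT iter_addr_0. Qed.

Lemma sum_subset_dist (C : numDomainType) (T : eqType) (f : T -> C) (M : C) (L B : seq T) :
  uniq L -> uniq B -> {subset L <= B} -> (forall x, `|f x| <= M) ->
  `|\sum_(x <- B) f x - \sum_(x <- L) f x| <= M *+ (size B - size L).
Proof.
move=> uL uB sLB fM.
have pB : perm_eq B (L ++ [seq x <- B | x \notin L]).
  apply: uniq_perm => //.
    rewrite cat_uniq uL filter_uniq// andbT; apply/hasPn => x.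
    by rewrite mem_filter => /andP[].
  by move=> x; rewrite mem_cat mem_filter; case: (boolP (x \in L)) => //= /sLB.
rewrite (perm_big _ pB) big_cat/= [X in `|X|]addrC addKr (perm_size pB) size_cat addKn.
rewrite (le_trans (ler_norm_sum _ _ _))// -sum_const_seq.
by apply: ler_sum => x _; exact: fM.
Qed.

(** Both sums differ from the sum over the larger ball [ball S n.+1], which
    contains the ball and its translate, by at most [M] per new point. *)
Lemma ball_shift (C : numDomainType) (G : groupType) (S : seq G) (f : G -> C) (M : C) n s :
  s \in S -> (forall x, `|f x| <= M) ->
  `|\sum_(x <- ball S n) f (x * s)%g - \sum_(x <- ball S n) f x| <=
    M *+ (size (ball S n.+1) - size (ball S n)) *+ 2.
Proof.
move=> Ss fM; set B := ball S n; set B' := ball S n.+1.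
have d1 := sum_subset_dist (ball_uniq S n) (ball_uniq S n.+1) (@ball_sub _ S n) fM.
have uBs : uniq [seq (x * s)%g | x <- B] by rewrite map_inj_uniq ?ball_uniq//; exact: mulIg.
have sBs : {subset [seq (x * s)%g | x <- B] <= B'}.
  by move=> _ /mapP[x Bx ->]; exact: ball_mul.
have d2 := sum_subset_dist uBs (ball_uniq S n.+1) sBs fM.
rewrite big_map size_map in d2; rewrite mulr2n (le_trans _ (lerD d1 d2))//.
rewrite (le_trans _ (ler_normB _ _))// opprB [X in _ <= `|X|]addrC.
by rewrite [X in _ <= `|X|]addrA subrK.
Qed.

(** * Subgroups of finitely generated nilpotent groups *)

Section IntegerPowers.
Variable G : groupType.
Local Open Scope group_scope.
Implicit Types (t x : G) (k l : int).

Definition zpow t k : G := match k with Posz n => t ^+ n | Negz n => t ^- n.+1 end.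

Lemma zpow1 t : zpow t 1 = t.
Proof. by []. Qed.

Lemma zpowS t k : zpow t (k + 1)%R = zpow t k * t.
Proof.
case: k => [n|[|n]].
- by rewrite (_ : (Posz n + 1)%R = Posz n.+1) ?[LHS]expgSr//; lia.
- by rewrite (_ : (Negz 0 + 1)%R = 0) //= expg1 mulVg.
- rewrite (_ : (Negz n.+1 + 1)%R = Negz n); last by lia.
  by rewrite /= [t ^+ n.+2]expgS invgM mulgVK.
Qed.

Lemma zpowP t k : zpow t (k - 1)%R = zpow t k * t^-1.
Proof. by rewrite -{2}[k](subrK 1%R) zpowS mulgK. Qed.

Lemma zpowD t k l : zpow t (k + l)%R = zpow t k * zpow t l.
Proof.
elim/int_ind: l => [|n IH|n IH]; first by rewrite addr0 mulg1.
  by rewrite -addn1 PoszD addrA !zpowS IH mulgA.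
by rewrite -addn1 PoszD opprD addrA !zpowP IH mulgA.
Qed.

Lemma zpowN t k : zpow t (- k)%R = (zpow t k)^-1.
Proof. by apply/eqP; rewrite -mulg_eq1 -zpowD addNr. Qed.

Lemma subgroup_zpow (H : set G) t k : is_subgroup H -> H t -> H (zpow t k).
Proof.
move=> sH Ht; case: k => n /=; first exact: subgroupX.
by apply: subgroupV => //; exact: subgroupX.
Qed.

End IntegerPowers.

Section Noetherian.
Variable G : groupType.
Local Open Scope group_scope.
Implicit Types (M L H K : set G) (t x y : G) (l : seq G) (k : int).

Definition fg_subgroup H := exists l, generated_subgroup [set` l] = H.

Definition noetherian_subgroup M :=
  is_subgroup M /\ forall L, is_subgroup L -> L `<=` M -> fg_subgroup L.

Section Extend.
Variables (M : set G) (t : G).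
Hypotheses (sM : is_subgroup M) (nM : forall x y, M x -> M (x ^ y)).

Let D x k := M (x * zpow t k).

Let D1 : D 1 0.
Proof. by rewrite /D mul1g; exact: subgroup1. Qed.

Let DM x y k (l : int) : D x k -> D y l -> D (x * y) (l + k)%R.
Proof.
rewrite /D => Dx Dy; rewrite zpowD.
have -> : x * y * (zpow t l * zpow t k) = x * zpow t k * (y * zpow t l) ^ (zpow t k).
  by rewrite conjgE !mulgA mulgK.
by apply: subgroupM => //; exact: nM.
Qed.

Let DV x k : D x k -> D x^-1 (- k)%R.
Proof.
rewrite /D zpowN => Dx.
have -> : x^-1 * (zpow t k)^-1 = ((x * zpow t k) ^ x)^-1.
  by rewrite conjgE -mulgA mulKg invgM.
by apply: subgroupV => //; exact: nM.
Qed.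

Let Dzpow x k n : D x k -> D (zpow x n) (n * k)%R.
Proof.
move=> Dx; elim/int_ind: n => [|n IH|n IH]; first by rewrite mul0r.
  by rewrite -addn1 PoszD zpowS mulrDl mul1r addrC; exact: DM.
rewrite -addn1 PoszD opprD zpowP mulrBl mul1r addrC.
exact: DM (DV Dx).
Qed.

Let N : set G := [set x | exists k, D x k].

Let sN : is_subgroup N.
Proof.
split; first by exists 0%R.
by move=> x y [k Dx] [l Dy]; eexists; apply: DM Dx _; exact: DV Dy.
Qed.

(** A subgroup [L] of the group generated by [M] and [t] is generated by
    [L `&` M] and one element whose exponent in [t] is minimal and positive. *)
Lemma subgroup_adjoin : noetherian_subgroup M ->
  exists M', [/\ noetherian_subgroup M', M `<=` M', M' t &
    forall K, is_subgroup K -> M `<=` K -> K t -> M' `<=` K].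
Proof.
move=> [_ nthM]; exists N; split.
- split=> // L sL LN.
  have sLM : is_subgroup (L `&` M).
    split; first by split; exact: subgroup1.
    by move=> x y [Lx Mx] [Ly My]; split; [case: sL|case: sM] => _; exact.
  have [l El] : fg_subgroup (L `&` M) by apply: nthM => // x [].
  have Ll x : x \in l -> L x /\ M x.
    by move=> xl; suff : (L `&` M) x by []; rewrite -El; exact: sub_generated.
  have genLM K x : is_subgroup K -> {subset l <= K} -> L x -> M x -> K x.
    move=> sK lK Lx Mx; have : generated_subgroup [set` l] x by rewrite El.
    by apply: generated_sub => // y /lK; rewrite inE.
  have [[d [d0 [y0 [Ly0 Dy0]]]]|noD] := pselect (exists n, (0 < n)%N /\ exists y, L y /\ D y n%:Z).
    have exd : exists n, `[< (0 < n)%N /\ exists y, L y /\ D y n%:Z >].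
      by exists d; apply/asboolP; split=> //; exists y0.
    case: (ex_minnP exd) => {d0 y0 Ly0 Dy0}d' /asboolP[d0 [y0 [Ly0 Dy0]]] min.
    exists (y0 :: l); apply/seteqP; split.
      by apply: generated_sub => // y /=; rewrite inE => /predU1P[->//|/Ll[]].
    move=> y Ly; have [k Dy] := LN _ Ly.
    have sg := generated_is_subgroup [set` y0 :: l].
    have gy0 : generated_subgroup [set` y0 :: l] y0 by apply: sub_generated; rewrite /= inE eqxx.
    pose q := (k %/ d'%:Z)%Z.
    have Dr : D (y * zpow y0 (- q)) (k %% d'%:Z)%Z.
      have -> : (k %% d'%:Z)%Z = (- q * d'%:Z + k)%R.
        by rewrite {2}(divz_eq k d') mulNr addKr.
      by apply: DM => //; exact: Dzpow.
    have Lr : L (y * zpow y0 (- q)) by apply: subgroupM => //; exact: subgroup_zpow.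
    have r0 : (k %% d'%:Z)%Z = 0.
      apply/eqP; apply: contrapT => /negP rn0.
      have rge : (0 <= k %% d'%:Z)%Z%R by rewrite modz_ge0// eqz_nat -lt0n.
      have rlt : (k %% d'%:Z < d'%:Z)%Z%R by rewrite ltz_pmod.
      case: (k %% d'%:Z)%Z rge rlt rn0 Dr => // r _ rd rn0 Dr.
      have : (d' <= r)%N.
        by apply: min; apply/asboolP; split; [rewrite lt0n|exists (y * zpow y0 (- q))].
      by rewrite leqNgt -ltz_nat rd.
    rewrite -(mulgK (zpow y0 (- q)) y); apply: (subgroupM sg).
      apply: genLM => //; last by move: Dr; rewrite r0 /D mulg1.
      by move=> x xl; rewrite inE; apply: sub_generated; rewrite /= inE xl orbT.
    by apply: (subgroupV sg); exact: (subgroup_zpow _ sg).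
  exists l; rewrite El; apply/seteqP; split=> [x []//|x Lx]; split=> //.
  have [k Dx] := LN _ Lx; case: k Dx => [[|n] Dx|n Dx].
  + by move: Dx; rewrite /D mulg1.
  + by case: noD; exists n.+1; split=> //; exists x.
  + case: noD; exists n.+1; split=> //; exists x^-1; split; first exact: subgroupV.
    by move/DV: Dx; rewrite NegzE opprK.
- by move=> x Mx; exists 0%R; rewrite /D mulg1.
- by exists (-1)%R; rewrite /D zpowN zpow1 mulgV; exact: subgroup1.
- move=> K sK MK Kt x [k Dx]; rewrite -(mulgK (zpow t k) x).
  by case: (sK) => _; apply; [exact: MK|exact: subgroup_zpow].
Qed.

End Extend.

End Noetherian.

Section NilpotentNoetherian.
Variable G : groupType.
Local Open Scope group_scope.
Implicit Types (M L H K Q : set G) (t x y : G) (l : seq G).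

Lemma commMg_conj x y z : [~ x * y, z] = [~ x, z] ^ y * [~ y, z].
Proof. rewrite !commgEl conjMg invgM [(x^-1 * _) ^ y]conjgE !mulgA.
by rewrite !mulgK. Qed.

Lemma commgM_conj x y z : [~ x, y * z] = [~ x, z] * [~ x, y] ^ z.
Proof. by rewrite !commgEl conjgM [in RHS]conjMg conjVg -mulgA mulVKg. Qed.

Lemma commVg_conj x z : [~ x^-1, z] = ([~ x, z]^-1) ^ x^-1.
Proof. by rewrite conjVg; apply/esym/mulg1_eq; rewrite -commMg_conj mulgV comm1g. Qed.

Lemma commgV_conj x z : [~ x, z^-1] = ([~ x, z]^-1) ^ z^-1.
Proof.
by apply/eqP; rewrite conjVg -mulg_eq1 -commgM_conj mulgV commg1.
Qed.

(** Commutation is bimultiplicative modulo the next term, so generators of one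
    factor of the series, commuted with generators of [G], generate the next
    factor. *)
Lemma lower_central_fg_mod m : finitely_generated G ->
  exists X : seq G, (forall x, x \in X -> lower_central G m x) /\
    forall H, is_subgroup H -> lower_central G m.+1 `<=` H ->
      {subset X <= H} -> lower_central G m `<=` H.
Proof.
move=> [A [/finite_seqP[S ->] genS]]; elim: m => [|m [X [XL genX]]].
  exists S; split=> // H sH _ SH; rewrite /= -genS.
  by apply: generated_sub => // x /SH; rewrite inE.
exists [seq [~ x, s] | x <- X, s <- S]; split.
  by move=> _ /allpairsP[[x s] /= [/XL Lx _ ->]]; exact: lower_central_commr.
move=> H sH LH XH; pose Q := H `&` lower_central G m.+1.
have sL := lower_central_subgroup G m; have sL1 := lower_central_subgroup G m.+1.
have sQ : is_subgroup Q.
  split; first by split; exact: subgroup1.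
  by move=> x y [Hx Lx] [Hy Ly]; split; [case: sH|case: sL1] => _; exact.
have nQ x y : Q x -> Q (x ^ y).
  move=> [Hx Lx]; split; last exact: lower_centralJ.
  rewrite -[x ^ y](mulVKg x) -commgEl; apply: subgroupM => //.
  by apply: LH; exact: lower_central_commr.
have QX x s : x \in X -> s \in S -> Q [~ x, s].
  move=> xX sS; split; last exact: lower_central_commr (XL _ xX).
  suff : [~ x, s] \in H by rewrite inE.
  by apply: XH; apply/allpairsP; exists (x, s).
have QS s x : s \in S -> lower_central G m x -> Q [~ x, s].
  move=> sS; pose K := [set x | lower_central G m x /\ Q [~ x, s]].
  suff LK : lower_central G m `<=` K by move=> /LK[].
  apply: genX.
  - split; first by split; [exact: subgroup1|rewrite comm1g; exact: subgroup1].
    move=> x' y' [Lx Qx] [Ly Qy]; split; first by case: sL => _; exact.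
    rewrite commMg_conj; apply: subgroupM => //; first exact: nQ.
    by rewrite commVg_conj; apply: (nQ); exact: subgroupV.
  - move=> y Ly; split; first exact: lower_centralS.
    by split; [apply: LH|]; apply: lower_central_commr => //; exact: lower_centralS.
  - by move=> y yX; rewrite inE; split; [exact: XL|exact: QX].
suff QG y x : lower_central G m x -> Q [~ x, y].
  by apply: generated_sub => // _ [x Lx [y _ <-]]; case: (QG y x Lx).
pose K := [set y | forall x, lower_central G m x -> Q [~ x, y]].
suff : K y by exact.
have : [set: G] y by [].
rewrite -genS; apply: generated_sub => [|s /= sS u]; last exact: QS.
split; first by move=> u _; rewrite commg1; exact: subgroup1.
move=> s s' Ks Ks' u Lu; rewrite commgM_conj; apply: subgroupM => //.
  have := nQ _ s'^-1 (subgroupV sQ (Ks' u Lu)).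
  by rewrite -commgV_conj.
by apply: nQ; exact: Ks.
Qed.

(** Each factor of the series is generated by finitely many elements, which are
    adjoined to the next term one at a time; a subgroup between
    two consecutive terms is normalized by the larger one. *)
Lemma lower_central_noetherian k m : finitely_generated G ->
  lower_central G (m + k) `<=` [set 1] ->
  noetherian_subgroup (lower_central G m).
Proof.
move=> fgG; elim: k m => [|k IH] m triv.
  rewrite addn0 in triv; split=> [|L sL LL]; first exact: lower_central_subgroup.
  exists [::]; apply/seteqP; split; first exact: generated_sub.
  by move=> x /LL/triv ->; exact: subgroup1 (generated_is_subgroup _).
have [X [XL genX]] := lower_central_fg_mod m fgG.
have nth1 : noetherian_subgroup (lower_central G m.+1) by apply: IH; rewrite addSnnS.
have [M [nthM L1M ML XM]] : exists M, [/\ noetherian_subgroup M,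
    lower_central G m.+1 `<=` M, M `<=` lower_central G m & {subset X <= M}].
  elim: X XL {genX} => [|x X IHX] XL.
    by exists (lower_central G m.+1); split=> //; exact: lower_centralS.
  have [y yX|M [nthM L1M ML XM]] := IHX; first by apply: XL; rewrite inE yX orbT.
  have sM : is_subgroup M by case: nthM.
  have nM u v : M u -> M (u ^ v).
    move=> Mu; rewrite -[u ^ v](mulVKg u) -commgEl; apply: subgroupM => //.
    by apply: L1M; apply: lower_central_commr; exact: ML.
  have [M' [nthM' MM' M'x minM']] := subgroup_adjoin x sM nM nthM.
  exists M'; split=> //; first exact: subset_trans MM'.
    apply: minM' => //; first exact: lower_central_subgroup.
    by apply: XL; rewrite inE eqxx.
  by move=> y; rewrite inE => /predU1P[->|/XM]; rewrite !inE// => /MM'.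
suff -> : lower_central G m = M by [].
by apply/seteqP; split=> //; apply: genX => //; case: nthM.
Qed.

Theorem nilpotent_subgroup_fg L : finitely_generated G -> nilpotent_group G ->
  is_subgroup L -> fg_subgroup L.
Proof.
move=> fgG [n Ln] sL; have [|_ nth] := @lower_central_noetherian n 0 fgG.
  by rewrite add0n Ln.
exact: nth.
Qed.

End NilpotentNoetherian.

(** * Free abelian subgroups of finite index in the center *)

Section Circle.
Variable R : realType.
Local Open Scope complex_scope.

Definition cis (t : R) : R[i] := cos t +i* sin t.

Lemma cis0 : cis 0 = 1.
Proof. by rewrite /cis cos0 sin0. Qed.

Lemma cisD s t : cis (s + t) = cis s * cis t.
Proof.
apply/eqP; rewrite eq_complex /= cosD sinD; apply/andP; split; apply/eqP; ring.
Qed.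

Lemma cis_norm t : `|cis t| = 1.
Proof. by rewrite normc_def /= cos2Dsin2 sqrtr1. Qed.

Lemma cis_surj (z : R[i]) : `|z| = 1 -> exists t, z = cis t.
Proof.
case: z => a b z1.
have ab1 : a ^+ 2 + b ^+ 2 = 1.
  by have := add_Re2_Im2 (a +i* b); rewrite z1 expr1n => -[].
have a1 : -1 <= a <= 1 by have := sqr_ge0 b; nra.
have aI : a \in `[-1, 1] by rewrite in_itv.
have b2 : Num.sqrt (1 - a ^+ 2) = `|b| by rewrite -ab1 addrC addKr sqrtr_sqr.
have [b0|b0] := leP 0 b.
  by exists (acos a); rewrite /cis acosK// sin_acos// b2 ger0_norm.
by exists (- acos a); rewrite /cis cosN sinN acosK// sin_acos// b2 ltr0_norm// opprK.
Qed.

End Circle.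

Section FreeAbelian.
Variables (R : realType) (G : groupType).
Local Open Scope group_scope.
Implicit Types (M H K N : set G) (t x y z : G) (l : seq G).

(** Characters of [N] lift to the universal cover of the circle. For a central
    subgroup this property stands in for being free abelian: it is what deforms
    a character to the trivial one. *)
Definition circle_liftable N := forall w : G -> R[i],
  (forall x, N x -> `|w x| = 1)%R ->
  (forall x y, N x -> N y -> w (x * y)%g = w x * w y)%R ->
  exists th : G -> R, (forall x y, N x -> N y -> th (x * y)%g = th x + th y)%R /\
    forall x, N x -> w x = cis (th x).

Section AdjoinFree.
Variables (N : set G) (z : G).
Hypotheses (sN : is_subgroup N) (NZ : N `<=` group_center G) (Zz : group_center G z).
Hypotheses (freez : forall n, (0 < n)%N -> ~ N (z ^+ n)).

Let D x (k : int) := N (x * (zpow z k)^-1).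

Let Zpow k : group_center G (zpow z k).
Proof. exact: (subgroup_zpow _ (center_subgroup G)). Qed.

Let free_zpow k : N (zpow z k) -> k = 0.
Proof.
case: k => [[|n]|n] //= Nz; first by case: (@freez n.+1).
by case: (@freez n.+1) => //; rewrite -[z ^+ _]invgK; exact: subgroupV.
Qed.

Let Duniq x (k l : int) : D x k -> D x l -> k = l.
Proof.
move=> Dk Dl; apply/eqP; rewrite -subr_eq0; apply/eqP/free_zpow.
have : N ((x * (zpow z k)^-1)^-1 * (x * (zpow z l)^-1)).
  by apply: subgroupM => //; exact: subgroupV.
by rewrite invgM invgK -mulgA mulKg zpowD zpowN.
Qed.

Let DM x y (k l : int) : D x k -> D y l -> D (x * y) (k + l)%R.
Proof.
rewrite /D => Dx Dy; rewrite zpowD invgM.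
have -> : x * y * ((zpow z l)^-1 * (zpow z k)^-1) = x * (zpow z k)^-1 * (y * (zpow z l)^-1).
  rewrite -!mulgA; congr (_ * _); rewrite mulgA.
  by have := Zpow (- k)%R; rewrite zpowN => Zk; rewrite [RHS]Zk.
exact: subgroupM.
Qed.

Let DV x k : D x k -> D x^-1 (- k)%R.
Proof.
rewrite /D zpowN invgK => Dx; have Zk := Zpow k.
by rewrite -Zk -[zpow z k]invgK -invgM; exact: subgroupV.
Qed.

Let N' : set G := [set x | exists k, D x k].

(** The group generated by [N] and [z] is the direct product of [N] with an
    infinite cyclic group, so a lift of a character of [N] is extended by any
    angle of its value at [z], multiplied by the exponent of [z]. *)
Lemma free_adjoin : torsion_free N -> circle_liftable N ->
  exists M, [/\ is_subgroup M, M `<=` group_center G, N `<=` M /\ M z,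
    torsion_free M & circle_liftable M].
Proof.
move=> tfN liftN; exists N'.
have N'N : N `<=` N' by move=> x Nx; exists 0%R; rewrite /D invg1 mulg1.
have D0 x : N x -> D x 0 by rewrite /D invg1 mulg1.
have Dz : D z 1 by rewrite /D zpow1 mulgV; exact: subgroup1.
have sN' : is_subgroup N'.
  split; first by apply: N'N; exact: subgroup1.
  by move=> x y [k Dx] [l Dy]; eexists; apply: DM Dx _; exact: DV Dy.
split=> //.
- move=> x [k Dx]; rewrite -(mulgVK (zpow z k) x).
  by apply: (subgroupM (center_subgroup G)) => //; exact: NZ.
- by split=> //; exists 1%R.
- move=> x n [k Dx] n0 xn1.
  have Dn : D (x ^+ n) (k * n%:Z)%R.
    elim: n {n0 xn1} => [|n IH]; first by rewrite mulr0 expg0; apply: D0; exact: subgroup1.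
    by rewrite expgSr -addn1 PoszD mulrDr mulr1; exact: DM.
  have k0 : k = 0.
    have := Duniq Dn; rewrite xn1 => /(_ 0%R (D0 _ (subgroup1 sN))) /eqP.
    by rewrite mulf_eq0 eqz_nat (gtn_eqF n0) orbF => /eqP.
  by apply: tfN n0 xn1; move: Dx; rewrite k0 /D invg1 mulg1.
- move=> w w1 wM.
  have [th [thD thE]] := liftN w (fun x Nx => w1 x (N'N x Nx))
    (fun x y Nx Ny => wM x y (N'N x Nx) (N'N y Ny)).
  have [t tE] := cis_surj (w1 z (ex_intro _ 1%R Dz)).
  pose deg x := xget 0%R [set k | D x k].
  have degP x k : D x k -> deg x = k.
    by move=> Dx; apply: (Duniq _ Dx); rewrite /deg; case: xgetP => [l _ //|/(_ k)].
  pose ph x := (th (x * (zpow z (deg x))^-1)%g + t *~ deg x)%R.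
  have N'z k : N' (zpow z k) by apply: subgroup_zpow => //; exists 1%R.
  have wz k : w (zpow z k) = cis (t *~ k).
    have wS (l : int) : w (zpow z (l + 1)%R) = (w (zpow z l) * cis t)%R by rewrite zpowS -tE wM//; exists 1%R.
    elim/int_ind: k => [|n IH|n IH].
    + rewrite mulr0z cis0; apply: (mulfI (_ : w (zpow z 0) != 0)%R).
        by rewrite -normr_eq0 w1 ?oner_eq0.
      by rewrite -wM// mulr1 -zpowD.
    + by rewrite -addn1 PoszD wS IH -cisD mulrzDr mulr1z.
    + apply: (mulIf (_ : cis t != 0)%R); first by rewrite -normr_eq0 cis_norm oner_eq0.
      rewrite -wS -cisD -{2}[t]mulr1z -mulrzDr.
      by rewrite (_ : (- n.+1%:Z + 1)%R = (- n%:Z)%R) ?IH//; lia.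
  exists ph; split=> [x y [k Dx] [l Dy]|x [k Dx]].
    rewrite /ph (degP _ _ Dx) (degP _ _ Dy) (degP _ _ (DM Dx Dy)) mulrzDr.
    rewrite addrACA -thD//; congr (th _ + _)%R; rewrite zpowD invgM.
    rewrite -!mulgA; congr (_ * _); rewrite mulgA.
    by have := Zpow (- k)%R; rewrite zpowN => Zk; rewrite [RHS]Zk.
  rewrite /ph (degP _ _ Dx) cisD -thE// -wz -wM ?mulgVK//.
  exact: N'N.
Qed.

End AdjoinFree.

(** Adjoin an element of [l] only when it has no power in the group built so
    far. *)
Lemma free_subgroup_exists l : {subset l <= group_center G} ->
  exists N, [/\ is_subgroup N, N `<=` group_center G, torsion_free N,
    circle_liftable N & forall z, z \in l -> exists2 n, (0 < n)%N & N (z ^+ n)].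
Proof.
elim: l => [|z l IH] lZ.
  exists [set 1]; split=> //.
  - by split=> // x y -> ->; rewrite divg1.
  - by move=> x ->; exact: subgroup1 (center_subgroup G).
  - move=> w w1 wM; exists (fun=> 0%R); split=> [x y _ _|x ->]; first by rewrite addr0.
    rewrite cis0; apply: (mulfI (_ : w 1%g != 0)%R); first by rewrite -normr_eq0 w1 ?oner_eq0.
    by rewrite -wM// mulr1 mulg1.
have [y yl|N [sN NZ tfN liftN Nl]] := IH; first by apply: lZ; rewrite inE yl orbT.
have [[n [n0 Nzn]]|nz] := pselect (exists n, (0 < n)%N /\ N (z ^+ n)).
  exists N; split=> // y; rewrite inE => /predU1P[->|/Nl//]; by exists n.
have Zz : group_center G z by have := lZ z (mem_head _ _); rewrite inE.
have [M [sM MZ [NM Mz] tfM liftM]] : exists M, [/\ is_subgroup M, M `<=` group_center G,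
    N `<=` M /\ M z, torsion_free M & circle_liftable M].
  apply: (@free_adjoin N z) => // n n0 Nzn; apply: nz; by exists n.
exists M; split=> // y; rewrite inE => /predU1P[->|/Nl[n n0 Nyn]]; first by exists 1%N.
by exists n => //; exact: NM.
Qed.

(** Unlike [finite_index], this makes sense for sets [X] that are not subgroups,
    such as supports and conjugacy classes. *)
Definition finite_mod N (X : set G) :=
  exists T : seq G, forall x, X x -> exists2 t, t \in T & N (x * t^-1).

Lemma finite_mod_sub N (X Y : set G) : X `<=` Y -> finite_mod N Y -> finite_mod N X.
Proof. by move=> XY [T HT]; exists T => x /XY /HT. Qed.

Lemma finite_mod_index N H : is_subgroup N -> N `<=` group_center G ->
  finite_mod N H -> finite_index N H.
Proof.
move=> sN NZ [T HT]; apply: (@sub_finite_set _ _ [set [set t * a | a in N] | t in [set` T]]).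
  move=> _ [x Hx <-]; have [t tT Nxt] := HT x Hx; exists t => //.
  have xE : x = t * (x * t^-1) by rewrite -(NZ _ Nxt) mulgVK.
  apply/seteqP; split=> _ [a Na <-].
    exists ((x * t^-1)^-1 * a); first by apply: subgroupM => //; exact: subgroupV.
    by rewrite {1}xE -mulgA mulVKg.
  exists (x * t^-1 * a); first exact: subgroupM.
  by rewrite mulgA -xE.
by apply: finite_image; exact: finite_seq.
Qed.

Lemma finite_mod_trans K N (X : set G) : is_subgroup N ->
  finite_mod K X -> finite_mod N K -> finite_mod N X.
Proof.
move=> sN [T HT] [T' HT']; exists [seq t' * t | t' <- T', t <- T] => x /HT[t tT /HT'[t' t'T' Nt]].
by exists (t' * t); [apply/allpairsP; exists (t', t)|rewrite invgM mulgA].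
Qed.

Lemma finite_mod_fibres N (X : set G) (I : eqType) (L : seq I) (f : G -> I) :
  (forall x, X x -> f x \in L) ->
  (forall x y, X x -> X y -> f x = f y -> N (x * y^-1)) -> finite_mod N X.
Proof.
move=> fL fN; pose r i := xget 1 [set x | X x /\ f x = i].
exists (map r L) => x Xx; exists (r (f x)); first by apply: map_f; exact: fL.
rewrite /r; case: xgetP => [y _ [Xy fyx]|/(_ x)[]//].
by apply: fN.
Qed.

(** Each generator contributes finitely many cosets, since its exponent can be
    reduced modulo one that lies in [N]. *)
Lemma finite_mod_powers N l : is_subgroup N -> N `<=` group_center G ->
  {subset l <= group_center G} ->
  (forall z, z \in l -> exists2 n, (0 < n)%N & N (z ^+ n)) ->
  generated_subgroup [set` l] = group_center G -> finite_mod N (group_center G).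
Proof.
move=> sN NZ lZ lN genZ.
suff [M [sM lM fM]] : exists M, [/\ is_subgroup M, {subset l <= M}, finite_mod N M &
    N `<=` M /\ M `<=` group_center G].
  move=> _; apply: finite_mod_sub fM; rewrite -genZ; apply: generated_sub => // x /= xl.
  by have := lM x xl; rewrite inE.
elim: l lZ lN {genZ} => [|z l IH] lZ lN.
  have fNN : finite_mod N N.
    by exists [:: 1] => x Nx; exists 1; rewrite ?inE ?invg1 ?mulg1.
  by exists N; do 2!split=> //.
have [y yl|y yl|M [sM lM [T HT] [NM MZ]]] := IH; first by apply: lZ; rewrite inE yl orbT.
  by apply: lN; rewrite inE yl orbT.
have [m m0 Nzm] := lN z (mem_head _ _).
have Zz : group_center G z by have := lZ z (mem_head _ _); rewrite inE.
have Zzn n : group_center G (z ^+ n) by exact: (subgroupX n (center_subgroup G)).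
pose M' : set G := [set x | exists y n, M y /\ x = y * z ^+ n].
have red x : M' x -> exists y n, [/\ M y, (n < m)%N & x = y * z ^+ n].
  move=> [y [n [My ->]]]; exists (y * (z ^+ m) ^+ (n %/ m)), (n %% m)%N.
  split; first by apply: subgroupM => //; apply: subgroupX => //; exact: NM.
    by rewrite ltn_mod.
  by rewrite -mulgA -expgnA -expgnDr mulnC -divn_eq.
have MM' : M `<=` M' by move=> x Mx; exists x, 0%N; rewrite expg0 mulg1.
have sM' : is_subgroup M'.
  split; first by apply: MM'; exact: subgroup1.
  move=> _ _ /red[x [n [Mx nm ->]]] /red[y [k [My km ->]]].
  exists (x * y^-1 * (z ^+ m)^-1), (n + (m - k))%N; split.
    apply: subgroupM => //; first by apply: subgroupM => //; exact: subgroupV.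
    by apply: subgroupV => //; exact: NM.
  rewrite invgM -!mulgA; congr (_ * _).
  have -> : z ^- m * z ^+ (n + (m - k)) = z ^+ n * z ^- k.
    rewrite addnBA ?(ltnW km)// addnC expgnFr ?(leq_trans (ltnW km)) ?leq_addr//.
    by rewrite expgnDr -mulgA mulKg.
  rewrite [RHS]mulgA -(Zzn n) -mulgA; congr (_ * _).
  exact: (subgroupV (center_subgroup G) (Zzn k)).
exists M'; split=> //.
- move=> y; rewrite inE => /predU1P[->|/lM]; rewrite inE.
    by exists 1, 1%N; rewrite mul1g expg1; split=> //; exact: subgroup1.
  by rewrite !inE => /MM'.
- exists [seq t * z ^+ i | t <- T, i <- iota 0 m] => _ /red[x [n [Mx nm ->]]].
  have [t tT Nxt] := HT x Mx; exists (t * z ^+ n).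
    by apply/allpairsP; exists (t, n); split=> //=; rewrite mem_iota.
  by rewrite invgM mulgA mulgK.
- split; first exact: subset_trans MM'.
  by move=> _ [x [n [Mx ->]]]; apply: (subgroupM (center_subgroup G)); [exact: MZ|exact: Zzn].
Qed.

Theorem center_free_finite_index : finitely_generated G -> nilpotent_group G ->
  exists N, [/\ is_subgroup N, N `<=` group_center G, torsion_free N,
    circle_liftable N & finite_mod N (group_center G)].
Proof.
move=> fgG nilG; have [l genZ] := nilpotent_subgroup_fg fgG nilG (center_subgroup G).
have lZ : {subset l <= group_center G}.
  by move=> z zl; rewrite inE -genZ; exact: sub_generated.
have [N [sN NZ tfN liftN Nl]] := free_subgroup_exists lZ.
exists N; split=> //; exact: finite_mod_powers Nl genZ.
Qed.

End FreeAbelian.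

(** * Elements with finitely many conjugates *)

Section FiniteConjugates.
Variable G : groupType.
Local Open Scope group_scope.
Implicit Types (N K X : set G) (x y z : G).

Definition finite_conj : set G := [set x | exists T : seq G, forall y, x ^ y \in T].

Lemma finite_conj_subgroup : is_subgroup finite_conj.
Proof.
split; first by exists [:: 1] => y; rewrite conj1g inE.
move=> x x' [T HT] [T' HT']; exists [seq t * t'^-1 | t <- T, t' <- T'] => y.
by apply/allpairsP; exists (x ^ y, x' ^ y); rewrite /= conjMg conjVg.
Qed.

Lemma finite_conjJ x y : finite_conj x -> finite_conj (x ^ y).
Proof. by move=> [T HT]; exists T => z; rewrite -conjgM. Qed.

Lemma finite_conj_commg x y : finite_conj x -> finite_conj [~ x, y].
Proof.
move=> Fx; rewrite commgEl; have sF := finite_conj_subgroup.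
by apply: (subgroupM sF); [exact: (subgroupV sF)|exact: finite_conjJ].
Qed.

(** The second term of the upper central series. *)
Definition second_center : set G :=
  [set x | forall y, group_center G [~ x, y]].

Lemma second_center_conjX x y n : group_center G [~ x, y] ->
  x ^ (y ^+ n) = x * [~ x, y] ^+ n.
Proof.
move=> Zc; elim: n => [|n IH]; first by rewrite !expg0 conjg1 mulg1.
rewrite expgSr conjgM IH conjMg (center_conj y (subgroupX n (center_subgroup G) Zc)).
by rewrite expgS mulgA commgEl mulVKg.
Qed.

(** The conjugates [x ^ (y ^+ n) = x * [~ x, y] ^+ n] cannot all be distinct. *)
Lemma finite_conj_torsion x y : finite_conj x -> group_center G [~ x, y] ->
  exists2 n, (0 < n)%N & [~ x, y] ^+ n = 1.
Proof.
move=> [T HT] Zc; apply: contrapT => noexp.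
have inj : injective (fun n => x ^ (y ^+ n)).
  move=> n m; rewrite !second_center_conjX// => /mulgI.
  wlog nm : n m / (n <= m)%N.
    by move=> H; have [/H//|/ltnW/H H' E] := leqP n m; rewrite H'.
  move=> E; apply/eqP; rewrite eqn_leq nm /= leqNgt; apply/negP => ltnm.
  apply: noexp; exists (m - n)%N; first by rewrite subn_gt0.
  by rewrite expgnFr// E mulgV.
have := @uniq_leq_size _ [seq x ^ (y ^+ n) | n <- iota 0 (size T).+1] T.
rewrite map_inj_uniq// iota_uniq size_map size_iota ltnn => H.
by have /(H isT) : {subset [seq x ^ (y ^+ n) | n <- iota 0 (size T).+1] <= T}
  by move=> _ /mapP[n _ ->].
Qed.

Lemma words_finite (I : eqType) (T : seq I) n :
  exists L : seq (seq I), forall w, {subset w <= T} -> size w = n -> w \in L.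
Proof.
elim: n => [|n [L HL]]; first by exists [:: [::]] => w _ /size0nil ->.
exists [seq t :: w | t <- T, w <- L] => -[//|t w] wT [wn].
apply/allpairsP; exists (t, w); split=> //=; first by apply: wT; rewrite mem_head.
by apply: HL => // x xw; apply: wT; rewrite inE xw orbT.
Qed.

(** Commuting with the generators embeds the relevant group, modulo [N'], into
    a finite power of a group already known to be finite modulo [N]. *)
Lemma finite_mod_commg (S : seq G) N N' X (Y : set G) : is_subgroup N ->
  finite_mod N Y -> (forall x s, X x -> s \in S -> Y [~ x, s]) ->
  (forall x y, X x -> X y ->
    (forall s, s \in S -> N ([~ x, s] * [~ y, s]^-1)) -> N' (x * y^-1)) ->
  finite_mod N' X.
Proof.
move=> sN [T HT] XY XN'; pose c g := xget 1 [set t | t \in T /\ N (g * t^-1)].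
have cP g : Y g -> c g \in T /\ N (g * (c g)^-1).
  by move=> /HT[t tT Nt]; rewrite /c; case: xgetP => [u _ //|/(_ t)[]].
have [L HL] := words_finite T (size S).
apply: (finite_mod_fibres (L := L) (f := fun x => [seq c [~ x, s] | s <- S])).
  move=> x Xx; apply: HL; last by rewrite size_map.
  by move=> _ /mapP[s sS ->]; case: (cP [~ x, s]) => //; exact: XY.
move=> x y Xx Xy /eq_in_map E; apply: XN' => // s sS.
have [_ Nx] := cP _ (XY x s Xx sS); have [_ Ny] := cP _ (XY y s Xy sS).
have -> : [~ x, s] * [~ y, s]^-1 =
    [~ x, s] * (c [~ x, s])^-1 * ([~ y, s] * (c [~ y, s])^-1)^-1.
  by rewrite (E s sS) invgF mulgA mulgVK.
by apply: subgroupM => //; exact: subgroupV.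
Qed.

Lemma commg_div_central x y s :
  group_center G ([~ x, s] * [~ y, s]^-1) ->
  [~ x * y^-1, s] = [~ x, s] * [~ y, s]^-1.
Proof.
set z := [~ x, s] * _ => Zz.
have -> : [~ x * y^-1, s] = (x * y^-1)^-1 * (x * z * y^-1).
  rewrite commgEl conjMg conjVg; congr (_ * _).
  have -> : x ^ s = x * [~ x, s] by rewrite commgEl mulVKg.
  have -> : y ^ s = y * [~ y, s] by rewrite commgEl mulVKg.
  by rewrite invgM !mulgA.
by rewrite -(Zz x) -mulgA (Zz (x * y^-1)) mulKg.
Qed.

Variable S : seq G.
Hypothesis genS : generated_subgroup [set` S] = [set: G].

Lemma generators_ind (K : set G) : is_subgroup K -> {subset S <= K} -> forall y, K y.
Proof.
move=> sK SK y; have : [set: G] y by [].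
by rewrite -genS; apply: generated_sub => // x /SK; rewrite inE.
Qed.

Lemma commutes_generators_center x : (forall s, s \in S -> [~ x, s] = 1) -> group_center G x.
Proof.
move=> xS; apply/centerP; apply: (generators_ind (K := [set y | [~ x, y] = 1])) => [|s /xS]; last by rewrite inE.
split; first exact: commg1.
move=> y z /= Hy Hz; rewrite commgM_conj Hy conj1g mulg1.
by rewrite commgV_conj Hz invg1 conj1g.
Qed.

Lemma second_center_generators x :
  (forall s, s \in S -> group_center G [~ x, s]) -> second_center x.
Proof.
have sZ := center_subgroup G.
move=> xS; apply: (generators_ind (K := [set y | group_center G [~ x, y]])) => [|s sS]; last first.
  by rewrite inE; exact: xS.
split; first by rewrite /= commg1; exact: (subgroup1 sZ).
move=> y z Hy Hz; rewrite /= commgM_conj; apply: (subgroupM sZ).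
  by rewrite commgV_conj center_conj; exact: (subgroupV sZ).
by rewrite center_conj.
Qed.

Variable N : set G.
Hypotheses (sN : is_subgroup N) (NZ : N `<=` group_center G) (tfN : torsion_free N).
Hypothesis fN : finite_mod N (group_center G).

Let Z := group_center G.
Let sZ : is_subgroup Z := center_subgroup G.

(** Each coset of the torsion-free group [N] contains at most one torsion element
    of the center. *)
Lemma center_torsion_finite :
  finite_mod [set 1] [set z | Z z /\ exists2 n, (0 < n)%N & z ^+ n = 1].
Proof.
have [T HT] := fN.
pose c z := xget 1 [set t | t \in T /\ N (z * t^-1)].
have cP z : Z z -> c z \in T /\ N (z * (c z)^-1).
  by move=> /HT[t tT Nt]; rewrite /c; case: xgetP => [u _ //|/(_ t)[]].
apply: (finite_mod_fibres (L := T) (f := c)) => [z [/cP[]//]|].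
move=> y z [Zy [n n0 yn]] [Zz [m m0 zm]] E.
have Nyz : N (y * z^-1).
  have -> : y * z^-1 = y * (c y)^-1 * (z * (c z)^-1)^-1.
    by rewrite E invgF mulgA mulgVK.
  have [[_ Ny] [_ Nz]] := (cP y Zy, cP z Zz).
  by apply: subgroupM => //; exact: subgroupV.
apply: (tfN (n := (n * m)%N)) => //; first by rewrite muln_gt0 n0.
rewrite expgMn; last exact: Zy.
by rewrite expgnA yn expg1n mul1g expVgn mulnC expgnA zm expg1n invg1.
Qed.

(** For such [x] the map [y |-> [~ x, y]] is a homomorphism into the torsion of
    the center, which is finite; it is determined by its values on the generators
    and trivial exactly when [x] is central. *)
Lemma finite_conj_second_center : finite_mod Z (finite_conj `&` second_center).
Proof.
apply: (finite_mod_commg (S := S) (N := [set 1]) (Y := [set z | Z z /\ exists2 n, (0 < n)%N & z ^+ n = 1])).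
- by split=> // x y -> ->; rewrite divg1.
- exact: center_torsion_finite.
- by move=> x s [Fx Zx] _; split; [exact: Zx|exact: finite_conj_torsion].
- move=> x y [_ Zx] [_ Zy] E; apply: commutes_generators_center => s sS.
  by rewrite commg_div_central ?E//; exact: (subgroup1 sZ).
Qed.

(** Commuting with the generators leads from one term of the series to the next;
    the fibres of this map lie in cosets of the second center. *)
Lemma finite_conj_lower_central k m : lower_central G (m + k) `<=` [set 1] ->
  finite_mod Z (finite_conj `&` lower_central G m).
Proof.
elim: k m => [|k IH] m triv.
  rewrite addn0 in triv; exists [:: 1] => x [_ /triv ->]; exists 1; rewrite ?inE//.
  by rewrite mulgV; exact: (subgroup1 sZ).
apply: (finite_mod_trans sZ _ finite_conj_second_center).
apply: (finite_mod_commg (S := S) (N := Z) (Y := finite_conj `&` lower_central G m.+1)) => //.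
- by apply: IH; rewrite addSnnS.
- by move=> x s [Fx Lx] _; split; [exact: finite_conj_commg|exact: lower_central_commr].
- move=> x y [Fx _] [Fy _] E; split; first by case: finite_conj_subgroup => _; exact.
  apply: second_center_generators => s sS; rewrite commg_div_central; exact: E.
Qed.

(** The set [finite_conj] is known as the FC-center of the group. *)
Theorem finite_conj_finite_mod : nilpotent_group G -> finite_mod N finite_conj.
Proof.
move=> [n Ln]; apply: (finite_mod_trans sN _ fN).
apply: finite_mod_sub (@finite_conj_lower_central n 0 _); last by rewrite add0n Ln.
by move=> x Fx.
Qed.

End FiniteConjugates.

(** * Infima and null sequences in the complex numbers *)

Section ComplexOrder.
Variable R : realType.
Local Open Scope complex_scope.
Local Notation C := R[i].
Implicit Types (P : set C) (a b c e : C) (d : nat -> C).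

Lemma ge0_ReK c : 0 <= c -> (complex.Re c)%:C = c.
Proof. by move=> /ger0_real/RRe_real. Qed.

(** The infimum of a set of nonnegative complex numbers; the order of the complex
    numbers makes such sets sets of reals. *)
Definition infC P : C := (inf [set complex.Re c | c in P])%:C.

Lemma infC_ge P b : 0 <= b -> P !=set0 -> (forall c, P c -> b <= c) -> b <= infC P.
Proof.
move=> b0 [c Pc] bP; rewrite /infC -[b]ge0_ReK// lecR; apply: lb_le_inf.
  by exists (complex.Re c), c.
by move=> _ [x /bP bx <-]; move: bx; rewrite lecE => /andP[].
Qed.

Lemma infC_le P c : (forall c, P c -> 0 <= c) -> P c -> infC P <= c.
Proof.
move=> P0 Pc; rewrite /infC -[leRHS](ge0_ReK (P0 c Pc)) lecR; apply: ge_inf; last by exists c.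
exists 0 => _ [x /P0 x0 <-]; by move: x0; rewrite lecE => /andP[].
Qed.

(** The C*-algebras below carry a norm with complex values but no topology, so
    limits in them are expressed by null sequences of norms. *)
Definition null d := forall e, 0 < e -> exists n0, forall n, (n0 <= n)%N -> d n < e.

Lemma null_le d d' : (forall n, d n <= d' n) -> null d' -> null d.
Proof.
move=> dd' Nd' e /Nd'[n0 Hn0]; exists n0 => n /Hn0; exact: le_lt_trans.
Qed.

Lemma null_near d d' n1 : (forall n, (n1 <= n)%N -> d n <= d' n) -> null d' -> null d.
Proof.
move=> dd' Nd' e /Nd'[n0 Hn0]; exists (maxn n0 n1) => n; rewrite geq_max => /andP[/Hn0 H /dd'].
by move=> H'; exact: le_lt_trans H' H.
Qed.

Lemma nullD d d' : null d -> null d' -> null (fun n => d n + d' n).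
Proof.
move=> Nd Nd' e e0; have e2 : 0 < e / 2 by rewrite divr_gt0.
have [n0 H0] := Nd _ e2; have [n1 H1] := Nd' _ e2; exists (maxn n0 n1) => n.
by rewrite geq_max => /andP[/H0 ? /H1 ?]; rewrite [e]splitr ltrD.
Qed.

Lemma nullM c d : 0 <= c -> (forall n, 0 <= d n) -> null d -> null (fun n => c * d n).
Proof.
move=> c0 d0 Nd e e0; have c1 : 0 < c + 1 by rewrite ltr_wpDl.
have [n0 H0] := Nd (e / (c + 1)) (divr_gt0 e0 c1); exists n0 => n /H0.
rewrite ltr_pdivlMr// mulrC mulrDl mul1r; apply: le_lt_trans.
by rewrite lerDl.
Qed.

Lemma null_cst0 c : 0 <= c -> null (fun=> c) -> c = 0.
Proof.
move=> c0 Nc; apply/eqP; rewrite eq_le c0 andbT; apply/negPn/negP => cn0.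
have cgt0 : 0 < c by rewrite lt_def c0 andbT; apply: contraNneq cn0 => ->.
by have [n0 /(_ n0 (leqnn _))] := Nc c cgt0; rewrite ltxx.
Qed.

Lemma eps_eq0 a c : 0 <= a -> 0 <= c -> (forall e, 0 < e -> a <= e * c) -> a = 0.
Proof.
move=> a0 c0 ae; apply: null_cst0 => // e e0; exists 0%N => n _.
have c1 : 0 < c + 1 by rewrite ltr_wpDl.
apply: (le_lt_trans (ae (e / (c + 1)) (divr_gt0 e0 c1))).
by rewrite mulrAC -mulrA gtr_pMr// ltr_pdivrMr// mul1r ltrDl.
Qed.

Lemma null0 : null (fun=> 0).
Proof. by move=> e e0; exists 0%N. Qed.

Lemma nonneg_le_of_null a b d : 0 <= a -> 0 <= b -> (forall n, a <= b + d n) -> null d ->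
  a <= b.
Proof.
move=> a0 b0 abd Nd.
have ab : a >=< b by apply: real_comparable; exact: ger0_real.
rewrite real_leNgt ?ger0_real//; apply/negP => ltba.
have e0 : 0 < a - b by rewrite subr_gt0.
have [n0 /(_ n0 (leqnn _))] := Nd _ e0.
by rewrite ltrBrDl => H; have := le_lt_trans (abd n0) H; rewrite ltxx.
Qed.

Lemma null_harmonic : null (fun n => n.+1%:R^-1).
Proof.
move=> e e0; have Re0 : 0 < complex.Re e by move: e0; rewrite ltcE => /andP[].
have eE : (complex.Re e)%:C = e by apply: ge0_ReK; exact: ltW.
exists (Num.bound (complex.Re e)^-1) => n n0n; rewrite -eE -[ltRHS]invrK.
rewrite ltf_pV2 ?posrE ?invr_gt0 ?ltr0n ?ltcR// -fmorphV -(rmorph_nat (real_complex R)) ltcR.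
have Rei : 0 <= (complex.Re e)^-1 by rewrite invr_ge0 ltW.
by apply: lt_le_trans (archi_boundP Rei) _; rewrite ler_nat leqW.
Qed.

End ComplexOrder.

(** * Hilbert spaces and their bounded operators *)

Section Dot.
Variables (R : realType) (H : completeNormedModType R[i]).
Variable dot : {dot H for (@Num.conj R[i])}.
Hypothesis H_hilbert : norm_of_dot dot.
Local Notation C := R[i].
Implicit Types (u v w : H) (a b : C).

Lemma dotC u v : dot u v = Num.conj (dot v u).
Proof. by rewrite hermC expr0 mul1r. Qed.

Lemma dotDl u v w : dot (u + v) w = dot u w + dot v w.
Proof. by rewrite linearDl. Qed.

Lemma dotZl a u v : dot (a *: u) v = a * dot u v.
Proof. by rewrite linearZl_LR. Qed.

Lemma dotDr u v w : dot u (v + w) = dot u v + dot u w.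
Proof. by rewrite linearDr. Qed.

Lemma dotZr a u v : dot u (a *: v) = Num.conj a * dot u v.
Proof. by rewrite linearZr_LR. Qed.

Lemma dotNl u v : dot (- u) v = - dot u v.
Proof. by rewrite linearNl. Qed.

Lemma dotNr u v : dot u (- v) = - dot u v.
Proof. by rewrite linearNr. Qed.

Lemma dotBl u v w : dot (u - v) w = dot u w - dot v w.
Proof. by rewrite dotDl dotNl. Qed.

Lemma dotBr u v w : dot u (v - w) = dot u v - dot u w.
Proof. by rewrite dotDr dotNr. Qed.

Lemma dot0l v : dot 0 v = 0.
Proof. by rewrite linear0l. Qed.

Lemma dot0r v : dot v 0 = 0.
Proof. by rewrite linear0r. Qed.

Lemma dotvv v : dot v v = `|v| ^+ 2.
Proof. by rewrite H_hilbert. Qed.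

Lemma dot_nondeg u v : (forall w, dot w u = dot w v) -> u = v.
Proof.
move=> uv; apply/eqP; rewrite -subr_eq0 -normr_eq0 -sqrf_eq0 -dotvv dotBr uv.
by rewrite subrr.
Qed.

Lemma cauchy_schwarz u v : `|dot u v| <= `|u| * `|v|.
Proof.
have [->|v0] := eqVneq v 0; first by rewrite dot0r !normr0 mulr0.
have nv0 : `|v| ^+ 2 != 0 by rewrite sqrf_eq0 normr_eq0.
have nvgt0 : 0 < `|v| ^+ 2 by rewrite exprn_gt0// normr_gt0.
rewrite -(@ler_pXn2r _ 2)// ?nnegrE ?mulr_ge0//.
have : 0 <= `|u - (dot u v / `|v| ^+ 2) *: v| ^+ 2 by rewrite exprn_ge0.
rewrite -dotvv dotBl !dotBr !dotZl !dotZr !dotvv.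
set n := `|v| ^+ 2; rewrite -/n in nv0 nvgt0; rewrite (dotC v u).
set z := dot u v; rewrite rmorphM fmorphV /=.
have -> : Num.conj n = n by rewrite conj_Creal// ger0_real// ltW.
set zc := z^*; rewrite (_ : _ - _ - _ = `|u| ^+ 2 - zc * z / n); last by field.
rewrite subr_ge0 ler_pdivrMr// exprMn -/n; apply: le_trans.
by rewrite normCK mulrC.
Qed.

Lemma hilbert_complete (a_ : nat -> H) :
  (forall e : C, 0 < e -> exists n0, forall m n, (n0 <= m)%N -> (n0 <= n)%N -> `|a_ m - a_ n| < e) ->
  exists a : H, null (fun n => `|a_ n - a|).
Proof.
move=> Ca; have : cvg (a_ @ \oo).
  apply/cauchy_cvgP/cauchy_ballP => e e0; have [n0 Hn0] := Ca e e0.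
  exists ((fun n => a_ n) @` [set n | (n0 <= n)%N], (fun n => a_ n) @` [set n | (n0 <= n)%N]).
    by split; exists n0 => // n /= n0n; exists n.
  by move=> [_ _] /= [[m n0m <-] [n n0n <-]]; rewrite -ball_normE /=; exact: Hn0.
move=> /cvg_ex[a /cvgrPdist_lt Ha]; exists a => e e0.
have [n0 _ Hn0] := Ha e e0; exists n0 => n n0n.
by rewrite distrC; exact: Hn0.
Qed.

End Dot.

Section BoundedOperators.
Variables (R : realType) (H : completeNormedModType R[i]).
Variable dot : {dot H for (@Num.conj R[i])}.
Hypothesis H_hilbert : norm_of_dot dot.
Local Notation C := R[i].
Implicit Types (u v w : H) (a b c : C) (S T : H -> H).

Definition bounded_by c T := 0 <= c /\ forall v, `|T v| <= c * `|v|.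

Definition adjointable T :=
  [/\ linear T, exists c, bounded_by c T & exists S, adjoint_of dot T S].

Definition opnorm T : C := infC [set c | bounded_by c T].

Lemma linear_map0 T : linear T -> T 0 = 0.
Proof. by move=> lT; have := lT (-1) 0 0; rewrite scaler0 addr0 scaleN1r addNr. Qed.

Lemma opnorm_bounded T : (exists c, bounded_by c T) -> bounded_by (opnorm T) T.
Proof.
move=> bT; have on0 : 0 <= opnorm T by apply: infC_ge => // c [].
split=> // v; have [->|v0] := eqVneq v 0.
  by case: bT => c [_ /(_ 0)]; rewrite normr0 !mulr0.
have nv : 0 < `|v| by rewrite normr_gt0.
rewrite -ler_pdivrMr//; apply: infC_ge; rewrite ?divr_ge0//.
by move=> c [_ /(_ v)]; rewrite ler_pdivrMr.
Qed.

Lemma opnorm_le c T : bounded_by c T -> opnorm T <= c.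
Proof. by move=> bT; apply: infC_le => // x []. Qed.

(** Apply the Cauchy-Schwarz inequality to [dot (S w) (S w) = dot (T (S w)) w]. *)
Lemma adjoint_bounded c T S : bounded_by c T -> adjoint_of dot T S -> bounded_by c S.
Proof.
move=> [c0 bT] adj; split=> // w; have [->|Sw0] := eqVneq (S w) 0.
  by rewrite normr0 mulr_ge0.
have nS : 0 < `|S w| by rewrite normr_gt0.
rewrite -(ler_pM2l nS) -expr2 -(dotvv H_hilbert) -adj.
have := cauchy_schwarz H_hilbert (T (S w)) w; rewrite adj (dotvv H_hilbert) normrX normr_id.
move=> le1; apply: (le_trans le1); rewrite mulrCA mulrA.
by rewrite ler_wpM2r.
Qed.

Lemma adjoint_linear T S : adjoint_of dot T S -> linear S.
Proof.
move=> adj a u v; apply: (dot_nondeg H_hilbert) => w.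
by rewrite -adj !(dotDr, dotZr) -!adj.
Qed.

Lemma adjoint_unique T S S' : adjoint_of dot T S -> adjoint_of dot T S' -> S = S'.
Proof.
move=> adj adj'; apply/funext => v; apply: (dot_nondeg H_hilbert) => w.
by rewrite -adj adj'.
Qed.

Lemma adjoint_sym T S : adjoint_of dot T S -> adjoint_of dot S T.
Proof. by move=> adj v w; rewrite dotC -adj -dotC. Qed.

Lemma adjoint_linear_left T S : adjoint_of dot T S -> linear T.
Proof. by move/adjoint_sym/adjoint_linear. Qed.

Lemma bounded_continuous c T : linear T -> bounded_by c T -> continuous T.
Proof.
move=> lT [c0 bT] v; apply/cvgrPdist_lt => e e0.
have c1 : 0 < c + 1 by rewrite ltr_wpDl.
near=> w; have -> : T v - T w = T (v - w).
  by have := lT (-1) w v; rewrite !scaleN1r addrC => <-; rewrite addrC.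
apply: (le_lt_trans (bT _)); apply: (@le_lt_trans _ _ ((c + 1) * `|v - w|)).
  by rewrite ler_wpM2r// lerDl.
rewrite mulrC -ltr_pdivlMr//; near: w.
by apply: cvgr_dist_lt => //; rewrite divr_gt0.
Unshelve. all: by end_near.
Qed.

Lemma adjointable_bounded_operator T : adjointable T -> bounded_operator T.
Proof. by move=> [lT [c bT] _]; split=> //; exact: bounded_continuous bT. Qed.

Lemma adjointable0 : adjointable (fun=> 0).
Proof.
split; first by move=> a u v; rewrite scaler0 addr0.
  by exists 0; split=> // v; rewrite normr0 mul0r.
by exists (fun=> 0) => u v; rewrite dot0l dot0r.
Qed.

Lemma adjointable1 : adjointable id.
Proof. by split=> //; [exists 1; split=> // v; rewrite mul1r | exists id]. Qed.

Lemma bounded_byD c c' T S : bounded_by c T -> bounded_by c' S ->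
  bounded_by (c + c') (fun v => T v + S v).
Proof.
move=> [c0 bT] [c'0 bS]; split=> [|v]; first exact: addr_ge0.
by rewrite mulrDl (le_trans (ler_normD _ _))// lerD.
Qed.

Lemma bounded_byZ a c T : bounded_by c T -> bounded_by (`|a| * c) (fun v => a *: T v).
Proof.
move=> [c0 bT]; split=> [|v]; first exact: mulr_ge0.
by rewrite normrZ -mulrA ler_wpM2l.
Qed.

Lemma bounded_byM c c' T S : bounded_by c T -> bounded_by c' S -> bounded_by (c * c') (T \o S).
Proof.
move=> [c0 bT] [c'0 bS]; split=> [|v]; first exact: mulr_ge0.
by rewrite (le_trans (bT _))// -mulrA ler_wpM2l.
Qed.

Lemma adjointableD S T : adjointable S -> adjointable T -> adjointable (fun v => S v + T v).
Proof.
move=> [lS [c bS] [S' aS]] [lT [c' bT] [T' aT]]; split.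
- by move=> a u v; rewrite lS lT scalerDr addrACA.
- by exists (c + c'); exact: bounded_byD.
- by exists (fun v => S' v + T' v) => u v; rewrite dotDl dotDr aS aT.
Qed.

Lemma adjointableZ a T : adjointable T -> adjointable (fun v => a *: T v).
Proof.
move=> [lT [c bT] [T' aT]]; split.
- by move=> b u v; rewrite lT scalerDr !scalerA mulrC.
- by exists (`|a| * c); exact: bounded_byZ.
- by exists (fun v => Num.conj a *: T' v) => u v; rewrite dotZl dotZr conjCK aT.
Qed.

Lemma adjointableM S T : adjointable S -> adjointable T -> adjointable (S \o T).
Proof.
move=> [lS [c bS] [S' aS]] [lT [c' bT] [T' aT]]; split.
- by move=> a u v; rewrite /= lT lS.
- by exists (c * c'); exact: bounded_byM.
- by exists (T' \o S') => u v; rewrite /= aS aT.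
Qed.

Lemma adjointable_adjoint S T : adjointable T -> adjoint_of dot T S -> adjointable S.
Proof.
move=> [lT [c bT] _] aT; split; first exact: adjoint_linear aT.
  by exists c; exact: adjoint_bounded bT aT.
by exists T; exact: adjoint_sym.
Qed.

(** The adjoints form a Cauchy sequence with the same moduli, and their limit is
    the adjoint of the limit. *)
Lemma adjointable_limit (T_ : nat -> H -> H) : (forall n, adjointable (T_ n)) ->
  (forall e, 0 < e -> exists n0, forall m n, (n0 <= m)%N -> (n0 <= n)%N ->
     bounded_by e (fun v => T_ m v - T_ n v)) ->
  exists2 T, adjointable T &
    forall e, 0 < e -> exists n0, forall n, (n0 <= n)%N -> bounded_by e (fun v => T_ n v - T v).
Proof.
move=> adjT CT.
have lim (U_ : nat -> H -> H) : (forall e, 0 < e -> exists n0, forall m n, (n0 <= m)%N -> (n0 <= n)%N ->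
     bounded_by e (fun v => U_ m v - U_ n v)) -> exists U, forall v, null (fun n => `|U_ n v - U v|).
  move=> CU; suff /choice[U HU] : forall v, exists u, null (fun n => `|U_ n v - u|) by exists U.
  move=> v; apply: hilbert_complete => e e0.
  have v1 : 0 < `|v| + 1 by rewrite ltr_wpDl.
  have [n0 Hn0] := CU (e / (`|v| + 1)) (divr_gt0 e0 v1); exists n0 => m n n0m n0n.
  have [_ /(_ v) le1] := Hn0 m n n0m n0n; apply: (le_lt_trans le1).
  by rewrite mulrAC -mulrA gtr_pMr// ltr_pdivrMr// mul1r ltrDl.
have [T HT] := lim T_ CT.
have /choice[S_ adjS] : forall n, exists S, adjoint_of dot (T_ n) S by move=> n; case: (adjT n).
have CS : forall e, 0 < e -> exists n0, forall m n, (n0 <= m)%N -> (n0 <= n)%N ->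
     bounded_by e (fun v => S_ m v - S_ n v).
  move=> e /CT[n0 Hn0]; exists n0 => m n n0m n0n; apply: adjoint_bounded (Hn0 m n n0m n0n) _.
  by move=> u v; rewrite dotBl dotBr adjS adjS.
have [S HS] := lim S_ CS.
have bT e : 0 < e -> exists n0, forall n, (n0 <= n)%N -> bounded_by e (fun v => T_ n v - T v).
  move=> e0; have [n0 Hn0] := CT e e0; exists n0 => n n0n; split; first exact: ltW.
  move=> v; apply: (nonneg_le_of_null (d := fun m => `|T_ (m + n0)%N v - T v|)) => //.
  - by rewrite mulr_ge0// ltW.
  - move=> m; rewrite -(subrK (T_ (m + n0)%N v) (T_ n v)) -addrA (le_trans (ler_normD _ _))//.
    by rewrite lerD2r; case: (Hn0 n (m + n0)%N) => //; exact: leq_addl.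
  - move=> e' /(HT v)[n1 H1]; exists n1 => m n1m; apply: H1.
    by rewrite (leq_trans n1m)// leq_addr.
have aT : adjoint_of dot T S.
  move=> u v; apply/eqP; rewrite -subr_eq0 -normr_eq0; apply/eqP.
  apply: (null_cst0 (normr_ge0 _)).
  apply: (null_le (d' := fun n => `|v| * `|T_ n u - T u| + `|u| * `|S_ n v - S v|)).
    move=> n; have -> : dot (T u) v - dot u (S v) = dot u (S_ n v - S v) - dot (T_ n u - T u) v.
      by rewrite dotBl dotBr adjS; ring.
    rewrite (le_trans (ler_normB _ _))// addrC lerD//.
      by rewrite mulrC; exact: cauchy_schwarz.
    exact: cauchy_schwarz.
  by apply: nullD; apply: nullM => //.
exists T => //; split; [exact: adjoint_linear_left aT| |by exists S].
have [n0 /(_ n0 (leqnn _)) b1] := bT 1 ltr01.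
have [_ [c bTn] _] := adjT n0; exists (1 + c).
have := bounded_byD (bounded_byZ (-1) b1) bTn; rewrite normrN1 mul1r.
by congr (bounded_by _ _); apply/funext => v; rewrite scaleN1r opprB subrK.
Qed.

End BoundedOperators.

(** Carrying an adjoint along with each operator replaces the representation
    theorem for bounded functionals, which would provide one; the operators of a
    unitary representation have adjoints, and so do their norm limits. *)
Section OperatorAlgebra.
Variables (R : realType) (H : completeNormedModType R[i]).
Variable dot : {dot H for (@Num.conj R[i])}.
Hypothesis H_hilbert : norm_of_dot dot.
Hypothesis H_nontrivial : exists v : H, v != 0.
Local Notation C := R[i].

Record op := Op { op_fun :> H -> H; op_adjointable : adjointable dot op_fun }.

Lemma op_ext (S T : op) : (forall v, S v = T v) -> S = T.
Proof.
case: S T => [S aS] [T aT] /= /funext ST; move: aS; rewrite ST => aS.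
by congr Op; exact: Prop_irrelevance.
Qed.

(** The algebra needs the two hypotheses for its C*-structure, hence carries
    them as parameters. *)
Definition operator_algebra of norm_of_dot dot & (exists v : H, v != 0) := op.

Local Notation opalg := (operator_algebra H_hilbert H_nontrivial).

HB.instance Definition _ := gen_eqMixin opalg.
HB.instance Definition _ := gen_choiceMixin opalg.

Definition op_add (S T : opalg) : opalg := Op (adjointableD (op_adjointable S) (op_adjointable T)).
Definition op_zero : opalg := Op (adjointable0 dot).
Definition op_scale (a : C) (T : opalg) : opalg := Op (adjointableZ a (op_adjointable T)).
Definition op_opp (T : opalg) : opalg := op_scale (-1) T.
Definition op_mul (S T : opalg) : opalg := Op (adjointableM (op_adjointable S) (op_adjointable T)).
Definition op_one : opalg := Op (adjointable1 dot).

Fact op_addA : associative op_add.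
Proof. by move=> S T U; apply: op_ext => v /=; rewrite addrA. Qed.
Fact op_addC : commutative op_add.
Proof. by move=> S T; apply: op_ext => v /=; rewrite addrC. Qed.
Fact op_add0 : left_id op_zero op_add.
Proof. by move=> T; apply: op_ext => v /=; rewrite add0r. Qed.
Fact op_addN : left_inverse op_zero op_opp op_add.
Proof. by move=> T; apply: op_ext => v /=; rewrite scaleN1r addNr. Qed.

HB.instance Definition _ := GRing.isZmodule.Build opalg op_addA op_addC op_add0 op_addN.

Lemma op_linear (T : opalg) : linear T.
Proof. by case: (op_adjointable T). Qed.

Lemma opD (T : opalg) u v : T (u + v) = T u + T v.
Proof. by have := op_linear T 1 u v; rewrite !scale1r. Qed.

Lemma opZ (T : opalg) a v : T (a *: v) = a *: T v.
Proof. by have := op_linear T a v 0; rewrite (linear_map0 (op_linear T)) !addr0. Qed.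

Fact op_mulA : associative op_mul.
Proof. by move=> S T U; apply: op_ext. Qed.
Fact op_mul1 : left_id op_one op_mul.
Proof. by move=> T; apply: op_ext. Qed.
Fact op_1mul : right_id op_one op_mul.
Proof. by move=> T; apply: op_ext. Qed.
Fact op_mulDl : left_distributive op_mul op_add.
Proof. by move=> S T U; apply: op_ext. Qed.
Fact op_mulDr : right_distributive op_mul op_add.
Proof. by move=> S T U; apply: op_ext => v /=; rewrite opD. Qed.
Fact op_one_neq0 : op_one != op_zero.
Proof.
case: H_nontrivial => v v0; apply: contraNneq v0 => E.
by apply/eqP; exact: (congr1 (fun T : opalg => T v) E).
Qed.

HB.instance Definition _ := GRing.Zmodule_isNzRing.Build opalg
  op_mulA op_mul1 op_1mul op_mulDl op_mulDr op_one_neq0.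

Fact op_scaleA a b (T : opalg) : op_scale a (op_scale b T) = op_scale (a * b) T.
Proof. by apply: op_ext => v /=; rewrite scalerA. Qed.
Fact op_scale1 : left_id 1 op_scale.
Proof. by move=> T; apply: op_ext => v /=; rewrite scale1r. Qed.
Fact op_scaleDr : right_distributive op_scale op_add.
Proof. by move=> a S T; apply: op_ext => v /=; rewrite scalerDr. Qed.
Fact op_scaleDl (T : opalg) : {morph op_scale^~ T : a b / a + b}.
Proof. by move=> a b; apply: op_ext => v /=; rewrite scalerDl. Qed.

HB.instance Definition _ := GRing.Zmodule_isLmodule.Build C opalg
  op_scaleA op_scale1 op_scaleDr op_scaleDl.

Fact op_scaleAl a (S T : opalg) : a *: (S * T) = (a *: S) * T.
Proof. by apply: op_ext. Qed.

HB.instance Definition _ := GRing.Lmodule_isLalgebra.Build C opalg op_scaleAl.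

Fact op_scaleAr a (S T : opalg) : a *: (S * T) = S * (a *: T).
Proof. by apply: op_ext => v; rewrite /= opZ. Qed.

HB.instance Definition _ := GRing.Lalgebra_isAlgebra.Build C opalg op_scaleAr.

Lemma op_adjoint_ex (T : opalg) : exists S : opalg, adjoint_of dot T S.
Proof.
by case: (op_adjointable T) => _ _ [S aS]; exists (Op (adjointable_adjoint H_hilbert (op_adjointable T) aS)).
Qed.

Definition op_star (T : opalg) : opalg := projT1 (cid (op_adjoint_ex T)).

Lemma op_starP (T : opalg) : adjoint_of dot T (op_star T).
Proof. exact: projT2 (cid (op_adjoint_ex T)). Qed.

Lemma op_star_unique (T S : opalg) : adjoint_of dot T S -> op_star T = S.
Proof.
move=> aS; apply: op_ext => v; congr (_ v).
exact: adjoint_unique (op_starP T) aS.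
Qed.

Fact op_starK : involutive op_star.
Proof. by move=> T; apply: op_star_unique; apply: adjoint_sym; exact: op_starP. Qed.
Fact op_starD (S T : opalg) : op_star (S + T) = op_star S + op_star T.
Proof. by apply: op_star_unique => u v; rewrite /= dotDl dotDr !op_starP. Qed.
Fact op_starZ a (T : opalg) : op_star (a *: T) = Num.conj a *: op_star T.
Proof. by apply: op_star_unique => u v; rewrite /= dotZl dotZr conjCK op_starP. Qed.
Fact op_starM (S T : opalg) : op_star (S * T) = op_star T * op_star S.
Proof. by apply: op_star_unique => u v; rewrite /= !op_starP. Qed.

Definition op_norm (T : opalg) : C := opnorm T.

Lemma op_bounded (T : opalg) : bounded_by (op_norm T) T.
Proof. by apply: opnorm_bounded; case: (op_adjointable T). Qed.

Lemma op_norm_ge0 T : 0 <= op_norm T.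
Proof. by case: (op_bounded T). Qed.

Fact op_norm_eq0 T : op_norm T = 0 -> T = 0.
Proof.
move=> T0; apply: op_ext => v; have [_ /(_ v)] := op_bounded T.
by rewrite T0 mul0r normr_le0 => /eqP.
Qed.
Fact op_normD S T : op_norm (S + T) <= op_norm S + op_norm T.
Proof. by apply: opnorm_le; exact: bounded_byD (op_bounded S) (op_bounded T). Qed.
Fact op_normZ a T : op_norm (a *: T) = `|a| * op_norm T.
Proof.
have le b S : op_norm (b *: S) <= `|b| * op_norm S.
  by apply: opnorm_le; exact: bounded_byZ (op_bounded S).
apply/eqP; rewrite eq_le le /=; have [->|a0] := eqVneq a 0.
  by rewrite normr0 mul0r op_norm_ge0.
have na : 0 < `|a| by rewrite normr_gt0.
have := le a^-1 (a *: T); rewrite scalerA mulVf// scale1r normfV.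
by rewrite ler_pdivlMl.
Qed.
Fact op_normM S T : op_norm (S * T) <= op_norm S * op_norm T.
Proof. by apply: opnorm_le; exact: bounded_byM (op_bounded S) (op_bounded T). Qed.

Lemma op_norm_star_le T : op_norm (op_star T) <= op_norm T.
Proof. by apply: opnorm_le; exact: adjoint_bounded (op_bounded T) (op_starP T). Qed.

Fact op_norm_star T : op_norm (op_star T * T) = op_norm T ^+ 2.
Proof.
have n0 := op_norm_ge0; apply/eqP; rewrite eq_le; apply/andP; split.
  by rewrite (le_trans (op_normM _ _))// expr2 ler_wpM2r// op_norm_star_le.
have s0 : 0 <= sqrtC (op_norm (op_star T * T)) by rewrite sqrtC_ge0.
have bT : bounded_by (sqrtC (op_norm (op_star T * T))) T.
  split=> // v; rewrite -(@ler_pXn2r _ 2)// ?nnegrE ?mulr_ge0// exprMn sqrtCK.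
  rewrite -(dotvv H_hilbert) op_starP.
  have le0 : 0 <= dot v (op_star T (T v)) by rewrite -op_starP (dotvv H_hilbert) exprn_ge0.
  rewrite -(ger0_norm le0) (le_trans (cauchy_schwarz H_hilbert _ _))// mulrC expr2 mulrA.
  by rewrite ler_wpM2r//; case: (op_bounded (op_star T * T)) => _; exact.
by have := opnorm_le bT; rewrite -(@ler_pXn2r _ 2)// ?nnegrE ?sqrtCK//; exact: (n0 T).
Qed.
Fact op_norm_complete (T_ : nat -> opalg) :
  (forall e : C, 0 < e -> exists n0, forall m n,
     (n0 <= m)%N -> (n0 <= n)%N -> op_norm (T_ m - T_ n) < e) ->
  exists T, forall e : C, 0 < e -> exists n0, forall n, (n0 <= n)%N -> op_norm (T_ n - T) < e.
Proof.
have bB (S T : opalg) e : op_norm (S - T) <= e -> bounded_by e (fun v => S v - T v).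
  move=> le; have [n0 bn] := op_bounded (S - T); split; first exact: le_trans le.
  move=> v; have := bn v; rewrite /= scaleN1r => /le_trans -> //.
  by rewrite ler_wpM2r.
move=> CT; have [||T aT HT] := adjointable_limit H_hilbert (T_ := T_).
- by move=> n; exact: op_adjointable.
- move=> e /CT[n0 Hn0]; exists n0 => m n n0m n0n; apply: bB; apply: ltW; exact: Hn0.
exists (Op aT) => e e0; have [n0 Hn0] := HT (e / 2) (divr_gt0 e0 (ltr0n _ 2)).
exists n0 => n /Hn0 bn; apply: (@le_lt_trans _ _ (e / 2)).
  apply: opnorm_le; congr (bounded_by _ _): bn; apply/funext => v /=.
  by rewrite scaleN1r.
by rewrite ltr_pdivrMr// ltr_pMr// ltr1n.
Qed.

HB.instance Definition _ := isCStarAlgebra.Build R opalg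
  op_starK op_starD op_starZ op_starM op_norm_eq0 op_normD op_normZ op_normM
  op_norm_star op_norm_complete.

End OperatorAlgebra.

(** * Elementary C*-algebra calculus *)

Section CStarCalculus.
Variables (R : realType) (A : cstarAlgType R).
Local Notation C := R[i].
Implicit Types (a b c x y : A) (k : C).

Lemma cnorm0 : cnorm (0 : A) = 0.
Proof. by rewrite -(scale0r (0 : A)) cnormZ normr0 mul0r. Qed.

Lemma cnormN a : cnorm (- a) = cnorm a.
Proof. by rewrite -scaleN1r cnormZ normrN1 mul1r. Qed.

Lemma cnorm_ge0 a : 0 <= cnorm a.
Proof.
have := cnormD a (- a); rewrite subrr cnorm0 cnormN -mulr2n -mulr_natl.
by rewrite pmulr_rge0// ltr0n.
Qed.

Lemma cnormB a b : cnorm (a - b) <= cnorm a + cnorm b.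
Proof. by rewrite (le_trans (cnormD _ _))// cnormN. Qed.

Lemma cnorm_dist a b : cnorm (a - b) = cnorm (b - a).
Proof. by rewrite -cnormN opprB. Qed.

Lemma cnorm_sum (I : Type) (r : seq I) (F : I -> A) :
  cnorm (\sum_(i <- r) F i) <= \sum_(i <- r) cnorm (F i).
Proof.
elim/big_ind2: _ => [|x1 x2 y1 y2 le1 le2|//]; first by rewrite cnorm0.
by rewrite (le_trans (cnormD _ _))// lerD.
Qed.

Lemma star0 : star (0 : A) = 0.
Proof. by have := starZ 0 (0 : A); rewrite conjC0 !scale0r. Qed.

Lemma starN a : star (- a) = - star a.
Proof. by rewrite -scaleN1r starZ rmorphN1 scaleN1r. Qed.

Lemma star1 : star (1 : A) = 1.
Proof. by rewrite -[LHS]mulr1 -{2}[1](starK 1) -starM mulr1 starK. Qed.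

Lemma star_sum (I : Type) (r : seq I) (F : I -> A) :
  star (\sum_(i <- r) F i) = \sum_(i <- r) star (F i).
Proof. by elim/big_rec2: _ => [|i x y _ <-]; rewrite ?star0 ?starD. Qed.

Lemma cnorm_star_eq a : cnorm (star a) = cnorm a.
Proof.
suff le b : cnorm b <= cnorm (star b) by apply/eqP; rewrite eq_le le -{2}[a]starK le.
have [b0|b0] := eqVneq (cnorm b) 0; first by rewrite b0 cnorm_ge0.
have bgt0 : 0 < cnorm b by rewrite lt_def b0 cnorm_ge0.
rewrite -(ler_pM2r bgt0) -expr2 -cnorm_star; exact: cnormM.
Qed.

Lemma cnorm1 : cnorm (1 : A) = 1.
Proof.
have n1 : cnorm (1 : A) != 0 by apply/eqP => /cnorm_eq0 /eqP; rewrite oner_eq0.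
by apply: (mulfI n1); rewrite mulr1 -expr2 -cnorm_star star1 mulr1.
Qed.

Lemma cnormX_le a n : cnorm (a ^+ n) <= cnorm a ^+ n.
Proof.
elim: n => [|n IH]; first by rewrite cnorm1.
by rewrite !exprS (le_trans (cnormM _ _))// ler_wpM2l// cnorm_ge0.
Qed.

Lemma cnorm_unitary a : unitary a -> cnorm a = 1.
Proof.
move=> [aa _]; apply/eqP; rewrite -(@eqrXn2 _ 2)// ?cnorm_ge0//.
by rewrite -cnorm_star aa cnorm1 expr1n.
Qed.

(** The C*-identity iterated along powers of two. *)
Lemma cnorm_selfadjoint_exp2 a n : star a = a -> cnorm (a ^+ (2 ^ n)) = cnorm a ^+ (2 ^ n).
Proof.
move=> sa; have sX m : star (a ^+ m) = a ^+ m.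
  by elim: m => [|m IH]; rewrite ?expr0 ?star1// exprS starM IH sa -exprSr exprS.
elim: n => [|n IH]; first by rewrite !expr1.
by rewrite expnS mulnC !exprM -IH -cnorm_star sX expr2.
Qed.

Definition converges (a_ : nat -> A) a := null (fun n => cnorm (a_ n - a)).

Lemma converges_unique (a_ : nat -> A) a b : converges a_ a -> converges a_ b -> a = b.
Proof.
move=> ca cb; apply/eqP; rewrite -subr_eq0; apply/eqP/cnorm_eq0.
apply: (null_cst0 (cnorm_ge0 _)); apply: null_le (nullD ca cb) => n.
have -> : a - b = (a - a_ n) + (a_ n - b) by rewrite addrA subrK.
by rewrite (le_trans (cnormD _ _))// lerD// cnorm_dist.
Qed.

Lemma converges_cst a : converges (fun=> a) a.
Proof. by apply: null_le (@null0 R) => n; rewrite subrr cnorm0. Qed.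

Lemma convergesD (a_ b_ : nat -> A) a b : converges a_ a -> converges b_ b ->
  converges (fun n => a_ n + b_ n) (a + b).
Proof.
move=> ca cb; apply: null_le (nullD ca cb) => n.
by rewrite opprD addrACA cnormD.
Qed.

Lemma convergesZ k (a_ : nat -> A) a : converges a_ a ->
  converges (fun n => k *: a_ n) (k *: a).
Proof.
move=> ca; apply: null_le (nullM (normr_ge0 k) _ ca) => n; last exact: cnorm_ge0.
by rewrite -scalerBr cnormZ.
Qed.

Lemma convergesMl b (a_ : nat -> A) a : converges a_ a ->
  converges (fun n => b * a_ n) (b * a).
Proof.
move=> ca; apply: null_le (nullM (cnorm_ge0 b) _ ca) => n; last exact: cnorm_ge0.
by rewrite -mulrBr cnormM.
Qed.

Lemma convergesMr b (a_ : nat -> A) a : converges a_ a ->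
  converges (fun n => a_ n * b) (a * b).
Proof.
move=> ca; apply: null_le (nullM (cnorm_ge0 b) _ ca) => n; last exact: cnorm_ge0.
by rewrite -mulrBl mulrC cnormM.
Qed.

Lemma converges_star (a_ : nat -> A) a : converges a_ a ->
  converges (fun n => star (a_ n)) (star a).
Proof. by apply: null_le => n; rewrite -starN -starD cnorm_star_eq. Qed.

Lemma converges_shift (a_ : nat -> A) a : converges a_ a -> converges (fun n => a_ n.+1) a.
Proof. by move=> ca e /ca[n0 Hn0]; exists n0 => n n0n; apply: Hn0; exact: leqW. Qed.

Lemma converges_bounded (a_ : nat -> A) a : converges a_ a ->
  exists2 n0, 0 <= cnorm a + 1 & forall n, (n0 <= n)%N -> cnorm (a_ n) <= cnorm a + 1.
Proof.
move=> ca; have [n0 Hn0] := ca 1 ltr01; exists n0 => [|n /Hn0 le1].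
  by rewrite addr_ge0// cnorm_ge0.
by rewrite -[a_ n](subrK a) addrC (le_trans (cnormD _ _))// lerD2l ltW.
Qed.

Lemma convergesM (a_ b_ : nat -> A) a b : converges a_ a -> converges b_ b ->
  converges (fun n => a_ n * b_ n) (a * b).
Proof.
move=> ca cb; have [n0 M0 bM] := converges_bounded cb.
apply: (null_near (n1 := n0) _ (nullD (nullM M0 (fun n => cnorm_ge0 _) ca)
  (nullM (cnorm_ge0 a) (fun n => cnorm_ge0 _) cb))) => n /bM bn.
have -> : a_ n * b_ n - a * b = (a_ n - a) * b_ n + a * (b_ n - b).
  by rewrite mulrBl mulrBr addrA subrK.
rewrite (le_trans (cnormD _ _))// lerD ?cnormM// (le_trans (cnormM _ _))//.
by rewrite mulrC ler_wpM2r// cnorm_ge0.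
Qed.

Lemma converges_le (a_ : nat -> A) a k : 0 <= k -> converges a_ a ->
  (forall n, cnorm (a_ n) <= k) -> cnorm a <= k.
Proof.
move=> k0 ca ak; apply: (nonneg_le_of_null (cnorm_ge0 a) k0 _ ca) => n.
rewrite -{1}[a](subrK (a_ n)) addrC (le_trans (cnormD _ _))// lerD//.
by rewrite cnorm_dist.
Qed.

End CStarCalculus.

(** * Square roots *)

Section SquareRoot.
Variables (R : realType) (A : cstarAlgType R) (b : A).
Hypothesis b1 : cnorm b <= 1.
Local Notation C := R[i].
Local Open Scope complex_scope.

(** Newton's binomial series for [1 - sqrt (1 - b)], in the form of the iteration
    [y |-> (b + y ^+ 2) / 2]. *)
Fixpoint sqrt_iter n : A := if n is m.+1 then 2^-1 *: (b + sqrt_iter m * sqrt_iter m) else 0.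

Fixpoint sqrt_bound n : R := if n is m.+1 then 2^-1 * (1 + sqrt_bound m * sqrt_bound m) else 0.

Lemma sqrt_bound_ge0 n : 0 <= sqrt_bound n.
Proof. by elim: n => //= n IH; rewrite mulr_ge0 ?invr_ge0 ?addr_ge0 ?mulr_ge0. Qed.

Lemma sqrt_bound_le1 n : sqrt_bound n <= 1.
Proof.
elim: n => [|n IH]; first exact: ler01.
by have /= := sqrt_bound_ge0 n; nra.
Qed.

Lemma sqrt_iter_bound n : cnorm (sqrt_iter n) <= (sqrt_bound n)%:C.
Proof.
have half0 : 0 <= 2^-1 :> C by rewrite invr_ge0.
elim: n => [|n IH] /=; first by rewrite cnorm0.
rewrite cnormZ ger0_norm// rmorphM rmorphD rmorphM fmorphV rmorph1 rmorph_nat.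
rewrite ler_wpM2l// (le_trans (cnormD _ _))// lerD// (le_trans (cnormM _ _))//.
by rewrite ler_pM ?cnorm_ge0.
Qed.

Lemma sqrt_iter_step n :
  cnorm (sqrt_iter n.+1 - sqrt_iter n) <= (sqrt_bound n.+1 - sqrt_bound n)%:C.
Proof.
have half0 : 0 <= 2^-1 :> C by rewrite invr_ge0.
elim: n => [|n IH].
  rewrite /= !mulr0 !addr0 !subr0 cnormZ ger0_norm// mulr1 fmorphV rmorph_nat.
  by rewrite -[leRHS]mulr1 ler_wpM2l.
set y1 := sqrt_iter n.+1 in IH *; set y0 := sqrt_iter n in IH *.
set r1 := sqrt_bound n.+1 in IH *; set r0 := sqrt_bound n in IH *.
have -> : sqrt_iter n.+2 - y1 = 2^-1 *: (y1 * (y1 - y0) + (y1 - y0) * y0).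
  rewrite {2}/y1 /= -scalerBr -/y1 -/y0; congr (_ *: _).
  by rewrite mulrBr mulrBl addrA subrK opprD addrACA subrr add0r.
have -> : sqrt_bound n.+2 - r1 = 2^-1 * (r1 * (r1 - r0) + (r1 - r0) * r0).
  have r00 : r0 * r0 = 2 * r1 - 1 by rewrite /r1 /= -/r0; field.
  by rewrite mulrBr mulrBl r00 /= -/r0 -[X in X * X]/r1; field.
rewrite cnormZ ger0_norm// rmorphM rmorphD fmorphV rmorph_nat ler_wpM2l//.
rewrite (le_trans (cnormD _ _))// lerD// (le_trans (cnormM _ _))// rmorphM.
  by rewrite ler_pM ?cnorm_ge0//; exact: sqrt_iter_bound.
by rewrite ler_pM ?cnorm_ge0//; exact: sqrt_iter_bound.
Qed.

Lemma sqrt_bound_nondecreasing : nondecreasing_seq sqrt_bound.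
Proof.
apply/nondecreasing_seqP => n; rewrite -subr_ge0 -ler0c.
exact: le_trans (cnorm_ge0 _) (sqrt_iter_step n).
Qed.

(** As the iterates are polynomials in [b] with nonnegative coefficients, their
    increments are dominated by those of the same iteration at the real number
    1, which is monotone and bounded. *)
Lemma sqrt_iter_converges : exists y, converges sqrt_iter y.
Proof.
have cr : cvgn sqrt_bound.
  apply: nondecreasing_is_cvgn; first exact: sqrt_bound_nondecreasing.
  by exists 1 => _ [n _ <-]; exact: sqrt_bound_le1.
have dist m n : cnorm (sqrt_iter (m + n) - sqrt_iter m) <= (sqrt_bound (m + n) - sqrt_bound m)%:C.
  elim: n => [|n IH]; first by rewrite addn0 !subrr cnorm0.
  rewrite addnS -(subrK (sqrt_iter (m + n)) (sqrt_iter (m + n).+1)) -addrA.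
  rewrite -(subrK (sqrt_bound (m + n)) (sqrt_bound (m + n).+1)) -[X in _ <= X%:C]addrA rmorphD.
  by rewrite (le_trans (cnormD _ _))// lerD// sqrt_iter_step.
apply: cnorm_complete => e e0.
have Re0 : 0 < complex.Re e by move: e0; rewrite ltcE => /andP[].
have eE : (complex.Re e)%:C = e by apply: ge0_ReK; exact: ltW.
have [n0 _ Hn0] : \forall n \near \oo, `|limn sqrt_bound - sqrt_bound n| < complex.Re e.
  by apply: cvgr_dist_lt.
exists n0 => m n; wlog mn : m n / (m <= n)%N.
  move=> H n0m n0n; have [/H|/ltnW/H] := leqP m n; first exact.
  by rewrite cnorm_dist; exact.
move=> n0m _; rewrite cnorm_dist -(subnKC mn); apply: (le_lt_trans (dist _ _)).
rewrite -eE ltcR; apply: le_lt_trans (Hn0 m n0m); apply: le_trans (ler_norm _).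
by rewrite lerD2r; apply: nondecreasing_cvgn_le => //; exact: sqrt_bound_nondecreasing.
Qed.

Lemma sqrt_exists : star b = b -> exists y : A,
  [/\ (1 - y) * (1 - y) = 1 - b, cnorm y <= 1, star y = y &
      forall c, c * b = b * c -> c * y = y * c].
Proof.
move=> sb; have [y cy] := sqrt_iter_converges.
have Ey : y = 2^-1 *: (b + y * y).
  apply: converges_unique (converges_shift cy) _.
  by apply: convergesZ; apply: convergesD; [exact: converges_cst|exact: convergesM].
have Eyy : y * y = y + y - b.
  have E2 : y + y = b + y * y.
    have := congr1 (fun z => (2 : C) *: z) Ey; rewrite scalerA divff ?pnatr_eq0// scale1r => <-.
    by rewrite scaler_nat mulr2n.
  by rewrite E2 addrC addKr.
exists y; split.
- rewrite mulrBr mulrBl mulrBl !mul1r mulr1 Eyy opprB.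
  by rewrite [y + y - b - y]addrAC addrK addrA subrK.
- apply: converges_le cy _ => // n; apply: (le_trans (sqrt_iter_bound n)).
  by rewrite -(rmorph1 (real_complex R)) lecR sqrt_bound_le1.
- have sX n : star (sqrt_iter n) = sqrt_iter n.
    elim: n => [|n IH] /=; first exact: star0.
    rewrite starZ starD starM sb IH; congr (_ *: _).
    by rewrite conj_Creal// ger0_real// invr_ge0.
  apply: converges_unique (converges_star cy) _.
  by apply: null_le cy => n; rewrite sX.
- move=> c cb.
  have cX n : c * sqrt_iter n = sqrt_iter n * c.
    elim: n => [|n IH] /=; first by rewrite mulr0 mul0r.
    by rewrite -scalerAr -scalerAl mulrDr mulrDl cb mulrA IH -mulrA IH mulrA.
  apply: converges_unique (convergesMl c cy) _.
  by apply: null_le (convergesMr c cy) => n; rewrite cX.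
Qed.

End SquareRoot.

(** * Schur's lemma *)

Section Schur.
Variables (R : realType) (H : completeNormedModType R[i]).
Variable dot : {dot H for (@Num.conj R[i])}.
Hypothesis H_hilbert : norm_of_dot dot.
Hypothesis H_nontrivial : exists v : H, v != 0.
Local Notation C := R[i].
Local Notation B := (operator_algebra H_hilbert H_nontrivial).
Local Open Scope complex_scope.

Lemma op_addE (S T : B) v : (S + T) v = S v + T v. Proof. by []. Qed.
Lemma op_scaleE a (T : B) v : (a *: T) v = a *: T v. Proof. by []. Qed.
Lemma op_mulE (S T : B) v : (S * T) v = S (T v). Proof. by []. Qed.
Lemma op_oneE v : (1 : B) v = v. Proof. by []. Qed.
Lemma op_zeroE v : (0 : B) v = 0. Proof. by []. Qed.
Lemma op_oppE (T : B) v : (- T) v = - T v. Proof. exact: scaleN1r. Qed.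
Lemma op_starE (T : B) u v : dot (T u) v = dot u (star T v).
Proof. exact: op_starP. Qed.

Lemma op_norm_le (T : B) c : 0 <= c -> (forall v, `|T v| <= c * `|v|) -> cnorm T <= c.
Proof. by move=> c0 Tc; exact: opnorm_le. Qed.

Lemma op_cnorm (T : B) v : `|T v| <= cnorm T * `|v|.
Proof. by case: (op_bounded T) => _; exact. Qed.

Lemma closed_op_kernel (T : B) : closed [set v | T v = 0].
Proof.
have -> : [set v | T v = 0] = T @^-1` [set 0] by [].
apply: closed_comp; last exact: accessible_closed_set1 (hausdorff_accessible (@norm_hausdorff _ H)) _.
by move=> v _; case: (adjointable_bounded_operator (op_adjointable T)) => _; exact.
Qed.

Lemma selfadjoint_dot_real (T : B) v : star T = T -> dot (T v) v \is Num.real.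
Proof. by move=> sT; rewrite CrealE -dotC op_starE sT. Qed.

Variables (G : groupType) (pi : G -> H -> H).
Hypothesis pi_unitary : unitary_representation dot pi.
Hypothesis pi_irreducible : irreducible_representation pi.

Lemma pi1 v : pi 1%g v = v.
Proof.
have [/(_ 1%g)[_ sur _] mul] := pi_unitary.
have [w _ <-] := sur v I.
by have := congr1 (@^~ w) (mul 1%g 1%g); rewrite mulg1 /=.
Qed.

Lemma piM g h v : pi (g * h)%g v = pi g (pi h v).
Proof. by case: pi_unitary => _ ->. Qed.

Lemma pi_adjoint g : adjoint_of dot (pi g) (pi g^-1%g).
Proof.
move=> v w; have [/(_ g)[_ _ iso] _] := pi_unitary.
by rewrite -{1}(pi1 w) -(mulgV g) piM iso.
Qed.

Lemma pi_adjointable g : adjointable dot (pi g).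
Proof.
have [/(_ g)[lin _ iso] _] := pi_unitary; split=> //; last first.
  by exists (pi g^-1%g); exact: pi_adjoint.
exists 1; split=> // v; rewrite mul1r -(@ler_pXn2r _ 2)// ?nnegrE//.
by rewrite -!(dotvv H_hilbert) iso.
Qed.

Definition rep_op g : B := Op (pi_adjointable g).

Lemma rep_op1 : rep_op 1%g = 1.
Proof. by apply: op_ext => v; exact: pi1. Qed.

Lemma rep_opM g h : rep_op (g * h)%g = rep_op g * rep_op h.
Proof. by apply: op_ext => v; exact: piM. Qed.

Lemma star_rep_op g : star (rep_op g) = rep_op g^-1%g.
Proof. by apply: op_star_unique; exact: pi_adjoint. Qed.

Lemma rep_op_unitary g : unitary (rep_op g).
Proof. by split; rewrite star_rep_op -rep_opM ?mulVg ?mulgV rep_op1. Qed.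

Definition intertwiner (T : B) := forall g, T * rep_op g = rep_op g * T.

Lemma intertwinerD S T : intertwiner S -> intertwiner T -> intertwiner (S + T).
Proof. by move=> iS iT g; rewrite mulrDl mulrDr iS iT. Qed.

Lemma intertwinerZ a T : intertwiner T -> intertwiner (a *: T).
Proof. by move=> iT g; rewrite -scalerAl -scalerAr iT. Qed.

Lemma intertwiner1 : intertwiner 1.
Proof. by move=> g; rewrite mul1r mulr1. Qed.

Lemma intertwiner_star T : intertwiner T -> intertwiner (star T).
Proof.
move=> iT g; apply: (can_inj (@starK _ _)).
by rewrite !starM starK star_rep_op iT.
Qed.

(** The kernel is a closed invariant subspace. *)
Lemma intertwiner_kernel T : intertwiner T -> (forall v, T v = 0 -> v = 0) \/ T = 0.
Proof.
move=> iT; have [_ irr] := pi_irreducible.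
have [||||K0|KT] := irr [set v | T v = 0].
- exact: closed_op_kernel.
- exact: linear_map0 (op_linear T).
- by move=> k v w /= v0 w0; rewrite op_linear v0 w0 scaler0 addr0.
- move=> g v /= v0; have := congr1 (fun S : B => S v) (iT g).
  by rewrite /= v0 => ->; exact: linear_map0 (op_linear (rep_op g)).
- by left=> v v0; have : [set v | T v = 0] v by []; rewrite K0.
- right; apply: op_ext => v; have : [set: H] v by []; by rewrite -KT.
Qed.

(** Writing [X] for the positive square root of [T ^+ 2], the product
    [(X - T) * (X + T)] vanishes, and each factor is zero or injective. *)
Lemma intertwiner_definite T : star T = T -> intertwiner T ->
  (forall v, 0 <= dot (T v) v) \/ (forall v, dot (T v) v <= 0).
Proof.
wlog T1 : T / cnorm T <= 1.
  move=> H0 sT iT; set k := cnorm T + 1.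
  have k0 : 0 < k by rewrite ltr_wpDl ?cnorm_ge0.
  have kV : 0 < k^-1 by rewrite invr_gt0.
  have [|||pos|neg] := H0 (k^-1 *: T).
  - by rewrite cnormZ gtr0_norm// ler_pdivrMl// mulr1 lerDl.
  - by rewrite starZ sT conj_Creal// gtr0_real.
  - exact: intertwinerZ.
  - by left=> v; have := pos v; rewrite op_scaleE dotZl pmulr_rge0.
  - by right=> v; have := neg v; rewrite op_scaleE dotZl pmulr_rle0.
move=> sT iT; pose b : B := 1 - T * T.
have sb : star b = b by rewrite /b starD starN starM sT star1.
have b1 : cnorm b <= 1.
  apply: op_norm_le => // v; rewrite mul1r -(@ler_pXn2r _ 2)// ?nnegrE//.
  rewrite -!(dotvv H_hilbert) /b op_addE op_oppE op_mulE op_oneE dotBl !dotBr.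
  have TT u w : dot (T u) w = dot u (T w) by rewrite op_starE sT.
  rewrite [dot (T (T v)) v]TT -[dot v (T (T v))]TT !(dotvv H_hilbert).
  rewrite -subr_ge0 (_ : _ - _ = `|T v| ^+ 2 + (`|T v| ^+ 2 - `|T (T v)| ^+ 2)); last by ring.
  rewrite addr_ge0// ?exprn_ge0// subr_ge0 ler_pXn2r// ?nnegrE//.
  by rewrite (le_trans (op_cnorm _ _))// -[leRHS]mul1r ler_wpM2r.
have [y [yy y1 sy cy]] := sqrt_exists b1 sb.
have iy : intertwiner y.
  move=> g; apply/esym/cy; rewrite /b mulrBr mulrBl mulr1 mul1r.
  by rewrite mulrA -iT -mulrA -iT mulrA.
have Ty : T * y = y * T by apply: cy; rewrite /b mulrBr mulrBl mulr1 mul1r mulrA.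
pose X : B := 1 - y.
have pX v : 0 <= dot (X v) v.
  rewrite /X op_addE op_oppE op_oneE dotBl (dotvv H_hilbert) subr_ge0.
  rewrite (le_trans (real_ler_norm _))// ?selfadjoint_dot_real//.
  rewrite (le_trans (cauchy_schwarz H_hilbert _ _))// expr2 ler_wpM2r//.
  by rewrite (le_trans (op_cnorm _ _))// -[leRHS]mul1r ler_wpM2r.
have XT : (X - T) * (X + T) = 0.
  have XX : X * X = T * T by rewrite /X yy /b opprB addrC subrK.
  have TX : T * X = X * T by rewrite /X mulrBl mulrBr mul1r mulr1 Ty.
  by rewrite mulrBl mulrDr [T * (X + T)]mulrDr XX TX [T * T + _]addrC subrr.
have iXT : intertwiner (X - T).
  apply: intertwinerD; first apply: intertwinerD; first exact: intertwiner1.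
    by rewrite -scaleN1r; exact: intertwinerZ.
  by rewrite -scaleN1r; exact: intertwinerZ.
case: (intertwiner_kernel iXT) => [inj|XT0]; last first.
  by left=> v; have -> : T = X by apply/esym/eqP; rewrite -subr_eq0 XT0.
right=> v; have -> : T = - X.
  apply/eqP; rewrite -subr_eq0 opprK addrC; apply/eqP/op_ext => w.
  by apply: inj; rewrite -op_mulE XT.
by rewrite op_oppE dotNl oppr_le0.
Qed.

Lemma selfadjoint_dot0 (T : B) : star T = T -> (forall v, dot (T v) v = 0) -> T = 0.
Proof.
move=> sT T0; apply: op_ext => v.
have := T0 (v + T v); rewrite opD dotDl !dotDr !T0 add0r addr0.
rewrite [dot (T (T v)) v]op_starE sT (dotvv H_hilbert) -mulr2n => /eqP.
by rewrite mulrn_eq0 /= sqrf_eq0 normr_eq0 => /eqP.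
Qed.

(** For every real [c] the operator [T - c] is definite, and the Rayleigh quotient
    [a] of [T] at one vector decides its sign; so all Rayleigh quotients are
    within [e] of [a], for every [e]. *)
Lemma schur_selfadjoint T : star T = T -> intertwiner T -> exists a, T = a *: 1.
Proof.
move=> sT iT; have [v0 nz] := H_nontrivial.
have n0 : 0 < `|v0| ^+ 2 by rewrite exprn_gt0// normr_gt0.
pose a := dot (T v0) v0 / `|v0| ^+ 2.
have ar : a \is Num.real.
  by rewrite realM ?selfadjoint_dot_real// realV ger0_real// ltW.
exists a; apply/eqP; rewrite -subr_eq0; apply/eqP/selfadjoint_dot0.
  by rewrite starD starN starZ star1 sT conj_Creal.
move=> v; rewrite op_addE op_oppE op_scaleE op_oneE dotBl dotZl (dotvv H_hilbert).
have near e : 0 < e -> `|dot (T v) v - a * `|v| ^+ 2| <= e * `|v| ^+ 2.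
  move=> e0; have er : e \is Num.real by exact: gtr0_real.
  have shift c : c \is Num.real ->
      (forall w, c * `|w| ^+ 2 <= dot (T w) w) \/ (forall w, dot (T w) w <= c * `|w| ^+ 2).
    move=> cr; have [||pos|neg] := @intertwiner_definite (T - c *: 1).
    - by rewrite starD starN starZ star1 sT conj_Creal.
    - apply: intertwinerD => //; rewrite -scaleN1r; apply: intertwinerZ.
      exact: intertwinerZ intertwiner1.
    - left=> w; have := pos w; rewrite op_addE op_oppE op_scaleE op_oneE dotBl dotZl.
      by rewrite (dotvv H_hilbert) subr_ge0.
    - right=> w; have := neg w; rewrite op_addE op_oppE op_scaleE op_oneE dotBl dotZl.
      by rewrite (dotvv H_hilbert) subr_le0.
  have av0 : dot (T v0) v0 = a * `|v0| ^+ 2 by rewrite /a divfK// gt_eqF.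
  have lo : (a - e) * `|v| ^+ 2 <= dot (T v) v.
    have [|//|/(_ v0)] := shift (a - e); first by rewrite realB.
    by rewrite av0 ler_pM2r// lerBrDr gerDl lt_geF.
  have hi : dot (T v) v <= (a + e) * `|v| ^+ 2.
    have [|/(_ v0)|//] := shift (a + e); first by rewrite realD.
    by rewrite av0 ler_pM2r// gerDl lt_geF.
  rewrite real_ler_norml; last first.
    by rewrite realB ?selfadjoint_dot_real// realM// ger0_real// exprn_ge0.
  by move: lo hi; rewrite mulrBl mulrDl lerBrDl => ->; rewrite lerBlDl.
apply: normr0_eq0; apply: (eps_eq0 (c := `|v| ^+ 2)) => //; exact: exprn_ge0.
Qed.

Theorem schur T : intertwiner T -> exists a, T = a *: 1.
Proof.
move=> iT; have iT' := intertwiner_star iT.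
have [a Ea] : exists a, T + star T = a *: 1.
  apply: schur_selfadjoint; last exact: intertwinerD.
  by rewrite starD starK addrC.
have [b Eb] : exists b, 'i *: (T - star T) = b *: 1.
  apply: schur_selfadjoint.
    by rewrite starZ starD starN starK conjCi scaleNr -scalerN opprB.
  apply: intertwinerZ; apply: intertwinerD => //.
  by rewrite -scaleN1r; exact: intertwinerZ.
have {}Eb : T - star T = (- 'i * b) *: 1.
  have := congr1 (fun S => - 'i *: S) Eb; rewrite !scalerA mulNr -expr2 sqrCi opprK.
  by rewrite scale1r.
exists (2^-1 * (a - 'i * b)); rewrite -scalerA -mulNr scalerDl -Ea -Eb.
have -> : T + star T + (T - star T) = (2 : C) *: T.
  by rewrite addrACA subrr addr0 scaler_nat mulr2n.
by rewrite scalerA mulVf ?scale1r// pnatr_eq0.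
Qed.

End Schur.

(** * Completing a formal algebra for a family of evaluations *)

(** Formal elements, with formal operations subject to no law, are evaluated in
    the C*-algebras [fa_alg i]. Uniformly Cauchy sequences of formal elements,
    identified when all their limits agree, form a C*-algebra whose axioms are
    checked after evaluation at every [i]. Sequences are preferred to families
    of limits because they live in the universe of [fa_sort], however large the
    index type; this lets the index range over all C*-algebras. *)
Record formal_algebra (R : realType) := FormalAlgebra {
  fa_sort : Type;
  fa_index : Type;
  fa_alg : fa_index -> cstarAlgType R;
  fa_ev : forall i, fa_sort -> fa_alg i;
  fa_index0 : fa_index;
  fa_add : fa_sort -> fa_sort -> fa_sort;
  fa_mul : fa_sort -> fa_sort -> fa_sort;
  fa_scale : R[i] -> fa_sort -> fa_sort;
  fa_star : fa_sort -> fa_sort;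
  fa_one : fa_sort;
  fa_evD : forall i a b, fa_ev i (fa_add a b) = fa_ev i a + fa_ev i b;
  fa_evM : forall i a b, fa_ev i (fa_mul a b) = fa_ev i a * fa_ev i b;
  fa_evZ : forall i k a, fa_ev i (fa_scale k a) = k *: fa_ev i a;
  fa_ev_star : forall i a, fa_ev i (fa_star a) = star (fa_ev i a);
  fa_ev1 : forall i, fa_ev i fa_one = 1;
  fa_bounded : forall a, exists2 c : R[i], 0 <= c & forall i, cnorm (fa_ev i a) <= c }.

Section Completion.
Variables (R : realType) (F : formal_algebra R).
Local Notation C := R[i].
Local Notation W := (fa_sort F).
Local Notation I := (fa_index F).
Local Notation B := (@fa_alg _ F).
Local Notation ev := (@fa_ev _ F).
Local Notation wadd := (@fa_add _ F).
Local Notation wmul := (@fa_mul _ F).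
Local Notation wscale := (@fa_scale _ F).
Local Notation wstar := (@fa_star _ F).
Local Notation wone := (@fa_one _ F).
Local Notation i0 := (fa_index0 F).

Definition uniformly_cauchy (s : nat -> W) := forall e, 0 < e -> exists n0, forall m n,
  (n0 <= m)%N -> (n0 <= n)%N -> forall i, cnorm (ev i (s m) - ev i (s n)) <= e.

Record cseq := Cseq { cseq_fun :> nat -> W; cseq_cauchy : uniformly_cauchy cseq_fun }.

Lemma cseq_limit_ex (s : cseq) i : exists a, converges (fun n => ev i (s n)) a.
Proof.
apply: cnorm_complete => e e0; have [n0 H] := cseq_cauchy s (divr_gt0 e0 (ltr0n _ 2)).
exists n0 => m n n0m n0n; apply: le_lt_trans (H m n n0m n0n i) _.
by rewrite ltr_pdivrMr// ltr_pMr// ltr1n.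
Qed.

Definition cseq_lim i (s : cseq) : B i := projT1 (cid (cseq_limit_ex s i)).

Lemma cseq_limP i (s : cseq) : converges (fun n => ev i (s n)) (cseq_lim i s).
Proof. exact: projT2 (cid (cseq_limit_ex s i)). Qed.

Lemma cseq_lim_uniform (s : cseq) e : 0 < e -> exists n0, forall n, (n0 <= n)%N ->
  forall i, cnorm (ev i (s n) - cseq_lim i s) <= e.
Proof.
move=> e0; have [n0 H] := cseq_cauchy s e0; exists n0 => n n0n i.
have cs := cseq_limP i s.
apply: (nonneg_le_of_null (d := fun m => cnorm (ev i (s (m + n0)%N) - cseq_lim i s))).
- exact: cnorm_ge0.
- exact: ltW.
- move=> m; have -> : ev i (s n) - cseq_lim i s =
      (ev i (s n) - ev i (s (m + n0)%N)) + (ev i (s (m + n0)%N) - cseq_lim i s).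
    by rewrite addrA subrK.
  by rewrite (le_trans (cnormD _ _))// lerD2r; apply: H => //; exact: leq_addl.
- move=> e' /cs[n1 H1]; exists n1 => m n1m; apply: H1.
  by rewrite (leq_trans n1m)// leq_addr.
Qed.

Lemma cseq_bounded (s : cseq) : exists2 c, 0 <= c & exists n0, forall n, (n0 <= n)%N ->
  forall i, cnorm (ev i (s n)) <= c.
Proof.
have [n0 H] := cseq_cauchy s ltr01; have [c c0 Hc] := fa_bounded (s n0).
exists (1 + c); first exact: addr_ge0.
exists n0 => n n0n i; rewrite -[ev i (s n)](subrK (ev i (s n0))).
by rewrite (le_trans (cnormD _ _))// lerD// H.
Qed.

Lemma cseq_lim_bounded (s : cseq) : exists2 c, 0 <= c & forall i, cnorm (cseq_lim i s) <= c.
Proof.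
have [n0 H] := cseq_lim_uniform s ltr01; have [c c0 Hc] := fa_bounded (s n0).
exists (1 + c) => [|i]; first exact: addr_ge0.
rewrite -[cseq_lim i s](subrK (ev i (s n0))) (le_trans (cnormD _ _))// lerD//.
by rewrite cnorm_dist H.
Qed.

Fact cst_cauchy (a : W) : uniformly_cauchy (fun=> a).
Proof. by move=> e e0; exists 0%N => m n _ _ i; rewrite subrr cnorm0 ltW. Qed.

Definition cseq_cst a := Cseq (cst_cauchy a).

Fact add_cauchy (s t : cseq) : uniformly_cauchy (fun n => wadd (s n) (t n)).
Proof.
move=> e e0; have e2 : 0 < e / 2 by rewrite divr_gt0.
have [n0 H0] := cseq_cauchy s e2; have [n1 H1] := cseq_cauchy t e2.
exists (maxn n0 n1) => m n; rewrite !geq_max => /andP[m0 m1] /andP[p0 p1] i.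
rewrite !fa_evD opprD addrACA (le_trans (cnormD _ _))// [leRHS]splitr lerD//.
  exact: H0.
exact: H1.
Qed.

Fact scale_cauchy k (s : cseq) : uniformly_cauchy (fun n => wscale k (s n)).
Proof.
move=> e e0; have k1 : 0 < `|k| + 1 by rewrite ltr_wpDl.
have [n0 H] := cseq_cauchy s (divr_gt0 e0 k1); exists n0 => m n n0m n0n i.
rewrite !fa_evZ -scalerBr cnormZ.
rewrite (le_trans (ler_wpM2l _ (H m n n0m n0n i)))//.
by rewrite mulrCA ger_pMr// ler_pdivrMr// mul1r lerDl.
Qed.

Fact star_cauchy (s : cseq) : uniformly_cauchy (fun n => wstar (s n)).
Proof.
move=> e /(cseq_cauchy s)[n0 H]; exists n0 => m n n0m n0n i.
by rewrite !fa_ev_star -starN -starD cnorm_star_eq; exact: H.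
Qed.

Fact mul_cauchy (s t : cseq) : uniformly_cauchy (fun n => wmul (s n) (t n)).
Proof.
move=> e e0; have [c c0 [n0 Hc]] := cseq_bounded s; have [d d0 [n1 Hd]] := cseq_bounded t.
have cd : 0 < c + d + 1 by rewrite ltr_wpDl// addr_ge0.
have e2 : 0 < e / (c + d + 1) by rewrite divr_gt0.
have [n2 H2] := cseq_cauchy s e2; have [n3 H3] := cseq_cauchy t e2.
exists (maxn (maxn n0 n1) (maxn n2 n3)) => m n; rewrite !geq_max.
move=> /andP[/andP[m0 m1] /andP[m2 m3]] /andP[/andP[p0 p1] /andP[p2 p3]] i.
rewrite !fa_evM; set a := ev i (s m); set b := ev i (t m).
set a' := ev i (s n); set b' := ev i (t n).
have -> : a * b - a' * b' = a * (b - b') + (a - a') * b'.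
  by rewrite mulrBr mulrBl addrA subrK.
rewrite (le_trans (cnormD _ _))//.
apply: (@le_trans _ _ (c * (e / (c + d + 1)) + (e / (c + d + 1)) * d)).
  rewrite lerD// (le_trans (cnormM _ _))// ler_pM ?cnorm_ge0//.
  - exact: Hc.
  - exact: H3.
  - exact: H2.
  - exact: Hd.
by rewrite [X in X + _]mulrC -mulrDr mulrAC -mulrA ger_pMr// ler_pdivrMr// mul1r lerDl.
Qed.

HB.instance Definition _ := gen_eqMixin cseq.
HB.instance Definition _ := gen_choiceMixin cseq.

Definition cseq_eq : rel cseq := fun s t => `[< forall i, cseq_lim i s = cseq_lim i t >].

Fact cseq_eqP : equiv_class_of cseq_eq.
Proof.
split=> [s|s t|t s u]; first exact/asboolP.
- by apply/asboolP/asboolP => st i; rewrite st.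
- by move=> /asboolP st /asboolP tu; apply/asboolP => i; rewrite st tu.
Qed.

Canonical cseq_equiv := EquivRelPack cseq_eqP.

Definition completion : Type := {eq_quot cseq_equiv}.

HB.instance Definition _ := Choice.on completion.
HB.instance Definition _ := EqQuotient.on completion.

Implicit Types (x y z : completion).

Definition cev i x : B i := cseq_lim i (repr x).

Lemma cev_pi i (s : cseq) : cev i (\pi_completion s) = cseq_lim i s.
Proof.
have : \pi_completion (repr (\pi_completion s)) = \pi_completion s by rewrite reprK.
by move/eqmodP/asboolP => /(_ i).
Qed.

(** The evaluations are jointly faithful: every identity in the completion is
    proved through them. *)
Lemma cev_ext x y : (forall i, cev i x = cev i y) -> x = y.
Proof.
by move=> xy; rewrite -[x]reprK -[y]reprK; apply/eqmodP/asboolP.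
Qed.

Definition ccst a : completion := \pi_completion (cseq_cst a).

Lemma cev_cst i a : cev i (ccst a) = ev i a.
Proof.
rewrite cev_pi; apply: converges_unique (cseq_limP i (cseq_cst a)) _.
exact: (converges_cst (ev i a)).
Qed.

Definition cadd x y : completion := \pi_completion (Cseq (add_cauchy (repr x) (repr y))).
Definition cscale k x : completion := \pi_completion (Cseq (scale_cauchy k (repr x))).
Definition cmul x y : completion := \pi_completion (Cseq (mul_cauchy (repr x) (repr y))).
Definition cstar_op x : completion := \pi_completion (Cseq (star_cauchy (repr x))).
Definition copp x := cscale (-1) x.
Definition cone := ccst wone.
Definition czero := cscale 0 cone.

Lemma cev_add i x y : cev i (cadd x y) = cev i x + cev i y.
Proof.
rewrite cev_pi /cev; apply: converges_unique (cseq_limP i _) _ => /=.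
by apply: null_le (convergesD (cseq_limP i _) (cseq_limP i _)) => n; rewrite fa_evD.
Qed.

Lemma cev_scale i k x : cev i (cscale k x) = k *: cev i x.
Proof.
rewrite cev_pi /cev; apply: converges_unique (cseq_limP i _) _ => /=.
by apply: null_le (convergesZ k (cseq_limP i _)) => n; rewrite fa_evZ.
Qed.

Lemma cev_mul i x y : cev i (cmul x y) = cev i x * cev i y.
Proof.
rewrite cev_pi /cev; apply: converges_unique (cseq_limP i _) _ => /=.
by apply: null_le (convergesM (cseq_limP i _) (cseq_limP i _)) => n; rewrite fa_evM.
Qed.

Lemma cev_star i x : cev i (cstar_op x) = star (cev i x).
Proof.
rewrite cev_pi /cev; apply: converges_unique (cseq_limP i _) _ => /=.
by apply: null_le (converges_star (cseq_limP i _)) => n; rewrite fa_ev_star.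
Qed.

Lemma cev_one i : cev i cone = 1.
Proof. by rewrite cev_cst fa_ev1. Qed.

Lemma cev_zero i : cev i czero = 0.
Proof. by rewrite cev_scale scale0r. Qed.

Lemma cev_opp i x : cev i (copp x) = - cev i x.
Proof. by rewrite cev_scale scaleN1r. Qed.

Let cevE := (cev_add, cev_scale, cev_mul, cev_star, cev_one, cev_zero, cev_opp).

Fact caddA : associative cadd.
Proof. by move=> x y z; apply: cev_ext => i; rewrite !cevE addrA. Qed.
Fact caddC : commutative cadd.
Proof. by move=> x y; apply: cev_ext => i; rewrite !cevE addrC. Qed.
Fact cadd0 : left_id czero cadd.
Proof. by move=> x; apply: cev_ext => i; rewrite !cevE add0r. Qed.
Fact caddN : left_inverse czero copp cadd.
Proof. by move=> x; apply: cev_ext => i; rewrite !cevE addNr. Qed.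

HB.instance Definition _ := GRing.isZmodule.Build completion caddA caddC cadd0 caddN.

Fact cmulA : associative cmul.
Proof. by move=> x y z; apply: cev_ext => i; rewrite !cevE mulrA. Qed.
Fact cmul1 : left_id cone cmul.
Proof. by move=> x; apply: cev_ext => i; rewrite !cevE mul1r. Qed.
Fact c1mul : right_id cone cmul.
Proof. by move=> x; apply: cev_ext => i; rewrite !cevE mulr1. Qed.
Fact cmulDl : left_distributive cmul cadd.
Proof. by move=> x y z; apply: cev_ext => i; rewrite !cevE mulrDl. Qed.
Fact cmulDr : right_distributive cmul cadd.
Proof. by move=> x y z; apply: cev_ext => i; rewrite !cevE mulrDr. Qed.
Fact cone_neq0 : cone != czero.
Proof.
apply/eqP => /(congr1 (cev i0)); rewrite !cevE => /eqP; exact/negP/oner_neq0.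
Qed.

HB.instance Definition _ := GRing.Zmodule_isNzRing.Build completion
  cmulA cmul1 c1mul cmulDl cmulDr cone_neq0.

Fact cscaleA a b x : cscale a (cscale b x) = cscale (a * b) x.
Proof. by apply: cev_ext => i; rewrite !cevE scalerA. Qed.
Fact cscale1 : left_id 1 cscale.
Proof. by move=> x; apply: cev_ext => i; rewrite !cevE scale1r. Qed.
Fact cscaleDr : right_distributive cscale cadd.
Proof. by move=> a x y; apply: cev_ext => i; rewrite !cevE scalerDr. Qed.
Fact cscaleDl x : {morph cscale^~ x : a b / a + b}.
Proof. by move=> a b; apply: cev_ext => i; rewrite !cevE scalerDl. Qed.

HB.instance Definition _ := GRing.Zmodule_isLmodule.Build C completion
  cscaleA cscale1 cscaleDr cscaleDl.

Fact cscaleAl a x y : a *: (x * y) = (a *: x) * y.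
Proof. by apply: cev_ext => i; rewrite !cevE scalerAl. Qed.

HB.instance Definition _ := GRing.Lmodule_isLalgebra.Build C completion cscaleAl.

Fact cscaleAr a x y : a *: (x * y) = x * (a *: y).
Proof. by apply: cev_ext => i; rewrite !cevE scalerAr. Qed.

HB.instance Definition _ := GRing.Lalgebra_isAlgebra.Build C completion cscaleAr.

Definition cbound c x := 0 <= c /\ forall i, cnorm (cev i x) <= c.

(** The supremum of the norms of all evaluations, as the least common bound. *)
Definition completion_norm x : C := infC [set c | cbound c x].

Lemma cbound_ex x : exists c, cbound c x.
Proof. by have [c c0 Hc] := cseq_lim_bounded (repr x); exists c. Qed.

Lemma completion_norm_bound x : cbound (completion_norm x) x.
Proof.
have [c bc] := cbound_ex x; split; first by apply: infC_ge => //; [exists c|move=> ? []].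
by move=> i; apply: infC_ge; [exact: cnorm_ge0|exists c|move=> ? []].
Qed.

Lemma completion_norm_le c x : cbound c x -> completion_norm x <= c.
Proof. by move=> bc; apply: infC_le => // ? []. Qed.

Lemma completion_norm_ge0 x : 0 <= completion_norm x.
Proof. by case: (completion_norm_bound x). Qed.

Lemma cev_norm i x : cnorm (cev i x) <= completion_norm x.
Proof. by case: (completion_norm_bound x). Qed.

Fact completion_starK : involutive cstar_op.
Proof. by move=> x; apply: cev_ext => i; rewrite !cevE starK. Qed.
Fact completion_starD x y : cstar_op (x + y) = cstar_op x + cstar_op y.
Proof. by apply: cev_ext => i; rewrite !cevE starD. Qed.
Fact completion_starZ k x : cstar_op (k *: x) = Num.conj k *: cstar_op x.
Proof. by apply: cev_ext => i; rewrite !cevE starZ. Qed.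
Fact completion_starM x y : cstar_op (x * y) = cstar_op y * cstar_op x.
Proof. by apply: cev_ext => i; rewrite !cevE starM. Qed.

Fact completion_norm_eq0 x : completion_norm x = 0 -> x = 0.
Proof.
move=> x0; apply: cev_ext => i; rewrite cev_zero; apply: cnorm_eq0; apply: le_anti.
by rewrite cnorm_ge0 andbT -x0 cev_norm.
Qed.
Fact completion_normD x y : completion_norm (x + y) <= completion_norm x + completion_norm y.
Proof.
apply: completion_norm_le; split=> [|i]; first by rewrite addr_ge0 ?completion_norm_ge0.
by rewrite cev_add (le_trans (cnormD _ _))// lerD// cev_norm.
Qed.
Fact completion_normZ k x : completion_norm (k *: x) = `|k| * completion_norm x.
Proof.
have le j y : completion_norm (j *: y) <= `|j| * completion_norm y.
  apply: completion_norm_le; split=> [|i]; first by rewrite mulr_ge0 ?completion_norm_ge0.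
  by rewrite cev_scale cnormZ ler_wpM2l// cev_norm.
apply/eqP; rewrite eq_le le /=; have [->|k0] := eqVneq k 0.
  by rewrite normr0 mul0r completion_norm_ge0.
have nk : 0 < `|k| by rewrite normr_gt0.
have := le k^-1 (k *: x); rewrite scalerA mulVf// scale1r normfV.
by rewrite ler_pdivlMl.
Qed.
Fact completion_normM x y : completion_norm (x * y) <= completion_norm x * completion_norm y.
Proof.
apply: completion_norm_le; split=> [|i]; first by rewrite mulr_ge0 ?completion_norm_ge0.
by rewrite cev_mul (le_trans (cnormM _ _))// ler_pM ?cnorm_ge0// cev_norm.
Qed.
Fact completion_norm_star x : completion_norm (cstar_op x * x) = completion_norm x ^+ 2.
Proof.
have n0 := completion_norm_ge0; apply/eqP; rewrite eq_le; apply/andP; split.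
  apply: completion_norm_le; split=> [|i]; first exact: exprn_ge0.
  by rewrite cev_mul cev_star cnorm_star lerXn2r ?nnegrE ?cnorm_ge0// cev_norm.
have s0 : 0 <= sqrtC (completion_norm (cstar_op x * x)) by rewrite sqrtC_ge0.
have : completion_norm x <= sqrtC (completion_norm (cstar_op x * x)).
  apply: completion_norm_le; split=> // i; rewrite -(@ler_pXn2r _ 2)// ?nnegrE ?cnorm_ge0//.
  by rewrite sqrtCK -cnorm_star -cev_star -cev_mul cev_norm.
by rewrite -(@ler_pXn2r _ 2)// ?nnegrE ?n0// sqrtCK.
Qed.

Lemma ccst_approx x e : 0 < e -> exists a, completion_norm (x - ccst a) <= e.
Proof.
move=> e0; have [n0 H] := cseq_lim_uniform (repr x) e0.
exists (repr x n0); apply: completion_norm_le; split; first exact: ltW.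
by move=> i; rewrite cev_add cev_opp cev_cst cnorm_dist; exact: H.
Qed.

Fact completion_complete (x_ : nat -> completion) :
  (forall e : C, 0 < e -> exists n0, forall m n,
     (n0 <= m)%N -> (n0 <= n)%N -> completion_norm (x_ m - x_ n) < e) ->
  exists x, forall e : C, 0 < e -> exists n0, forall n,
     (n0 <= n)%N -> completion_norm (x_ n - x) < e.
Proof.
move=> Cx; pose d n : C := n.+1%:R^-1.
have d0 n : 0 < d n by rewrite invr_gt0 ltr0n.
have /choice[w Hw] : forall n, exists a, completion_norm (x_ n - ccst a) <= d n.
  by move=> n; exact: ccst_approx.
have dsmall e : 0 < e -> exists n0, forall n, (n0 <= n)%N -> d n <= e.
  by move=> /null_harmonic[n0 H]; exists n0 => n /H/ltW.
have evx n i : cnorm (cev i (x_ n) - ev i (w n)) <= d n.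
  rewrite -cev_cst -cev_opp -cev_add; exact: le_trans (cev_norm _ _) (Hw n).
have Cw : uniformly_cauchy w.
  move=> e e0; have e3 : 0 < e / 3 by rewrite divr_gt0.
  have [n0 H0] := Cx _ e3; have [n1 H1] := dsmall _ e3.
  exists (maxn n0 n1) => m n; rewrite !geq_max => /andP[m0 m1] /andP[p0 p1] i.
  have -> : ev i (w m) - ev i (w n) = - (cev i (x_ m) - ev i (w m)) +
      ((cev i (x_ m) - cev i (x_ n)) + (cev i (x_ n) - ev i (w n))).
    by rewrite opprB !addrA subrK subrK.
  rewrite (_ : e = e / 3 + (e / 3 + e / 3)); last by field.
  rewrite (le_trans (cnormD _ _))// lerD//.
    by rewrite cnormN (le_trans (evx _ _))// H1.
  rewrite (le_trans (cnormD _ _))// lerD//; last by rewrite (le_trans (evx _ _))// H1.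
  by rewrite -cev_opp -cev_add (le_trans (cev_norm _ _))// ltW// H0.
exists (\pi_completion (Cseq Cw)) => e e0.
have e2 : 0 < e / 2 / 2 by rewrite !divr_gt0.
have [n0 H0] := dsmall _ e2; have [n1 H1] := cseq_lim_uniform (Cseq Cw) e2.
exists (maxn n0 n1) => n; rewrite geq_max => /andP[/H0 le0 /H1 le1].
apply: (@le_lt_trans _ _ (e / 2)); last by rewrite ltr_pdivrMr// ltr_pMr// ltr1n.
apply: completion_norm_le; split=> [|i]; first by rewrite ltW// divr_gt0.
rewrite cev_add cev_opp cev_pi [leRHS]splitr.
rewrite -[cev i _](subrK (ev i (w n))) -addrA (le_trans (cnormD _ _))// lerD//.
exact: le_trans (evx n i) le0.
Qed.

HB.instance Definition _ := isCStarAlgebra.Build R completion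
  completion_starK completion_starD completion_starZ completion_starM
  completion_norm_eq0 completion_normD completion_normZ completion_normM
  completion_norm_star completion_complete.

Fact cev_is_zmod_morphism i : zmod_morphism (@cev i).
Proof. by move=> x y; rewrite cev_add cev_opp. Qed.
Fact cev_is_scalable i : scalable (@cev i).
Proof. by move=> k x; rewrite cev_scale. Qed.
Fact cev_is_monoid_morphism i : monoid_morphism (@cev i).
Proof. by split=> [|x y]; [exact: cev_one|exact: cev_mul]. Qed.

HB.instance Definition _ i :=
  GRing.isZmodMorphism.Build completion (B i) (@cev i) (cev_is_zmod_morphism i).
HB.instance Definition _ i :=
  GRing.isMonoidMorphism.Build completion (B i) (@cev i) (cev_is_monoid_morphism i).
HB.instance Definition _ i :=
  GRing.isScalable.Build C completion (B i) *:%R (@cev i) (cev_is_scalable i).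

Lemma cev_star_homomorphism i :
  star_homomorphism (@cev i : {lrmorphism completion -> B i}).
Proof. by move=> x; exact: cev_star. Qed.

Lemma ccst_dense x (e : C) : 0 < e -> exists a, cnorm (x - ccst a) <= e.
Proof. exact: ccst_approx. Qed.

Lemma cnorm_completion_le c x : 0 <= c -> (forall i, cnorm (cev i x) <= c) -> cnorm x <= c.
Proof. by move=> c0 Hc; exact: completion_norm_le. Qed.

Lemma cnorm_cev i x : cnorm (cev i x) <= cnorm x.
Proof. exact: cev_norm. Qed.

End Completion.

(** * Formal sums of group elements *)

Section FormalSums.
Variables (R : realType) (G : groupType).
Local Notation C := R[i].
Implicit Types (a b w : seq (C * G)) (t : G -> C) (k : C).

Definition lin (V : lmodType C) (f : G -> V) w : V := \sum_(p <- w) p.1 *: f p.2.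

Definition fsum_mul a b : seq (C * G) :=
  [seq (p.1 * q.1, (p.2 * q.2)%g) | p <- a, q <- b].
Definition fsum_scale k a : seq (C * G) := [seq (k * p.1, p.2) | p <- a].
Definition fsum_star a : seq (C * G) := [seq (Num.conj p.1, p.2^-1%g) | p <- a].
Definition fsum_one : seq (C * G) := [:: (1, 1%g)].

Fixpoint fsum_exp a n := if n is m.+1 then fsum_mul a (fsum_exp a m) else fsum_one.

Section Lin.
Variables (V : lmodType C) (f : G -> V).

Lemma lin_cat a b : lin f (a ++ b) = lin f a + lin f b.
Proof. by rewrite /lin big_cat. Qed.

Lemma lin_scale k a : lin f (fsum_scale k a) = k *: lin f a.
Proof. by rewrite /lin big_map scaler_sumr; apply: eq_bigr => p _; rewrite scalerA. Qed.

Lemma lin_mul a b : lin f (fsum_mul a b) =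
  \sum_(p <- a) \sum_(q <- b) (p.1 * q.1) *: f (p.2 * q.2)%g.
Proof. by rewrite /lin /fsum_mul big_allpairs_dep. Qed.

Lemma lin1 : lin f fsum_one = f 1%g.
Proof. by rewrite /lin big_seq1 scale1r. Qed.

End Lin.

Lemma lin_mul_left (V : lmodType C) (f : G -> V) a b :
  lin f (fsum_mul a b) = lin (fun g => lin (fun h => f (g * h)%g) b) a.
Proof.
rewrite lin_mul; apply: eq_bigr => p _; rewrite scaler_sumr.
by apply: eq_bigr => q _; rewrite scalerA.
Qed.

Lemma lin_mul_right (V : lmodType C) (f : G -> V) a b :
  lin f (fsum_mul a b) = lin (fun h => lin (fun g => f (g * h)%g) a) b.
Proof.
rewrite lin_mul exchange_big; apply: eq_bigr => q _; rewrite scaler_sumr.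
by apply: eq_bigr => p _; rewrite scalerA mulrC.
Qed.

Lemma lin_ext (V : lmodType C) (f f' : G -> V) a : f =1 f' -> lin f a = lin f' a.
Proof. by move=> ff'; apply: eq_bigr => p _; rewrite ff'. Qed.

Lemma lin_mulA (V : lmodType C) (f : G -> V) a b c :
  lin f (fsum_mul a (fsum_mul b c)) = lin f (fsum_mul (fsum_mul a b) c).
Proof.
rewrite !lin_mul_left; apply: lin_ext => g; rewrite lin_mul_left.
by apply: lin_ext => h; apply: lin_ext => k; rewrite mulgA.
Qed.

Lemma lin_star_mul (V : lmodType C) (f : G -> V) a b :
  lin f (fsum_star (fsum_mul a b)) = lin f (fsum_mul (fsum_star b) (fsum_star a)).
Proof.
rewrite lin_mul /lin /fsum_star !big_map /fsum_mul big_allpairs_dep exchange_big.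
apply: eq_bigr => q _; rewrite big_map; apply: eq_bigr => p _ /=.
by rewrite rmorphM mulrC invgM.
Qed.

Lemma lin_mul_eq (V : lmodType C) (f : G -> V) a a' b :
  (forall f' : G -> V, lin f' a = lin f' a') -> lin f (fsum_mul a b) = lin f (fsum_mul a' b).
Proof. by move=> aa'; rewrite !lin_mul_left aa'. Qed.

Lemma lin_mul_cat (V : lmodType C) (f : G -> V) a b c :
  lin f (fsum_mul a (b ++ c)) = lin f (fsum_mul a b) + lin f (fsum_mul a c).
Proof. by rewrite !(lin_mul_right f a) lin_cat. Qed.

Lemma lin_mul_scale (V : lmodType C) (f : G -> V) a k b :
  lin f (fsum_mul a (fsum_scale k b)) = k *: lin f (fsum_mul a b).
Proof. by rewrite !(lin_mul_right f a) lin_scale. Qed.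

Lemma lin_mulC t a b : (forall g h, t (g * h)%g = t (h * g)%g) ->
  lin (t : G -> C^o) (fsum_mul a b) = lin (t : G -> C^o) (fsum_mul b a).
Proof.
move=> tC; rewrite !lin_mul exchange_big; apply: eq_bigr => q _; apply: eq_bigr => p _.
by rewrite tC mulrC.
Qed.

Section Representation.
Variable A : cstarAlgType R.
Implicit Types (V : G -> A).

Definition group_rep V := (forall g, unitary (V g)) /\ forall g h, V (g * h)%g = V g * V h.

Variable V : G -> A.
Hypothesis repV : group_rep V.

Lemma rep1 : V 1%g = 1.
Proof.
have [u m] := repV; have [su _] := u 1%g.
by rewrite -[LHS]mul1r -su -mulrA -m mulg1 su.
Qed.

Lemma repVE g : V g^-1%g = star (V g).
Proof.
have [u m] := repV; have [_ us] := u g.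
by rewrite -[LHS]mulr1 -us mulrA -m mulVg rep1 mul1r.
Qed.

Lemma lin_rep_mul a b : lin V (fsum_mul a b) = lin V a * lin V b.
Proof.
rewrite lin_mul /lin mulr_suml; apply: eq_bigr => p _; rewrite mulr_sumr.
apply: eq_bigr => q _; case: repV => _ ->.
by rewrite -scalerAl -scalerAr scalerA.
Qed.

Lemma lin_rep_star a : lin V (fsum_star a) = star (lin V a).
Proof.
rewrite /lin star_sum big_map; apply: eq_bigr => p _.
by rewrite /= starZ repVE.
Qed.

Lemma lin_rep1 : lin V fsum_one = 1.
Proof. by rewrite lin1 rep1. Qed.

Lemma lin_rep_exp a n : lin V (fsum_exp a n) = lin V a ^+ n.
Proof. by elim: n => [|n IH] /=; rewrite ?lin_rep1// lin_rep_mul IH exprS. Qed.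

Lemma lin_rep_bound a : cnorm (lin V a) <= \sum_(p <- a) `|p.1|.
Proof.
rewrite (le_trans (cnorm_sum _ _))//; apply: ler_sum => p _.
by rewrite cnormZ cnorm_unitary ?mulr1//; case: repV.
Qed.

End Representation.

Lemma fsum_exp_word a n p : p \in fsum_exp a n ->
  exists2 w, word_of [seq q.2 | q <- a] n w & p.2 = (\prod_(x <- w) x)%g.
Proof.
elim: n p => [|n IH] p /=; first by rewrite inE => /eqP ->; exists [::]; rewrite ?big_nil.
move=> /allpairsP[[q r] /= [qa /IH[w /andP[Aw sw] Ew] ->]].
exists (q.2 :: w); last by rewrite big_cons /= Ew.
by rewrite /word_of /= Aw ltnS sw !andbT; apply/mapP; exists q.
Qed.

End FormalSums.

(** * Central characters and the canonical trace *)

Section CanonicalTrace.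
Variables (R : realType) (G : groupType) (N : set G) (w : G -> R[i]).
Local Notation C := R[i].
Hypotheses (sN : is_subgroup N) (NZ : N `<=` group_center G).
Hypothesis w_norm : forall x, N x -> `|w x| = 1.
Hypothesis wM : forall x y, N x -> N y -> w (x * y)%g = w x * w y.
Implicit Types (g h x y : G) (a b c : seq (C * G)).

Lemma character1 : w 1%g = 1.
Proof.
have N1 := subgroup1 sN; apply: (mulfI (_ : w 1%g != 0)); first by rewrite -normr_eq0 w_norm ?oner_eq0.
by rewrite -wM// mulg1 mulr1.
Qed.

Lemma characterV x : N x -> w x^-1%g = Num.conj (w x).
Proof.
move=> Nx; have NVx := subgroupV sN Nx; have nz : w x != 0 by rewrite -normr_eq0 w_norm ?oner_eq0.
by apply: (mulfI nz); rewrite -wM// mulgV character1 -normCK w_norm// expr1n.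
Qed.

(** These are the twisted representations of [G / N], without the choice of a
    section. *)
Definition central_rep (A : cstarAlgType R) (V : G -> A) :=
  group_rep V /\ forall n, N n -> V n = w n *: 1.

(** Evaluating at the identity of [C*(G/N, sigma)]: the trace that vanishes off
    [N] and restricts to the character there. *)
Definition can_trace g : C := if `[< N g >] then w g else 0.

Lemma can_traceT g : N g -> can_trace g = w g.
Proof. by move=> Ng; rewrite /can_trace asboolT. Qed.

Lemma can_traceF g : ~ N g -> can_trace g = 0.
Proof. by move=> Ng; rewrite /can_trace asboolF. Qed.

Lemma central_mul_sym g h : N (g * h)%g -> (h * g)%g = (g * h)%g.
Proof. by move=> /NZ Z; rewrite -{1}(mulKg g h) -mulgA Z mulKg. Qed.

Lemma can_traceC g h : can_trace (g * h)%g = can_trace (h * g)%g.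
Proof.
rewrite /can_trace; case: asboolP => [Ngh|nNgh].
  by rewrite (central_mul_sym Ngh) asboolT.
by rewrite asboolF// => Nhg; apply: nNgh; rewrite (central_mul_sym Nhg).
Qed.

Definition coset_rep g : G := xget 1%g [set h | N (g * h^-1)%g].

Lemma coset_repP g : N (g * (coset_rep g)^-1)%g.
Proof.
rewrite /coset_rep; case: xgetP => [h _ //|/(_ g)[]].
by rewrite /= mulgV; exact: subgroup1.
Qed.

Lemma coset_rep_eq g h : N (g * h^-1)%g -> coset_rep g = coset_rep h.
Proof.
move=> Ngh; rewrite /coset_rep; congr (xget _ _); apply/seteqP; split=> x /= Nx.
  have -> : (h * x^-1 = (g * h^-1)^-1 * (g * x^-1))%g by rewrite invgF mulgA mulgVK.
  by apply: (subgroupM sN) => //; exact: subgroupV.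
have -> : (g * x^-1 = (g * h^-1) * (h * x^-1))%g by rewrite mulgA mulgVK.
exact: (subgroupM sN).
Qed.

Definition coset_part g : C := w (g * (coset_rep g)^-1)%g.

Lemma central_rep_coset A V g : @central_rep A V -> V g = coset_part g *: V (coset_rep g).
Proof.
move=> [[_ VM] VN]; rewrite -{1}(mulgVK (coset_rep g) g) VM (VN _ (coset_repP g)).
by rewrite -scalerAl mul1r.
Qed.

Lemma can_trace_coset g h :
  can_trace (g^-1 * h)%g =
  Num.conj (coset_part g) * coset_part h *+ (coset_rep g == coset_rep h).
Proof.
have Ng := coset_repP g; have Nh := coset_repP h.
rewrite can_traceC; case: eqP => [E|nE]; last first.
  by rewrite mulr0n can_traceF// => /(fun H => coset_rep_eq H)/esym.
have -> : (h * g^-1 = (g * (coset_rep g)^-1)^-1 * (h * (coset_rep h)^-1))%g.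
  have -> : (h * g^-1 = (h * (coset_rep h)^-1) * (g * (coset_rep g)^-1)^-1)%g.
    by rewrite -E invgF mulgA mulgVK.
  exact: (NZ Nh).
have NVg := subgroupV sN Ng.
by rewrite (can_traceT (subgroupM sN NVg Nh)) (wM NVg Nh) (characterV Ng).
Qed.

Lemma sum_fibre (I T : eqType) (V : nmodType) (s : seq I) (X : seq T) (r : I -> T) (F : I -> V) :
  uniq X -> {in s, forall i, r i \in X} ->
  \sum_(x <- X) \sum_(i <- s | r i == x) F i = \sum_(i <- s) F i.
Proof.
move=> uX rX; rewrite (exchange_big_dep predT)//=; apply: eq_big_seq => i /rX riX.
rewrite -big_filter (eq_filter (a2 := pred1 (r i))) => [|x]; last by rewrite /= eq_sym.
by rewrite filter_pred1_uniq// big_seq1.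
Qed.

Lemma sqr_sum_le (T : eqType) (X : seq T) (d : T -> C) : (forall i, 0 <= d i) ->
  (\sum_(x <- X) d x) ^+ 2 <= (size X)%:R * \sum_(x <- X) d x ^+ 2.
Proof.
move=> d0; elim: X => [|x X IH]; first by rewrite !big_nil expr0n mul0r.
rewrite !big_cons /= sqrrD -natr1 mulrDl mul1r mulrDr.
have cross : d x * (\sum_(y <- X) d y) *+ 2 <= (size X)%:R * d x ^+ 2 + \sum_(y <- X) d y ^+ 2.
  rewrite mulr_sumr -sumrMnl mulr_natl -sum_const_seq -big_split /=.
  apply: ler_sum => y _; rewrite -subr_ge0.
  have -> : d x ^+ 2 + d y ^+ 2 - d x * d y *+ 2 = (d x - d y) ^+ 2 by ring.
  by rewrite real_exprn_even_ge0// realB// ger0_real.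
rewrite addrAC; apply: (@le_trans _ _ (d x ^+ 2 + ((size X)%:R * \sum_(y <- X) d y ^+ 2) +
  ((size X)%:R * d x ^+ 2 + \sum_(y <- X) d y ^+ 2))).
  by rewrite lerD// lerD2l.
by rewrite le_eqVlt; apply/orP; left; apply/eqP; ring.
Qed.

Local Notation tau := (lin (can_trace : G -> C^o)).

(** The operator [V a] is a combination of as many unitaries as [a] meets cosets,
    and [tau (a^* a)] is the sum of the squared moduli of its coefficients, so
    the Cauchy-Schwarz inequality applies. *)
Lemma cnorm_le_trace A V a : @central_rep A V ->
  cnorm (lin V a) ^+ 2 <=
    (size (undup [seq p.2 | p <- a]))%:R * tau (fsum_mul (fsum_star a) a).
Proof.
move=> cV; pose X := undup [seq coset_rep p.2 | p <- a].
have uX : uniq X by exact: undup_uniq.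
pose cf x := \sum_(p <- a | coset_rep p.2 == x) p.1 * coset_part p.2.
have inX : {in a, forall p : C * G, coset_rep p.2 \in X}.
  by move=> p pa; rewrite mem_undup; apply/mapP; exists p.
pose u (p : C * G) := p.1 * coset_part p.2.
have EV : lin V a = \sum_(x <- X) cf x *: V x.
  rewrite /lin; under eq_bigr do rewrite (central_rep_coset _ cV) scalerA.
  rewrite -(sum_fibre _ uX inX); apply: eq_bigr => x _; rewrite /cf scaler_suml.
  by apply: eq_bigr => p /eqP <-.
have Etau : tau (fsum_mul (fsum_star a) a) = \sum_(x <- X) `|cf x| ^+ 2.
  transitivity (\sum_(p <- a) Num.conj (u p) * cf (coset_rep p.2)).
    rewrite lin_mul /fsum_star big_map /=; apply: eq_bigr => p _.
    rewrite /cf [in RHS]big_mkcond /= mulr_sumr; apply: eq_bigr => q _.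
    rewrite can_trace_coset eq_sym /u rmorphM /=; case: eqP => _.
      by rewrite mulr1n /GRing.scale /=; ring.
    by rewrite mulr0n scaler0 mulr0.
  rewrite -(sum_fibre _ uX inX); apply: eq_bigr => x _.
  rewrite normCK mulrC /cf rmorph_sum mulr_suml; apply: eq_bigr => p /eqP px.
  by rewrite px.
have V1 x : cnorm (V x) = 1 by apply: cnorm_unitary; case: cV => -[].
rewrite Etau (@le_trans _ _ ((\sum_(x <- X) `|cf x|) ^+ 2))//.
  rewrite lerXn2r ?nnegrE ?cnorm_ge0 ?sumr_ge0// EV (le_trans (cnorm_sum _ _))//.
  by apply: ler_sum => x _; rewrite cnormZ V1 mulr1.
rewrite (le_trans (sqr_sum_le _ _))// ler_wpM2r ?sumr_ge0//.
rewrite ler_nat -[leqRHS](size_map coset_rep); apply: uniq_leq_size => // x.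
rewrite mem_undup => /mapP[p pa ->]; apply: map_f; rewrite mem_undup.
by apply/mapP; exists p.
Qed.

(** The canonical trace is faithful on formal sums. *)
Lemma lin_rep_eq0 A V a : @central_rep A V -> (forall b, tau (fsum_mul b a) = 0) ->
  lin V a = 0.
Proof.
move=> cV a0; apply: cnorm_eq0; apply/eqP; rewrite -sqrf_eq0 eq_le.
have := cnorm_le_trace a cV; rewrite a0 mulr0 => ->.
by rewrite exprn_ge0// cnorm_ge0.
Qed.

End CanonicalTrace.

(** * The central projection cut out by a faithful trace *)

Section RootTest.
Variable R : realType.
Local Notation C := R[i].
Local Open Scope complex_scope.

(** A polynomial factor disappears on taking roots of order [2 ^ k]. *)
Lemma le_of_exp2_poly (x y K : C) d : 0 <= x -> 0 <= y -> 0 <= K ->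
  (forall k, x ^+ (2 ^ k) <= K * (2 ^ k).+1%:R ^+ d * y ^+ (2 ^ k)) -> x <= y.
Proof.
move=> x0 y0 K0 H.
rewrite -(ge0_ReK x0) -(ge0_ReK y0) lecR leNgt; apply/negP.
set x' := complex.Re x; set y' := complex.Re y; set K' := complex.Re K => yx.
have x'0 : 0 <= x' by rewrite -ler0c ge0_ReK.
have y'0 : 0 <= y' by rewrite -ler0c ge0_ReK.
have K'0 : 0 <= K' by rewrite -ler0c ge0_ReK.
have H' k : x' ^+ (2 ^ k) <= K' * (2 ^ k).+1%:R ^+ d * y' ^+ (2 ^ k).
  by rewrite -lecR !rmorphM !rmorphXn /= rmorph_nat !ge0_ReK.
have x'gt0 : 0 < x' by exact: le_lt_trans yx.
have [y'gt0|y'le0] := ltP 0 y'; last first.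
  have y'E : y' = 0 by apply/le_anti; rewrite y'0 y'le0.
  have := H' 0%N; rewrite expn0 expr1 y'E expr0n mulr0.
  by rewrite leNgt x'gt0.
have [k] : exists k, K' * (2 ^ k).+1%:R ^+ d < (x' / y') ^+ (2 ^ k).
  by apply: exp_beats_poly; rewrite ?ltr_pdivlMr ?mul1r.
rewrite expr_div_n ltr_pdivlMr ?exprn_gt0//.
by rewrite ltNge H'.
Qed.

End RootTest.

Section TraceProjection.
Variables (R : realType) (G : groupType) (N : set G) (w : G -> R[i]).
Local Notation C := R[i].
Hypotheses (sN : is_subgroup N) (NZ : N `<=` group_center G).
Hypothesis w_norm : forall x, N x -> `|w x| = 1.
Hypothesis wM : forall x y, N x -> N y -> w (x * y)%g = w x * w y.
Implicit Types (g h x y : G) (a b c : seq (C * G)).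

Variable chi : G -> C.
Hypothesis chiC : forall g h, chi (g * h)%g = chi (h * g)%g.
Hypothesis chiN : forall n g, N n -> chi (n * g)%g = w n * chi g.
Hypothesis chiV : forall g, chi g^-1%g = Num.conj (chi g).
Hypothesis chi1 : chi 1%g = 1.

Variable F : seq G.
Hypothesis uniqF : uniq F.
Hypothesis F_sep : forall x y, x \in F -> y \in F -> N (x * y^-1)%g -> x = y.
Hypothesis F_supp : forall g, chi g != 0 -> exists2 x, x \in F & N (g * x^-1)%g.

Variables (B : cstarAlgType R) (rep : G -> B).
Hypothesis rep_central : central_rep N w rep.
Hypothesis chi_bound : forall a, `|lin (chi : G -> C^o) a| <= cnorm (lin rep a).

(** Up to a scalar, the Fourier expansion of the minimal central projection
    carrying the trace [chi]; it represents [chi] against the canonical trace. *)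
Definition trace_sum : seq (C * G) := [seq (chi x, x^-1%g) | x <- F].

Variable s : C.
Hypothesis rep_trace_sum : lin rep trace_sum = s *: 1.

Local Notation P := trace_sum.
Local Notation tr := (can_trace N w).
Local Notation tau := (lin (tr : G -> C^o)).
Local Notation Chi := (lin (chi : G -> C^o)).

Lemma can_traceV g : tr g^-1%g = Num.conj (tr g).
Proof.
rewrite /can_trace; case: asboolP => [NVg|nN].
  have Ng : N g by rewrite -[g]invgK; exact: (subgroupV sN).
  by rewrite asboolT// (characterV sN w_norm wM Ng).
by rewrite asboolF ?conjC0// => Ng; apply: nN; exact: (subgroupV sN).
Qed.

Lemma sum_chi_trace g : \sum_(x <- F) chi x * tr (x^-1 * g)%g = chi g.
Proof.
have term x : chi x * tr (x^-1 * g)%g = if `[< N (g * x^-1)%g >] then chi g else 0.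
  rewrite (can_traceC _ NZ); case: asboolP => [Ng|nN]; last by rewrite can_traceF ?mulr0.
  by rewrite can_traceT// mulrC -chiN// mulgVK.
under eq_bigr do rewrite term.
have [->|chi0] := eqVneq (chi g) 0; first by rewrite big1// => x _; case: ifP.
have [x xF Nx] := F_supp chi0; rewrite (bigD1_seq x)//= asboolT// big1_seq ?addr0//.
move=> y /andP[yx yF]; case: asboolP => // Ny; case/eqP: yx; apply: F_sep => //.
have -> : (y * x^-1 = (g * y^-1)^-1 * (g * x^-1))%g by rewrite invgF mulgA mulgVK.
by apply: (subgroupM sN) => //; exact: (subgroupV sN).
Qed.

Lemma trace_sum_l a : tau (fsum_mul P a) = Chi a.
Proof.
rewrite lin_mul /trace_sum big_map exchange_big; apply: eq_bigr => q _ /=.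
rewrite -sum_chi_trace scaler_sumr; apply: eq_bigr => x _.
by rewrite /GRing.scale /=; ring.
Qed.

Lemma trace_sum_star_l a : tau (fsum_mul (fsum_star P) a) = Chi a.
Proof.
rewrite lin_mul /trace_sum /fsum_star !big_map exchange_big; apply: eq_bigr => q _ /=.
rewrite -[q.2]invgK chiV -sum_chi_trace rmorph_sum scaler_sumr; apply: eq_bigr => x _.
rewrite !invgK rmorphM /= -can_traceV invgM invgK invgK (can_traceC _ NZ).
by rewrite /GRing.scale /=; ring.
Qed.

Let tauC a b : tau (fsum_mul a b) = tau (fsum_mul b a).
Proof. by apply: lin_mulC => g h; exact: can_traceC. Qed.

Let ChiC a b : Chi (fsum_mul a b) = Chi (fsum_mul b a).
Proof. exact: lin_mulC. Qed.

(** The trace [chi] factors through [rep], where [P] is the scalar [s]. *)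
Lemma chi_trace_sum a : Chi (fsum_mul P a) = s * Chi a.
Proof.
apply/eqP; rewrite -subr_eq0 -normr_eq0 eq_le normr_ge0 andbT.
have [grep _] := rep_central.
have E0 : lin rep (fsum_mul P a ++ fsum_scale (- s) a) = 0.
  by rewrite lin_cat lin_scale lin_rep_mul// rep_trace_sum -scalerAl mul1r scaleNr subrr.
have := chi_bound (fsum_mul P a ++ fsum_scale (- s) a).
by rewrite E0 cnorm0 lin_cat lin_scale scaleNr.
Qed.

Lemma trace_sum_scalar : s = \sum_(x <- F) `|chi x| ^+ 2.
Proof.
have := chi_trace_sum (@fsum_one R G).
rewrite lin1 chi1 mulr1 => <-; rewrite lin_mul /trace_sum big_map; apply: eq_bigr => x _.
by rewrite /fsum_one big_seq1 /= mulr1 mulg1 chiV normCK.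
Qed.

Lemma trace_sum_gt0 : 0 < s.
Proof.
have [x xF Nx] : exists2 x, x \in F & N (1 * x^-1)%g by apply: F_supp; rewrite chi1 oner_eq0.
rewrite mul1g in Nx; rewrite trace_sum_scalar (bigD1_seq x)//= ltr_pwDl ?sumr_ge0//.
rewrite exprn_gt0// normr_gt0; apply: contraTneq (oner_neq0 C) => chix0.
by rewrite -chi1 -(mulVg x) (chiN _ Nx) chix0 mulr0 eqxx.
Qed.

Section AnyRepresentation.
Variables (A : cstarAlgType R) (V : G -> A).
Hypothesis V_central : central_rep N w V.

Let grepV : group_rep V := V_central.1.

(** Identities between formal sums hold in every representation as soon as the
    canonical trace cannot tell the two sides apart. *)
Let lin_eq a b : (forall c, tau (fsum_mul c a) = tau (fsum_mul c b)) -> lin V a = lin V b.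
Proof.
move=> ab; apply/eqP; rewrite -subr_eq0 -scaleN1r -lin_scale -lin_cat; apply/eqP.
apply: (lin_rep_eq0 sN NZ w_norm wM V_central) => c.
by rewrite lin_mul_cat lin_mul_scale ab scaleN1r subrr.
Qed.

Lemma trace_sum_central a : lin V P * lin V a = lin V a * lin V P.
Proof.
rewrite -!lin_rep_mul//; apply: lin_eq => c.
by rewrite tauC -lin_mulA trace_sum_l [RHS]lin_mulA [RHS]tauC trace_sum_l ChiC.
Qed.

Lemma trace_sum_sqr : lin V P * lin V P = s *: lin V P.
Proof.
rewrite -lin_rep_mul// -lin_scale; apply: lin_eq => c.
rewrite lin_mulA tauC trace_sum_l ChiC chi_trace_sum lin_mul_scale [in RHS]tauC.
by rewrite trace_sum_l.
Qed.

Lemma trace_sum_star : star (lin V P) = lin V P.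
Proof.
rewrite -lin_rep_star//; apply: lin_eq => c.
by rewrite tauC trace_sum_star_l [RHS]tauC trace_sum_l.
Qed.

(** The trace of [(P y)^* (P y)] against the canonical trace collapses to the
    value of [chi] at [y^* y]. *)
Lemma trace_sum_norm (y : seq (C * G)) : cnorm (lin V (fsum_mul P y)) ^+ 2 <=
  (size (undup [seq p.2 | p <- fsum_mul P y]))%:R * (s * cnorm (lin rep y) ^+ 2).
Proof.
have [grep _] := rep_central; have s0 := ltW trace_sum_gt0.
have le1 := cnorm_le_trace sN NZ w_norm wM (fsum_mul P y) V_central.
apply: (le_trans le1).
rewrite -(ger0_norm (le_trans (exprn_ge0 2 (cnorm_ge0 _)) le1)) normrM normr_nat ler_wpM2l//.
have -> : tau (fsum_mul (fsum_star (fsum_mul P y)) (fsum_mul P y)) =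
    s * Chi (fsum_mul (fsum_star y) y).
  rewrite (lin_mul_eq _ _ (fun f => lin_star_mul f P y)) -lin_mulA tauC -lin_mulA.
  by rewrite trace_sum_star_l -lin_mulA chi_trace_sum ChiC.
rewrite normrM (ger0_norm s0) ler_wpM2l// (le_trans (chi_bound _))//.
by rewrite lin_rep_mul// lin_rep_star// cnorm_star.
Qed.

(** Polynomial growth turns the trace estimate, applied to the powers of
    [a^* a], into an inequality of norms. *)
Theorem trace_projection_norm a : (forall S : seq G, poly_growth S) ->
  cnorm (s^-1 *: (lin V P * lin V a)) <= cnorm (lin rep a).
Proof.
move=> growth; have [grep _] := rep_central; have s0 := trace_sum_gt0.
have sn0 : s != 0 by rewrite gt_eqF.
pose p := s^-1 *: lin V P; pose b := fsum_mul (fsum_star a) a; pose h := p * lin V b.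
have pp : p * p = p.
  by rewrite /p -scalerAl -scalerAr trace_sum_sqr !scalerA -mulrA mulVf ?mulr1.
have sp : star p = p.
  by rewrite /p starZ trace_sum_star conj_Creal// ger0_real// invr_ge0 ltW.
have cp c : p * lin V c = lin V c * p.
  by rewrite /p -scalerAl -scalerAr trace_sum_central.
have Eb : lin V b = star (lin V a) * lin V a by rewrite lin_rep_mul// lin_rep_star.
have sh : star h = h by rewrite /h starM sp cp Eb starM starK.
(* By the C*-identity it suffices to bound the selfadjoint element [h]. *)
have Eh : cnorm (p * lin V a) ^+ 2 = cnorm h.
  rewrite -cnorm_star starM sp -mulrA [p * (p * _)]mulrA pp cp mulrA -Eb.
  by rewrite /h cp.
have hX n : h ^+ n.+1 = p * lin V b ^+ n.+1.
  elim: n => [|n IH]; first by rewrite !expr1.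
  rewrite exprS IH [in RHS]exprS /h -mulrA [lin V b * (p * _)]mulrA -cp.
  by rewrite -[p * _ * _]mulrA [LHS]mulrA pp.
have [C [d gr]] := growth [seq q.2 | q <- b].
(* The support of [P * b ^+ n] has at most [size F * C * n.+1 ^ d] elements. *)
pose K : R[i] := (size F * C)%:R / s.
have K0 : 0 <= K by rewrite divr_ge0 ?ler0n// ltW.
have main : cnorm h ^+ 2 <= (cnorm (lin rep b)) ^+ 2.
  apply: (le_of_exp2_poly (K := K) (d := d)); rewrite ?exprn_ge0 ?cnorm_ge0// => k.
  have E2 : (2 ^ k)%N = (2 ^ k).-1.+1 by rewrite prednK// expn_gt0.
  rewrite exprAC -cnorm_selfadjoint_exp2// E2 hX -E2 -lin_rep_exp// /p -scalerAl -lin_rep_mul//.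
  rewrite cnormZ exprMn (le_trans (ler_wpM2l _ (trace_sum_norm _)))// ?exprn_ge0//.
  have m_le : (size (undup [seq q.2 | q <- fsum_mul P (fsum_exp b (2 ^ k))]) <=
      size F * C * (2 ^ k).+1 ^ d)%N.
    have [L [sL HL]] := gr (2 ^ k)%N; rewrite -mulnA.
    apply: (@leq_trans (size F * size L)); last by rewrite leq_mul2l sL orbT.
    rewrite -(size_allpairs (fun x g => (x^-1 * g)%g)); apply: uniq_leq_size; first exact: undup_uniq.
    move=> x; rewrite mem_undup => /mapP[q /allpairsP[[r t] /= [/mapP[y yF ->] tb ->]] ->] /=.
    have [v Wv ->] := fsum_exp_word tb.
    by apply/allpairsP; exists (y, (\prod_(x <- v) x)%g); split=> //=; exact: HL.
  rewrite lin_rep_exp// ger0_norm ?invr_ge0 ?(ltW s0)//.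
  have -> : K * (2 ^ k).+1%:R ^+ d * (cnorm (lin rep b) ^+ 2) ^+ (2 ^ k) =
      s^-1 ^+ 2 * ((size F * C * (2 ^ k).+1 ^ d)%:R * (s * (cnorm (lin rep b) ^+ (2 ^ k)) ^+ 2)).
    rewrite /K (natrM _ (size F * C)) natrX exprAC.
    by move: (_ ^+ (2 ^ k)) (_ ^+ d) (size F * C)%:R => x y z; field.
  rewrite ler_wpM2l ?exprn_ge0 ?invr_ge0 ?(ltW s0)//.
  apply: ler_pM; rewrite ?ler0n ?mulr_ge0 ?exprn_ge0 ?cnorm_ge0 ?(ltW s0) ?ler_nat//.
  by rewrite ler_wpM2l ?(ltW s0)// lerXn2r ?nnegrE ?exprn_ge0 ?cnorm_ge0// cnormX_le.
rewrite scalerAl -/p.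
have n0 := @cnorm_ge0 R.
move: main; rewrite ler_pXn2r ?nnegrE ?n0// -Eh lin_rep_mul// lin_rep_star// cnorm_star.
by rewrite ler_pXn2r ?nnegrE ?n0.
Qed.

End AnyRepresentation.
End TraceProjection.

(** * A generalized limit for bounded sequences *)

Section Ultralimit.
Variable R : realType.
Local Notation C := R[i].
Local Open Scope complex_scope.

Definition bounded_seq (f : nat -> C) := exists M, forall n, `|f n| <= M.

(** An axiomatic form of the limit along a nonprincipal ultrafilter on the
    natural numbers. *)
Record generalized_limit (L : (nat -> C) -> C) : Prop := GeneralizedLimit {
  glimD : forall f g, bounded_seq f -> bounded_seq g -> L (fun n => f n + g n) = L f + L g;
  glimZ : forall k f, bounded_seq f -> L (fun n => k * f n) = k * L f;
  glim_cst : forall c, L (fun=> c) = c;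
  glim_null : forall f, null (fun n => `|f n|) -> L f = 0;
  glim_conj : forall f, bounded_seq f -> L (fun n => Num.conj (f n)) = Num.conj (L f);
  glim_sqr : forall f g, bounded_seq f -> bounded_seq g ->
    (forall n, `|f n| ^+ 2 <= g n) -> `|L f| ^+ 2 <= L g }.

Lemma bounded_seq_Re f : bounded_seq f ->
  exists M : R, forall n, `|complex.Re (f n)| <= M /\ `|complex.Im (f n)| <= M.
Proof.
move=> [M fM]; exists (complex.Re M) => n.
have ME : (complex.Re M)%:C = M by apply: ge0_ReK; exact: le_trans (normr_ge0 (f n)) (fM n).
have Re_le (z : C) : `|z| <= M -> `|complex.Re z| <= complex.Re M.
  by move=> zM; rewrite -lecR ME (le_trans (normc_ge_Re z)).
split; first exact: Re_le.
rewrite -normrN -ReiNIm; apply: Re_le; rewrite normrM.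
by rewrite (_ : `|'i%C| = 1) ?mulr1// normc_def /= expr0n add0r expr1n sqrtr1.
Qed.

Theorem generalized_limit_exists : exists L, generalized_limit L.
Proof.
have [U [UU subU]] := ultraFilterLemma (eventually_filter).
have PU : ProperFilter U by exact: ultra_proper.
have cvR (f : nat -> R) (M : R) : (forall n, `|f n| <= M) -> exists l : R, f @ U --> l.
  move=> fM; have := @segment_compact R (- M) M; rewrite compact_ultra.
  have UfU : UltraFilter (f @ U).
    split; first exact: fmap_proper_filter.
    move=> Q PQ fUQ; apply/seteqP; split=> [A QA|A /fUQ//].
    have [//|UnA] := in_ultra_setVsetC (f @^-1` A) UU.
    have /fUQ QnA : (f @ U) (~` A) by [].
    have Q0 : Q (A `&` ~` A) by exact: filterI.
    by rewrite setICr in Q0; case: (@filter_not_empty _ Q PQ Q0).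
  move=> /(_ _ UfU); case=> [|l [_ fl]]; last by exists l.
  by apply: nearW => n; rewrite /= in_itv /= -ler_norml.
pose re (f : nat -> C) n := complex.Re (f n); pose im (f : nat -> C) n := complex.Im (f n).
have cvre f : bounded_seq f -> exists l : R, re f @ U --> l.
  by case/bounded_seq_Re => M HM; apply: (cvR _ M) => n; case: (HM n).
have cvim f : bounded_seq f -> exists l : R, im f @ U --> l.
  by case/bounded_seq_Re => M HM; apply: (cvR _ M) => n; case: (HM n).
have haus : hausdorff_space R by exact: order_hausdorff.
pose L f : C := (lim (re f @ U)) +i* (lim (im f @ U)).
have LE f (l m : R) : re f @ U --> l -> im f @ U --> m -> L f = l +i* m.
  by move=> /(cvg_lim haus) rl /(cvg_lim haus) im'; rewrite /L rl im'.
exists L; split.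
- move=> f g /[dup] /cvre[a ra] /cvim[b ib] /[dup] /cvre[c rc] /cvim[d id].
  rewrite (LE f a b)// (LE g c d)// (LE _ (a + c) (b + d))//.
    by rewrite (_ : re _ = re f \+ re g); [exact: cvgD|apply/funext => n; rewrite /re /=; case: (f n); case: (g n)].
  by rewrite (_ : im _ = im f \+ im g); [exact: cvgD|apply/funext => n; rewrite /im /=; case: (f n); case: (g n)].
- move=> k f /[dup] /cvre[a ra] /cvim[b ib]; rewrite (LE f a b)//; case: k => x y.
  have E : ((x +i* y) * (a +i* b) : C) = (x * a - y * b) +i* (x * b + y * a) by [].
  rewrite E; apply: LE.
    rewrite (_ : re _ = (fun n => x * re f n - y * im f n)); last first.
      by apply/funext => n; rewrite /re /im /=; case: (f n).
    by apply: cvgB; apply: cvgM => //; exact: cvg_cst.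
  rewrite (_ : im _ = (fun n => x * im f n + y * re f n)); last first.
    by apply/funext => n; rewrite /re /im /=; case: (f n).
  by apply: cvgD; apply: cvgM => //; exact: cvg_cst.
- by move=> [x y]; apply: LE; exact: cvg_cst.
- move=> f f0.
  have cv0 (g : nat -> R) : (forall n, (`|g n|)%:C <= `|f n|) -> g @ U --> (0 : R).
    move=> gf; apply: (@cvg_trans _ (g @ \oo)).
      by move=> A /subU.
    apply/cvgrPdist_lt => e e0; have [|n0 H] := f0 e%:C; first by rewrite ltcR.
    by exists n0 => // n /= /H; rewrite sub0r normrN -ltcR; apply: le_lt_trans; exact: gf.
  apply: LE; apply: cv0 => n; first exact: normc_ge_Re.
  rewrite -normrN -ReiNIm (le_trans (normc_ge_Re _))// normrM.
  by rewrite (_ : `|'i%C| = 1) ?mulr1// normc_def /= expr0n add0r expr1n sqrtr1.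
- move=> f /[dup] /cvre[a ra] /cvim[b ib]; rewrite (LE f a b)//.
  have -> : Num.conj (a +i* b : C) = a +i* (- b) by [].
  apply: LE.
    by rewrite (_ : re _ = re f)//; apply/funext => n; rewrite /re; case: (f n).
  rewrite (_ : im _ = (fun n => - im f n)); first exact: cvgN.
  by apply/funext => n; rewrite /im; case: (f n).
- move=> f g /[dup] /cvre[a ra] /cvim[b ib] /[dup] /cvre[c rc] /cvim[d id] fg.
  rewrite (LE f a b)// (LE g c d)//.
  have img n : im g n = 0.
    have : 0 <= g n by apply: le_trans (fg n); rewrite exprn_ge0.
    by move=> /ger0_Im.
  have d0 : d = 0.
    apply: (cvg_unique haus id); rewrite (_ : im g = fun=> 0); first exact: cvg_cst.
    by apply/funext => n; exact: img.
  rewrite -add_Re2_Im2 /= d0 lecR.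
  have le1 n : re f n ^+ 2 + im f n ^+ 2 <= re g n.
    have := fg n; rewrite -add_Re2_Im2 lecE => /andP[_]; exact.
  have cv2 : (fun n => re f n ^+ 2 + im f n ^+ 2) @ U --> a ^+ 2 + b ^+ 2.
    by apply: cvgD; apply: cvgM.
  by apply: (ler_cvg_to cv2 rc); exact: nearW.
Qed.

End Ultralimit.

(** * The trace of a faithful irreducible representation *)

Section RepresentationTrace.
Variables (R : realType) (G : groupType) (H : completeNormedModType R[i]).
Variable dot : {dot H for (@Num.conj R[i])}.
Variable pi : G -> H -> H.
Hypothesis H_hilbert : norm_of_dot dot.
Hypothesis H_nontrivial : exists v : H, v != 0.
Hypothesis pi_unitary : unitary_representation dot pi.
Hypothesis pi_irreducible : irreducible_representation pi.
Hypothesis pi_faithful : injective pi.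
Local Notation C := R[i].
Local Notation B := (operator_algebra H_hilbert H_nontrivial).
Local Notation Pi := (rep_op H_hilbert H_nontrivial pi_unitary).
Local Notation Z := (group_center G).
Implicit Types (g h t x y z : G) (a b : seq (C * G)).

Lemma Pi_group_rep : group_rep (Pi : G -> B).
Proof. by split; [exact: rep_op_unitary|exact: rep_opM]. Qed.

Lemma Pi_inj : injective (Pi : G -> B).
Proof. by move=> g h E; apply: pi_faithful; apply/funext => u; exact: (congr1 (fun T : B => T u) E). Qed.

Lemma unit_vector_exists : exists v : H, `|v| = 1.
Proof.
have [v v0] := H_nontrivial; exists (`|v|^-1 *: v).
by rewrite normrZ normfV normr_id mulVf// normr_eq0.
Qed.

Variable v : H.
Hypothesis v1 : `|v| = 1.

(** By Schur's lemma a central element acts by a scalar, which is its diagonal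
    coefficient at any unit vector. *)
Definition central_char g : C := dot (Pi g v) v.

Lemma central_charE z : Z z -> Pi z = central_char z *: 1.
Proof.
move=> Zz; have [|a Ea] := @schur _ _ _ H_hilbert H_nontrivial _ _ pi_unitary pi_irreducible (Pi z).
  by move=> g; rewrite -!rep_opM Zz.
by rewrite /central_char Ea op_scaleE op_oneE dotZl (dotvv H_hilbert) v1 expr1n mulr1.
Qed.

Lemma scalar_inj (a b : C) : a *: (1 : B) = b *: 1 -> a = b.
Proof. by move/eqP; rewrite -subr_eq0 -scalerBl scaler_eq0 oner_eq0 orbF subr_eq0 => /eqP. Qed.

Lemma central_char_norm z : Z z -> `|central_char z| = 1.
Proof.
move=> /central_charE E; have := cnorm_unitary (Pi_group_rep.1 z).
by rewrite E cnormZ cnorm1 mulr1.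
Qed.

Lemma central_charM y z : Z y -> Z z ->
  central_char (y * z)%g = central_char y * central_char z.
Proof.
move=> Zy Zz; apply: scalar_inj; rewrite -central_charE; last exact: (subgroupM (center_subgroup G)).
by rewrite rep_opM !central_charE// -scalerAl mul1r scalerA.
Qed.

Lemma central_char_eq1 z : Z z -> central_char z = 1 -> z = 1%g.
Proof. by move=> Zz E; apply: Pi_inj; rewrite central_charE// E scale1r rep_op1. Qed.

Lemma Pi_central_rep (N : set G) : N `<=` Z -> central_rep N central_char (Pi : G -> B).
Proof. by move=> NZ; split; [exact: Pi_group_rep|move=> n /NZ; exact: central_charE]. Qed.

Variable S : seq G.
Hypothesis genS : generated_subgroup [set` S] = [set: G].
Hypothesis growS : poly_growth S.

Lemma folner_radius_exists : exists r : nat -> nat, forall k,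
  (k.+1 * size (ball S (r k).+1) <= k.+2 * size (ball S (r k)))%N.
Proof. by have /choice[r rP] := ball_folner growS; exists r. Qed.

Variable r : nat -> nat.
Hypothesis rP : forall k, (k.+1 * size (ball S (r k).+1) <= k.+2 * size (ball S (r k)))%N.

Definition mean (k : nat) (f : G -> C) : C :=
  (size (ball S (r k)))%:R^-1 * \sum_(g <- ball S (r k)) f g.

Lemma size_folner_neq0 k : (size (ball S (r k)))%:R != 0 :> C.
Proof. by rewrite pnatr_eq0 -lt0n size_ball_gt0. Qed.

Lemma meanD k f f' : mean k (fun g => f g + f' g) = mean k f + mean k f'.
Proof. by rewrite /mean big_split mulrDr. Qed.

Lemma meanZ k c f : mean k (fun g => c * f g) = c * mean k f.
Proof. by rewrite /mean -mulr_sumr mulrCA. Qed.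

Lemma mean_cst k c : mean k (fun=> c) = c.
Proof. by rewrite /mean sum_const_seq -[c *+ _]mulr_natl mulrA mulVf ?mul1r ?size_folner_neq0. Qed.

Lemma mean_conj k f : mean k (fun g => Num.conj (f g)) = Num.conj (mean k f).
Proof. by rewrite /mean rmorphM rmorph_sum fmorphV /= rmorph_nat. Qed.

Lemma mean_le k f f' : (forall g, f g <= f' g) -> mean k f <= mean k f'.
Proof. by move=> ff'; rewrite ler_wpM2l ?invr_ge0 ?ler0n// ler_sum. Qed.

Lemma norm_mean k f : `|mean k f| <= mean k (fun g => `|f g|).
Proof.
rewrite normrM ger0_norm ?invr_ge0 ?ler0n// ler_wpM2l ?invr_ge0 ?ler0n//.
exact: ler_norm_sum.
Qed.

Lemma norm_mean_le k f (M : C) : (forall g, `|f g| <= M) -> `|mean k f| <= M.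
Proof. by move=> fM; rewrite (le_trans (norm_mean _ _))// -[leRHS](mean_cst k M) mean_le. Qed.

Lemma sqr_norm_mean k f : `|mean k f| ^+ 2 <= mean k (fun g => `|f g| ^+ 2).
Proof.
have m0 : 0 <= mean k (fun g => `|f g|) by exact: le_trans (norm_mean k f).
apply: (@le_trans _ _ (mean k (fun g => `|f g|) ^+ 2)).
  by rewrite lerXn2r ?nnegrE// norm_mean.
rewrite /mean exprMn; have := sqr_sum_le (ball S (r k)) (fun g => normr_ge0 (f g)).
set n := (size _)%:R; have n0 : 0 <= n^-1 ^+ 2 by rewrite exprn_ge0// invr_ge0 ler0n.
move=> /(ler_wpM2l n0)/le_trans; apply.
by rewrite le_eqVlt; apply/orP; left; apply/eqP; rewrite /n; field; exact: size_folner_neq0.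
Qed.

Lemma mean_shift f s : s \in S -> (forall g, `|f g| <= 1) ->
  null (fun k => `|mean k (fun g => f (g * s)%g) - mean k f|).
Proof.
move=> Ss f1; apply: null_le (nullM _ _ (@null_harmonic R)); last 2 first.
- exact: (ler0n _ 2).
- by move=> n; rewrite invr_ge0 ler0n.
move=> k; rewrite /mean -mulrBr normrM ger0_norm ?invr_ge0 ?ler0n//.
rewrite mulrC ler_pdivrMr ?ltr0n ?size_ball_gt0//.
apply: (le_trans (ball_shift _ Ss f1)).
have := rP k; set m := size _; set n := size _ => mn.
rewrite -[_ *+ 2]mulr_natl -mulrA ler_wpM2l ?ler0n//.
rewrite [leRHS]mulrC ler_pdivlMr ?ltr0n// -natrM ler_nat.
by rewrite mulnBl leq_subLR mulnC (leq_trans mn)// mulSn addnC mulnC.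
Qed.

Variable L : (nat -> C) -> C.
Hypothesis HL : generalized_limit L.

(** Replacing [g] by [g * s] conjugates the operator by [s]; averages over almost
    invariant sets of [g] are thus almost invariant under conjugation. *)
Definition orbit_coef (T : B) g : C := dot (T (Pi g^-1%g v)) (Pi g^-1%g v).

Definition rep_trace x : C := L (fun k => mean k (orbit_coef (Pi x))).

Local Notation chi := rep_trace.
Local Notation Chi := (lin (chi : G -> C^o)).

Lemma orbit_vector_norm g : `|Pi g v| = 1.
Proof.
apply/eqP; rewrite -(@eqrXn2 _ 2)//; apply/eqP.
have [/(_ g)[_ _ iso] _] := pi_unitary.
by rewrite -!(dotvv H_hilbert) iso (dotvv H_hilbert) v1.
Qed.

Lemma orbit_coef_bound T g : `|orbit_coef T g| <= cnorm T.
Proof.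
rewrite (le_trans (cauchy_schwarz H_hilbert _ _))// orbit_vector_norm mulr1.
by rewrite (le_trans (op_cnorm _ _))// orbit_vector_norm mulr1.
Qed.

(** The Cauchy-Schwarz inequality of a vector state. *)
Lemma orbit_coef_sqr T g : `|orbit_coef T g| ^+ 2 <= orbit_coef (star T * T) g.
Proof.
rewrite /orbit_coef op_mulE (op_starE (star T)) starK (dotvv H_hilbert).
rewrite lerXn2r ?nnegrE// (le_trans (cauchy_schwarz H_hilbert _ _))//.
by rewrite orbit_vector_norm mulr1.
Qed.

Lemma bounded_mean_coef T : bounded_seq (fun k => mean k (orbit_coef T)).
Proof.
by exists (cnorm T) => k; apply: norm_mean_le => g; exact: orbit_coef_bound.
Qed.

Lemma lin_rep_trace a : Chi a = L (fun k => mean k (orbit_coef (lin Pi a))).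
Proof.
elim: a => [|p a IH].
  rewrite /lin !big_nil -[LHS](glim_cst HL); congr L; apply/funext => k.
  rewrite -[LHS](mean_cst k); congr mean; apply/funext => g.
  by rewrite /orbit_coef op_zeroE dot0l.
rewrite /lin !big_cons -/(lin _ _) -/(lin _ _) IH /rep_trace /GRing.scale /=.
have b1 : bounded_seq (fun k => p.1 * mean k (orbit_coef (Pi p.2))).
  have [M HM] := bounded_mean_coef (Pi p.2); exists (`|p.1| * M) => k.
  by rewrite normrM ler_wpM2l.
rewrite -(glimZ HL p.1 (bounded_mean_coef (Pi p.2))).
rewrite -(glimD HL b1 (bounded_mean_coef (lin Pi a))).
congr L; apply/funext => k; rewrite -meanZ -meanD; congr mean; apply/funext => g.
by rewrite /orbit_coef op_addE dotDl dotZl.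
Qed.

Lemma rep_trace_sqr a : `|Chi a| ^+ 2 <= Chi (fsum_mul (fsum_star a) a).
Proof.
rewrite !lin_rep_trace lin_rep_mul ?lin_rep_star; try exact: Pi_group_rep.
apply: (glim_sqr HL); try exact: bounded_mean_coef.
move=> k; apply: (le_trans (sqr_norm_mean _ _)); apply: mean_le => g.
exact: orbit_coef_sqr.
Qed.

Lemma rep_trace_bound a : `|Chi a| <= cnorm (lin Pi a).
Proof.
rewrite -(@ler_pXn2r _ 2)// ?nnegrE ?cnorm_ge0// lin_rep_trace.
rewrite -[leRHS](glim_cst HL); apply: (glim_sqr HL); first exact: bounded_mean_coef.
  by exists `|cnorm (lin Pi a) ^+ 2|.
move=> k; rewrite lerXn2r ?nnegrE ?cnorm_ge0//; apply: norm_mean_le => g.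
exact: orbit_coef_bound.
Qed.

Lemma rep_trace1 : chi 1%g = 1.
Proof.
rewrite -[RHS](glim_cst HL); congr L; apply/funext => k.
rewrite -[RHS](mean_cst k); congr mean; apply/funext => g.
by rewrite /orbit_coef rep_op1 op_oneE (dotvv H_hilbert) orbit_vector_norm expr1n.
Qed.

Lemma rep_traceV x : chi x^-1%g = Num.conj (chi x).
Proof.
rewrite /rep_trace -(glim_conj HL); last exact: bounded_mean_coef.
congr L; apply/funext => k; rewrite -mean_conj; congr mean; apply/funext => g.
by rewrite /orbit_coef -star_rep_op (op_starE (star (Pi x))) starK dotC.
Qed.

Lemma rep_trace_central n x : Z n -> chi (n * x)%g = central_char n * chi x.
Proof.
move=> Zn; rewrite /rep_trace -(glimZ HL); last exact: bounded_mean_coef.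
congr L; apply/funext => k; rewrite -meanZ; congr mean; apply/funext => g.
by rewrite /orbit_coef rep_opM (central_charE Zn) -scalerAl mul1r op_scaleE dotZl.
Qed.

(** It suffices to conjugate by inverses of generators, which right-translate
    the sets of the average. *)
Lemma rep_trace_conj x y : chi (x ^ y)%g = chi x.
Proof.
have gen s z : s \in S -> chi (z ^ s^-1)%g = chi z.
  move=> Ss; apply/eqP; rewrite -subr_eq0; apply/eqP.
  have norm1 T : unitary T -> forall g, `|orbit_coef T g| <= 1.
    by move=> /cnorm_unitary <- g; exact: orbit_coef_bound.
  have := glim_null HL (mean_shift Ss (norm1 _ (rep_op_unitary H_hilbert H_nontrivial pi_unitary z))).
  have -> : (fun k => mean k (fun g => orbit_coef (Pi z) (g * s)%g) - mean k (orbit_coef (Pi z))) =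
      (fun k => mean k (orbit_coef (Pi (z ^ s^-1)%g)) + (-1) * mean k (orbit_coef (Pi z))).
    apply/funext => k; rewrite mulN1r; congr (mean k _ - _); apply/funext => g.
    rewrite /orbit_coef invgM rep_opM conjgE invgK !rep_opM !op_mulE.
    by rewrite (op_starE (Pi s)) star_rep_op.
  have b1 : bounded_seq (fun k => (-1) * mean k (orbit_coef (Pi z))).
    by have [M HM] := bounded_mean_coef (Pi z); exists M => k; rewrite mulN1r normrN.
  rewrite (glimD HL (bounded_mean_coef _) b1) (glimZ HL _ (bounded_mean_coef _)).
  by rewrite mulN1r.
suff H0 : forall t u, chi (u ^ t^-1)%g = chi u by rewrite -[y]invgK H0.
move=> {x y} t; pose K := [set t | forall u, chi (u ^ t^-1)%g = chi u].
suff : K t by exact.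
apply: (generators_ind genS (K := K)) => [|s sS]; last by rewrite inE => u; exact: gen.
split=> [u|t1 t2 K1 K2 u]; first by rewrite invg1 conjg1.
rewrite invgF conjgM K1.
by have := K2 (u ^ t2)%g; rewrite -conjgM mulgV conjg1.
Qed.

Lemma rep_traceC x y : chi (x * y)%g = chi (y * x)%g.
Proof. by rewrite -(rep_trace_conj (x * y)%g x) conjgE -mulgA mulKg. Qed.

(** Conjugating [x] by [y] multiplies it by the central element [[~ x, y]], hence
    multiplies its trace by a scalar, which is not 1 as the representation is
    faithful. *)
Lemma rep_trace_commg x y : Z [~ x, y]%g -> [~ x, y]%g != 1%g -> chi x = 0.
Proof.
move=> Zz; apply: contra_neq_eq => chi0; apply: (central_char_eq1 Zz).
apply: (mulIf chi0); rewrite mul1r -rep_trace_central// Zz.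
by rewrite commgEl mulVKg rep_trace_conj.
Qed.

(** This is Bessel's inequality in the inner product defined by the trace. *)
Lemma rep_trace_bessel (l : seq G) c : uniq l -> (forall x, x \in l -> chi x = c) ->
  (forall x y, x \in l -> y \in l -> x != y -> chi (x^-1 * y)%g = 0) ->
  `|c| ^+ 2 * (size l)%:R <= 1.
Proof.
move=> ul lc orth; pose a := [seq (1 : C, x) | x <- l].
have Ea : Chi a = (size l)%:R * c.
  rewrite /lin big_map mulr_natl -sum_const_seq.
  by apply: eq_big_seq => x xl; rewrite /= scale1r lc.
have Eaa : Chi (fsum_mul (fsum_star a) a) = (size l)%:R.
  rewrite lin_mul /fsum_star !big_map /= -sum_const_seq; apply: eq_big_seq => x xl.
  rewrite big_map (bigD1_seq x)//= big1_seq ?addr0 => [|y /andP[yx yl]].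
    by rewrite conjC1 mul1r scale1r mulVg rep_trace1.
  by rewrite orth ?scaler0// eq_sym.
have := rep_trace_sqr a; rewrite Ea Eaa.
case: (size l) => [|n]; first by rewrite !mulr0.
rewrite normrM normr_nat exprMn expr2 -mulrA -[leRHS]mulr1 ler_pM2l ?ltr0n//.
by rewrite mulrC.
Qed.

Hypothesis finite_conj_mod : finite_mod Z (@finite_conj G).

(** Quotients [a^-1 * b] of conjugates of [x] lie one term further down the series,
    so the trace vanishes at them unless they lie in one of finitely many cosets
    of the center. A class meeting infinitely many cosets would thus contain
    arbitrarily many elements orthogonal to each other, all with the trace of
    [x]. *)
Lemma conj_class_finite_mod m x : lower_central G m x -> chi x != 0 ->
  (forall y, lower_central G m.+1 y -> chi y != 0 -> finite_conj y) ->
  finite_mod Z [set y | exists g, y = (x ^ g)%g].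
Proof.
move=> Lx chix IH; have [T HT] := finite_conj_mod; apply: contrapT => nfin.
pose X : set G := [set y | exists g, y = (x ^ g)%g].
have XL (a y : G) : X a -> X y -> lower_central G m.+1 (a^-1 * y)%g.
  move=> [g ->] [h ->]; have sL := lower_central_subgroup G m.+1.
  have -> : ((x ^ g)^-1 * x ^ h = [~ x, g]^-1 * [~ x, h])%g.
    by rewrite !commgEl; move: (x ^ g)%g (x ^ h)%g => b c; rewrite [(x^-1 * b)^-1%g]invgM invgK mulgA mulgK.
  by apply: (subgroupM sL); [apply: (subgroupV sL)|]; exact: lower_central_commr.
have lists n : exists l, [/\ size l = n, uniq l, (forall a : G, a \in l -> X a) &
    forall a b : G, a \in l -> b \in l -> a != b -> chi (a^-1 * b)%g = 0].
  elim: n => [|n [l [sl ul lX orth]]]; first by exists [::].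
  have [y [Xy yT]] : exists y, X y /\ forall t, t \in [seq (g * t)%g | g <- l, t <- T] -> ~ Z (y * t^-1)%g.
    apply: contrapT => noy; apply: nfin; exists [seq (g * t)%g | g <- l, t <- T] => y Xy.
    apply: contrapT => nt; apply: noy; exists y; split=> // t tT Zyt.
    by apply: nt; exists t.
  have ortho (a : G) : a \in l -> chi (a^-1 * y)%g = 0.
    move=> al; apply: contrapT => /eqP chi0.
    have [t tT Zt] := HT _ (IH _ (XL _ _ (lX a al) Xy) chi0).
    case: (yT (a * t)%g); first by apply/allpairsP; exists (a, t).
    have -> : (y * (a * t)^-1 = (a^-1 * y * t^-1) ^ a^-1)%g.
      by rewrite conjgE invgK invgM !mulgA mulgV mul1g.
    by rewrite center_conj.
  exists (y :: l); split=> /=; first by rewrite sl.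
  - rewrite ul andbT; apply/negP => /ortho; rewrite mulVg rep_trace1 => /eqP.
    by rewrite oner_eq0.
  - by move=> a; rewrite inE => /predU1P[->//|/lX].
  - move=> a b; rewrite !inE => /predU1P[->|al] /predU1P[->|bl] ab.
    + by rewrite eqxx in ab.
    + by rewrite -[(y^-1 * b)%g]invgK invgM invgK rep_traceV ortho// conjC0.
    + exact: ortho.
    + exact: orth.
have c0 : `|chi x| ^+ 2 = 0.
  apply: null_cst0; first exact: exprn_ge0.
  apply: null_le (@null_harmonic R) => n; have [l [sl ul lX orth]] := lists n.+1.
  have := @rep_trace_bessel l (chi x) ul _ orth; rewrite sl -ler_pdivlMr ?ltr0n// div1r.
  by apply=> a /lX[g ->]; rewrite rep_trace_conj.
by move/eqP: c0; rewrite sqrf_eq0 normr_eq0 (negbTE chix).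
Qed.

(** Two conjugates of [x] in the same coset of the center are equal: if
    [x ^ y = z * x ^ h] with [z] central, then [z] is a commutator of [x], so it
    is trivial by [rep_trace_commg]. *)
Lemma rep_trace_support_lower k m x : lower_central G (m + k) `<=` [set 1%g] ->
  lower_central G m x -> chi x != 0 -> finite_conj x.
Proof.
elim: k m x => [|k IH] m x triv Lx chix.
  rewrite addn0 in triv; exists [:: 1%g] => y; rewrite (triv x Lx) conj1g.
  by rewrite mem_head.
have [|T HT] := conj_class_finite_mod Lx chix.
  by move=> y; apply: IH; rewrite addSnnS.
(* One conjugate of [x] per coset; the default 1 stands for the cosets that the
   class avoids. *)
exists [seq xget 1%g [set y | (exists g, y = (x ^ g)%g) /\ Z (y * t^-1)%g] | t <- T] => y.
have [|t tT Zt] := HT (x ^ y)%g; first by exists y.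
apply/mapP; exists t => //; case: xgetP => [u _ [[h ->] Zh]|/(_ (x ^ y)%g)[]]; last first.
  by split=> //; exists y.
have Zz : Z (x ^ y * (x ^ h)^-1)%g.
  have -> : (x ^ y * (x ^ h)^-1 = (x ^ y * t^-1) * (x ^ h * t^-1)^-1)%g.
    by rewrite invgF mulgA mulgVK.
  by apply: (subgroupM (center_subgroup G)) => //; exact: (subgroupV (center_subgroup G)).
have Ez : [~ x, y * h^-1]%g = (x ^ y * (x ^ h)^-1)%g.
  rewrite commgEl conjgM -{1}(mulgVK (x ^ h)%g (x ^ y)%g) conjMg conjgK.
  by rewrite (center_conj _ Zz) Zz mulKg.
apply/eqP; rewrite -divg_eq1; apply: contraNT chix => z1.
by apply/eqP; apply: (@rep_trace_commg x (y * h^-1)%g); rewrite Ez.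
Qed.

Theorem rep_trace_support x : nilpotent_group G -> chi x != 0 -> finite_conj x.
Proof.
by move=> [n Ln]; apply: (@rep_trace_support_lower n 0); rewrite // add0n Ln.
Qed.

End RepresentationTrace.

(** * The cocycle of a section *)

Section CircleContinuity.
Variable R : realType.
Local Open Scope complex_scope.

Lemma cis_continuous (f : R -> R) : continuous f ->
  continuous (fun t => cis (f t) : (R[i] : numFieldType)).
Proof.
move=> cf t; apply/cvgrPdist_le => e e0; have Re0 : 0 < complex.Re e / 2.
  by rewrite divr_gt0//; move: e0; rewrite ltcE => /andP[].
have ccos : cos (f u) @[u --> t] --> cos (f t).
  by apply: continuous_comp; [exact: cf|exact: continuous_cos].
have csin : sin (f u) @[u --> t] --> sin (f t).
  by apply: continuous_comp; [exact: cf|exact: continuous_sin].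
near=> u.
rewrite [X in `|X|]complexE /= (le_trans (ler_normD _ _))// normrM.
have -> : e = (complex.Re e / 2)%:C + (complex.Re e / 2)%:C.
  by rewrite -{1}(ge0_ReK (ltW e0)) {1}[complex.Re e]splitr rmorphD.
have -> : `|'i| = 1 :> R[i] by rewrite normc_def /= expr0n expr1n add0r sqrtr1.
have absC (r : R) : `|r%:C| = `|r|%:C.
  by rewrite normc_def /= expr0n addr0 sqrtr_sqr.
rewrite mul1r !absC lerD// lecR.
  by near: u; exact: cvgr_dist_le.
by near: u; exact: cvgr_dist_le.
Unshelve. all: by end_near.
Qed.

End CircleContinuity.

Section SectionCocycle.
Variables (R : realType) (G : groupType) (N : normal_subgroup G).
Hypothesis NZ : nsub_set N `<=` group_center G.
Local Notation C := R[i].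
Local Notation Q := (quotient_group N).
Local Notation M := (nsub_set N).
Local Notation q := (@quotient_map G N).
Implicit Types (x y z : Q) (g h : G).

Let sN : is_subgroup M := nsub_subgroup N.

(** Normalized at the identity, so that the unitaries of the twisted algebra
    are normalized as well. *)
Definition coset_section x : G := if x == 1%g then 1%g else repr x.

Local Notation s := coset_section.

Lemma coset_sectionK x : q (s x) = x.
Proof. by rewrite /s; case: eqP => [->//|_]; exact: reprK. Qed.

Lemma coset_section1 : s 1%g = 1%g.
Proof. by rewrite /s eqxx. Qed.

Lemma coset_section_mem g : M (g * (s (q g))^-1)%g.
Proof.
have /quotient_map_eq Ng : q (s (q g)) = q g by exact: coset_sectionK.
have -> : (g * (s (q g))^-1 = ((s (q g))^-1 * g) ^ (s (q g))^-1)%g.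
  by rewrite conjgE invgK !mulgA mulgV mul1g.
exact: nsub_normal.
Qed.

Definition section_defect x y : G := (s x * s y * (s (x * y))^-1)%g.

Lemma section_defect_mem x y : M (section_defect x y).
Proof.
have := coset_section_mem (s x * s y)%g.
by rewrite quotient_mapM !coset_sectionK.
Qed.

Lemma section_defectE x y : (section_defect x y * s (x * y) = s x * s y)%g.
Proof. by rewrite /section_defect mulgVK. Qed.

Lemma section_defect1 : section_defect 1%g 1%g = 1%g.
Proof. by rewrite /section_defect mulg1 coset_section1 mulg1 mulgV. Qed.

(** Both sides compare [s x * s y * s z] with [s (x * y * z)]. *)
Lemma section_defect_cocycle x y z :
  (section_defect x y * section_defect (x * y) z =
   section_defect x (y * z) * section_defect y z)%g.
Proof.
have Z : forall g, (section_defect y z * g = g * section_defect y z)%g.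
  exact: NZ (section_defect_mem y z).
apply: (mulIg (s (x * y * z)%g)); rewrite -mulgA section_defectE mulgA section_defectE.
have E : (section_defect x (y * z) * s (x * y * z) = s x * s (y * z))%g.
  by rewrite -(section_defectE x (y * z)%g) mulgA.
by rewrite -[RHS]mulgA Z mulgA E -[RHS]mulgA -Z section_defectE mulgA.
Qed.

Lemma section_cocycle (w : G -> C) : (forall g, M g -> `|w g| = 1) ->
  (forall g h, M g -> M h -> w (g * h)%g = w g * w h) ->
  cocycle (fun x y => w (section_defect x y)).
Proof.
move=> w1 wM; split=> [x y|x y z]; first by rewrite w1//; exact: section_defect_mem.
by rewrite -!wM ?section_defect_cocycle//; exact: section_defect_mem.
Qed.

(** The angle [th] is additive on [N], hence so are its multiples, and each of
    them gives a character of [N] and a cocycle. *)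
Lemma section_cocycle_homotopic (w : G -> C) : circle_liftable R M ->
  (forall g, M g -> `|w g| = 1) ->
  (forall g h, M g -> M h -> w (g * h)%g = w g * w h) ->
  cocycle_homotopic (fun x y => w (section_defect x y)) (trivial_cocycle R Q).
Proof.
move=> liftM w1 wM; have [th [thD thE]] := liftM w w1 wM.
exists (fun t x y => cis ((1 - t) * th (section_defect x y))); split.
- move=> t _; apply: (@section_cocycle (fun g => cis ((1 - t) * th g))) => [g _|g h Mg Mh].
    exact: cis_norm.
  by rewrite thD// mulrDr cisD.
- apply/funext => x; apply/funext => y; rewrite subr0 mul1r -thE//.
  exact: section_defect_mem.
- by apply/funext => x; apply/funext => y; rewrite subrr mul0r cis0.
- move=> x y; apply: continuous_subspaceT; apply: cis_continuous => t.
  by apply: cvgM; [apply: cvgB; [exact: cvg_cst|exact: cvg_id]|exact: cvg_cst].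
Qed.

End SectionCocycle.

(** * The twisted group algebra of a central quotient *)

Section TwistedAlgebra.
Variables (R : realType) (G : groupType) (N : normal_subgroup G).
Local Notation C := R[i].
Local Notation Q := (quotient_group N).
Local Notation M := (nsub_set N).
Local Notation q := (@quotient_map G N).
Local Notation s := (@coset_section G N).
Hypothesis NZ : M `<=` group_center G.
Variable w : G -> C.
Hypothesis w_norm : forall g, M g -> `|w g| = 1.
Hypothesis wM : forall g h, M g -> M h -> w (g * h)%g = w g * w h.
Variables (B0 : cstarAlgType R) (V0 : G -> B0).
Hypothesis V0_central : central_rep M w V0.
Implicit Types (x y z : Q) (g h : G) (a b : seq (C * G)).

Local Notation sN := (nsub_subgroup N).
Local Notation sigma := (fun x y => w (section_defect x y)).

Definition central_rep_index := {B : cstarAlgType R & {V : G -> B | central_rep M w V}}.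

Definition rep_index (B : cstarAlgType R) (V : G -> B) (cV : central_rep M w V) :
  central_rep_index := existT _ B (exist _ V cV).

Let alg (i : central_rep_index) : cstarAlgType R := projT1 i.
Let rep (i : central_rep_index) : G -> alg i := projT1 (projT2 i).
Let repP (i : central_rep_index) : central_rep M w (rep i) := projT2 (projT2 i).
Let grepP (i : central_rep_index) : group_rep (rep i) := (repP i).1.

Fact central_rep_bounded a : exists2 c : C, 0 <= c & forall i, cnorm (lin (rep i) a) <= c.
Proof. by exists (\sum_(p <- a) `|p.1|); [exact: sumr_ge0|move=> i; exact: lin_rep_bound]. Qed.

(** The representations of [G] with central character [w] on [N] amount to the
    twisted representations of the quotient. *)
Definition central_formal_algebra : formal_algebra R :=
  @FormalAlgebra R _ central_rep_index alg (fun i => lin (rep i)) (rep_index V0_central)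
    cat (@fsum_mul R G) (@fsum_scale R G) (@fsum_star R G) (@fsum_one R G)
    (fun i a b => lin_cat (rep i) a b) (fun i a b => lin_rep_mul (grepP i) a b)
    (fun i k a => lin_scale (rep i) k a) (fun i a => lin_rep_star (grepP i) a)
    (fun i => lin_rep1 (grepP i)) central_rep_bounded.

Local Notation F := central_formal_algebra.
Local Notation A := (completion F).

Definition group_element g : A := ccst (F := F) [:: (1, g)].

Definition twisted_element x : A := group_element (s x).

Lemma cev_group_element (i : fa_index F) g : cev i (group_element g) = rep i g.
Proof. by rewrite cev_cst /= /lin big_seq1 scale1r. Qed.

Lemma twisted_elementE g : group_element g = w (g * (s (q g))^-1)%g *: twisted_element (q g).
Proof.
apply: cev_ext => i; rewrite linearZ /= !cev_group_element.
rewrite -{1}(mulgVK (s (q g)) g) (grepP i).2 (repP i).2; last exact: coset_section_mem.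
by rewrite -scalerAl mul1r.
Qed.

Lemma twisted_elements_unitary : twisted_unitaries sigma (twisted_element : Q -> A).
Proof.
split=> [x|x y].
  split; apply: cev_ext => i; rewrite rmorphM rmorph1 /= cev_star_homomorphism /= !cev_group_element.
    by have [u _] := grepP i; case: (u (s x)).
  by have [u _] := grepP i; case: (u (s x)).
apply: cev_ext => i; rewrite linearZ rmorphM /= !cev_group_element.
have [_ VM] := grepP i; rewrite -VM -section_defectE VM (repP i).2.
  by rewrite -scalerAl mul1r.
exact: section_defect_mem.
Qed.

Lemma ccst_fsum a : ccst (F := F) a = \sum_(p <- a) p.1 *: group_element p.2.
Proof.
apply: cev_ext => i; rewrite cev_cst raddf_sum /= /lin; apply: eq_bigr => p _.
by rewrite linearZ /= cev_group_element.
Qed.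

Lemma twisted_elements_generate : cstar_generates (range (twisted_element : Q -> A)).
Proof.
move=> S [clS S0 linS mulS starS] uS; apply/seteqP; split=> // x _.
have cstS a : S (ccst (F := F) a).
  rewrite ccst_fsum; elim: a => [|p a IH]; first by rewrite big_nil.
  rewrite big_cons; apply: (linS) => //.
  rewrite twisted_elementE -[X in S X]addr0; apply: linS => //.
  by apply: uS; exists (q p.2).
apply: clS => e e0; have [a Ha] := ccst_dense x (divr_gt0 e0 (ltr0n _ 2)).
exists (ccst (F := F) a) => //; apply: (le_lt_trans Ha).
by rewrite ltr_pdivrMr// ltr_pMr// ltr1n.
Qed.

(** The inverse of restricting a representation along the section. *)
Lemma twisted_central_rep (B : cstarAlgType R) (v : Q -> B) : twisted_unitaries sigma v ->
  central_rep M w (fun g => w (g * (s (q g))^-1)%g *: v (q g)).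
Proof.
move=> [vu vM].
have v1 : v 1%g = 1.
  have [_ vv] := vu 1%g; have := vM 1%g 1%g; rewrite section_defect1 (character1 sN w_norm wM).
  rewrite mulg1 scale1r => E; by rewrite -[LHS]mulr1 -vv mulrA E.
split; [split=> [g|g h]|move=> n Mn].
- have Mg := coset_section_mem N g; have [v1l v1r] := vu (q g).
  by split; rewrite starZ -scalerAl -scalerAr scalerA ?v1l ?v1r ?[Num.conj _ * _]mulrC -normCK w_norm// expr1n scale1r.
- rewrite -scalerAl -scalerAr scalerA vM scalerA quotient_mapM; congr (_ *: _).
  have Mg := coset_section_mem N g; have Mh := coset_section_mem N h.
  rewrite -!wM//; last 2 first.
    exact: (subgroupM sN).
    exact: section_defect_mem.
  congr w; rewrite /section_defect.
  have Z : forall k, (h * (s (q h))^-1 * k = k * (h * (s (q h))^-1))%g := NZ Mh.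
  move: (s (q g)) (s (q h)) (s (q g * q h)%g) Z => a b c Z.
  have E : (h * b^-1 * (a * b * c^-1) = a * (h * c^-1))%g.
    by rewrite -(mulgA a) (mulgA _ a) Z -(mulgA a) (mulgA _ b) mulgVK.
  by rewrite -[RHS]mulgA E [RHS]mulgA mulgVK mulgA.
- have -> : q n = 1%g.
    by apply/esym/quotient_map_eq; rewrite invg1 mul1g.
  by rewrite coset_section1 invg1 mulg1 v1.
Qed.

(** A twisted family of unitaries extends to the completion because the
    representation of [G] that it determines is among the evaluations. *)
Theorem twisted_algebra_universal :
  is_twisted_group_cstar_algebra sigma (twisted_element : Q -> A).
Proof.
split; [exact: twisted_elements_unitary|exact: twisted_elements_generate|].
move=> B v tv; pose i : fa_index F := rep_index (twisted_central_rep tv).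
pose f : {lrmorphism A -> fa_alg i} := @cev R F i.
exists f; split; first exact: (@cev_star_homomorphism R F i).
move=> x; rewrite [LHS]cev_group_element -[LHS]/(w (s x * (s (q (s x)))^-1)%g *: v (q (s x))).
rewrite coset_sectionK mulgV (character1 sN w_norm wM).
by rewrite scale1r.
Qed.

End TwistedAlgebra.

(** * Isomorphism of a corner with the algebra of a representation *)

Section CornerIsomorphism.
Variables (R : realType) (G : groupType) (H : completeNormedModType R[i]).
Variable dot : {dot H for (@Num.conj R[i])}.
Variable pi : G -> H -> H.
Hypothesis H_hilbert : norm_of_dot dot.
Hypothesis H_nontrivial : exists v : H, v != 0.
Hypothesis pi_unitary : unitary_representation dot pi.
Local Notation C := R[i].
Local Notation B := (operator_algebra H_hilbert H_nontrivial).
Local Notation Pi := (rep_op H_hilbert H_nontrivial pi_unitary).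

Variables (A : cstarAlgType R) (X : set A) (phi : {lrmorphism A -> B}) (p : A).
Hypothesis genX : cstar_generates X.
Hypothesis phi_star : star_homomorphism phi.
Hypothesis phi_le : forall a, cnorm (phi a) <= cnorm a.
Hypothesis phi_gen : forall a, X a -> exists g, phi a = Pi g.
Hypothesis phi_onto : forall g, exists a, phi a = Pi g.
Hypothesis phi_p : phi p = 1.
Hypothesis corner_norm : forall a, cnorm (p * a) <= cnorm (phi a).

Let f (a : A) : H -> H := phi a.

Let phiB a b v : phi (a - b) v = phi a v - phi b v.
Proof. by rewrite raddfB op_addE op_oppE. Qed.

Let phi_corner a : phi (p * a) = phi a.
Proof. by rewrite -[RHS]mul1r rmorphM; congr (_ * _); exact: phi_p. Qed.

(** The elements that [phi] sends into [Y] form a C*-subalgebra containing the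
    generators. *)
Lemma phi_image_sub Y : operator_cstar_algebra dot Y -> range pi `<=` Y -> forall a, Y (f a).
Proof.
move=> [_ linY mulY adjY clY] piY.
have : [set a | Y (f a)] = setT; last by move=> E a; have : [set: A] a by []; rewrite -E.
apply: genX; last by move=> a /phi_gen[g Eg]; rewrite /= /f Eg; apply: piY; exists g.
split=> [a Ha| |k a b /= Ya Yb|a b /= Ya Yb|a /= Ya].
- apply: clY => [|e e0]; first exact: adjointable_bounded_operator (op_adjointable (phi a)).
  have [b Yb ab] := Ha e e0; exists (f b) => // v.
  rewrite /f -phiB (le_trans (op_cnorm _ _))// ler_wpM2r//.
  by rewrite (le_trans (phi_le _))// ltW.
- have Y1 : Y (pi 1%g) by apply: piY; exists 1%g.
  rewrite /= (_ : f 0 = fun v => (-1) *: pi 1%g v + pi 1%g v); first exact: linY.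
  by apply/funext => v; rewrite scaleN1r addNr /f raddf0.
- rewrite (_ : f (k *: a + b) = fun v => k *: f a v + f b v); first exact: linY.
  by apply/funext => v; rewrite /f linearP.
- rewrite (_ : f (a * b) = f a \o f b); first exact: mulY.
  by apply/funext => v; rewrite /f rmorphM.
- apply: adjY Ya _ _; first exact: adjointable_bounded_operator (op_adjointable (phi (star a))).
  by move=> u v; rewrite /f phi_star op_starE.
Qed.

(** Closure under norm limits is where the isometry of the corner enters: the
    elements [p * a_ n] converge as soon as their images do. *)
Lemma phi_image_algebra : operator_cstar_algebra dot (range f).
Proof.
split.
- by move=> _ [a _ <-]; exact: adjointable_bounded_operator (op_adjointable (phi a)).
- move=> k _ _ [a _ <-] [b _ <-]; exists (k *: a + b) => //.
  by apply/funext => v; rewrite /f linearP.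
- move=> _ _ [a _ <-] [b _ <-]; exists (a * b) => //.
  by apply/funext => v; rewrite /f rmorphM.
- move=> S _ [a _ <-] _ adj; exists (star a) => //.
  apply: (adjoint_unique H_hilbert (T := f a)) => // u v.
  by rewrite /f phi_star op_starE.
- move=> T _ adT.
  have /choice[a_ Ha] : forall n, exists a, forall v, `|T v - f a v| <= n.+1%:R^-1 * `|v|.
    move=> n; have [|_ [a _ <-] Ha] := adT (n.+1%:R^-1); first by rewrite invr_gt0.
    by exists a.
  have n0 n : 0 <= n.+1%:R^-1 :> C by rewrite invr_ge0.
  have dist m n : cnorm (p * a_ m - p * a_ n) <= m.+1%:R^-1 + n.+1%:R^-1.
    rewrite -mulrBr (le_trans (corner_norm _))//; apply: op_norm_le => [|v].
      by rewrite addr_ge0.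
    rewrite phiB -(subrKA (T v)) (le_trans (ler_normD _ _))//.
    by rewrite mulrDl lerD//; [rewrite distrC; exact: Ha|exact: Ha].
  have [|b Hb] := @cnorm_complete R A (fun n => p * a_ n).
    move=> e e0; have [n1 H1] := @null_harmonic R (e / 2) (divr_gt0 e0 (ltr0n _ 2)).
    exists n1 => m n n1m n1n; apply: (le_lt_trans (dist m n)).
    by rewrite [e]splitr ltrD ?H1.
  exists b => //; apply/funext => v; apply/eqP; rewrite -subr_eq0 -normr_eq0; apply/eqP.
  apply: (eps_eq0 (c := `|v|)) => // e e0; have e2 : 0 < e / 2 by rewrite divr_gt0.
  have [n1 H1] := @null_harmonic R _ e2; have [n2 H2] := Hb _ e2.
  pose n := maxn n1 n2.
  rewrite -(subrKA (f (a_ n) v)) (le_trans (ler_normD _ _))// [e]splitr mulrDl lerD//.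
    have -> : f b v - f (a_ n) v = - phi (p * a_ n - b) v.
      by rewrite /f -(phi_corner (a_ n)) phiB opprB.
    rewrite normrN (le_trans (op_cnorm _ _))// ler_wpM2r// (le_trans (phi_le _))// ltW//.
    exact/H2/leq_maxr.
  rewrite distrC (le_trans (Ha n v))// ler_wpM2r// ltW// H1//; exact: leq_maxl.
Qed.

Theorem corner_isomorphism :
  star_isomorphic dot [set p * a | a in [set: A]] (representation_cstar_algebra dot pi).
Proof.
exists f; split.
- by move=> a _ Y [algY piY]; exact: phi_image_sub.
- move=> _ _ /set_mem[a _ <-] /set_mem[b _ <-] E; apply/eqP; rewrite -subr_eq0 -mulrBr.
  apply/eqP/cnorm_eq0/le_anti; rewrite cnorm_ge0 andbT (le_trans (corner_norm _))//.
  have : phi (p * a) = phi (p * b) by apply: op_ext => v; exact: (congr1 (@^~ v) E).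
  rewrite !phi_corner => Eab; by rewrite raddfB; move: Eab => /= ->; rewrite subrr cnorm0.
- move=> T HT; have [|a _ <-] := HT (range f).
    split; first exact: phi_image_algebra.
    by move=> _ [g _ <-]; have [a Ea] := phi_onto g; exists a => //; rewrite /f Ea.
  exists (p * a); first by exists a.
  by rewrite /f phi_corner.
- by move=> k a b _ _; apply/funext => v; rewrite /f linearP.
- by move=> a b _ _; apply/funext => v; rewrite /f rmorphM.
- by move=> a _ u v; rewrite /f phi_star op_starE.
Qed.

End CornerIsomorphism.

(** * The structure theorem *)

(** The commutant of a selfadjoint element is a C*-subalgebra. *)
Lemma commutes_generated (R : realType) (A : cstarAlgType R) (X : set A) (p : A) :
  cstar_generates X -> star p = p -> (forall a, X a -> p * a = a * p) ->
  forall a, p * a = a * p.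
Proof.
move=> genX sp pX; have : [set a | p * a = a * p] = setT.
  apply: genX => //; split=> [a Ha| |k a b /= pa pb|a b /= pa pb|a /= pa].
  - apply/eqP; rewrite -subr_eq0; apply/eqP/cnorm_eq0.
    apply: (eps_eq0 (c := cnorm p + cnorm p)); rewrite ?addr_ge0 ?cnorm_ge0// => e e0.
    have [b /= pb ab] := Ha e e0.
    have -> : p * a - a * p = p * (a - b) - (a - b) * p.
      by rewrite mulrBr mulrBl pb opprB addrA subrK.
    rewrite [leRHS]mulrDr (le_trans (cnormB _ _))// lerD// (le_trans (cnormM _ _))//.
      by rewrite mulrC ler_wpM2r ?cnorm_ge0// ltW.
    by rewrite ler_wpM2r ?cnorm_ge0// ltW.
  - by rewrite /= mulr0 mul0r.
  - by rewrite mulrDr mulrDl -scalerAr -scalerAl pa pb.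
  - by rewrite mulrA pa -!mulrA pb.
  - by rewrite -{1}sp -starM -pa starM sp.
by move=> E a; have : [set: A] a by []; rewrite -E.
Qed.

Lemma corner_norm_dense (R : realType) (F : formal_algebra R) (i : fa_index F)
    (p : completion F) :
  (forall a, cnorm (p * ccst (F := F) a) <= cnorm (cev i (ccst (F := F) a))) ->
  forall x, cnorm (p * x) <= cnorm (cev i x).
Proof.
move=> le x; apply/ler_addgt0Pr => e e0; have p1 : 0 < cnorm p + 1 by rewrite ltr_wpDl ?cnorm_ge0.
have [a Ha] := ccst_dense x (divr_gt0 e0 p1).
rewrite -[x in p * x](subrK (ccst (F := F) a)) mulrDr (le_trans (cnormD _ _))//.
have -> : cnorm (cev i x) + e = cnorm p * (e / (cnorm p + 1)) + (cnorm (cev i x) + e / (cnorm p + 1)).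
  by field; rewrite gt_eqF.
rewrite lerD//; first by rewrite (le_trans (cnormM _ _))// ler_wpM2l ?cnorm_ge0.
rewrite (le_trans (le a))// -[X in cnorm (cev i X)](subKr x) raddfB.
by rewrite (le_trans (cnormB _ _))// lerD2l (le_trans (cnorm_cev _ _)).
Qed.

Section TraceCorner.
Variables (R : realType) (G : groupType) (N : normal_subgroup G).
Local Notation C := R[i].
Local Notation M := (nsub_set N).
Hypothesis NZ : M `<=` group_center G.
Variable w : G -> C.
Hypothesis w_norm : forall g, M g -> `|w g| = 1.
Hypothesis wM : forall g h, M g -> M h -> w (g * h)%g = w g * w h.
Variables (B : cstarAlgType R) (rep : G -> B).
Hypothesis rep_central : central_rep M w rep.
Variable chi : G -> C.
Hypothesis chiC : forall g h, chi (g * h)%g = chi (h * g)%g.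
Hypothesis chiN : forall n g, M n -> chi (n * g)%g = w n * chi g.
Hypothesis chiV : forall g, chi g^-1%g = Num.conj (chi g).
Hypothesis chi1 : chi 1%g = 1.
Hypothesis chi_bound : forall a, `|lin (chi : G -> C^o) a| <= cnorm (lin rep a).
Hypothesis chi_supp : finite_mod M [set g | chi g != 0].
Hypothesis rep_scalar : forall T : B, (forall g, T * rep g = rep g * T) -> exists a, T = a *: 1.
Hypothesis growth : forall S : seq G, poly_growth S.

Local Notation sN := (nsub_subgroup N).
Local Notation K := (central_formal_algebra rep_central).
Local Notation phi := (cev (rep_index rep_central : fa_index K)).

(** The projection is [trace_sum] divided by the scalar through which it acts in
    the given representation; all its properties are checked in each evaluation
    of the completion. *)
Theorem trace_corner : exists p : completion K,
  [/\ central_projection p, phi p = 1 & forall a, cnorm (p * a) <= cnorm (phi a)].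
Proof.
have [T HT] := chi_supp; pose F := undup (map (coset_rep M) T).
have repK g : coset_rep M (coset_rep M g) = coset_rep M g.
  by apply/esym/(coset_rep_eq sN); exact: (coset_repP sN).
have F_sep x y : x \in F -> y \in F -> M (x * y^-1)%g -> x = y.
  rewrite !mem_undup => /mapP[t _ ->] /mapP[u _ ->] /(coset_rep_eq sN).
  by rewrite !repK.
have F_supp g : chi g != 0 -> exists2 x, x \in F & M (g * x^-1)%g.
  move=> /HT[t tT Mgt]; exists (coset_rep M t); first by rewrite mem_undup map_f.
  by rewrite -(coset_rep_eq sN Mgt); exact: (coset_repP sN).
have uF : uniq F by exact: undup_uniq.
pose P := trace_sum chi F.
have tc := trace_sum_central sN NZ w_norm wM chiC chiN uF F_sep F_supp.
have [s Es] : exists s, lin rep P = s *: 1.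
  apply: rep_scalar => g; have := tc _ _ rep_central [:: (1, g)].
  by rewrite /lin big_seq1 scale1r.
have s0 := trace_sum_gt0 chiN chiV chi1 uF F_supp rep_central chi_bound Es.
have sn0 : s != 0 by rewrite gt_eqF.
pose p : completion K := s^-1 *: ccst (F := K) P.
pose V (i : fa_index K) : G -> fa_alg i := projT1 (projT2 i).
have irep i : central_rep M w (V i) := projT2 (projT2 i).
have evp i : cev i p = s^-1 *: lin (V i) P by rewrite linearZ /= cev_cst.
have sp : star p = p.
  apply: cev_ext => i; rewrite cev_star_homomorphism /= evp starZ.
  rewrite (trace_sum_star sN NZ w_norm wM chiN chiV uF F_sep F_supp (irep i)).
  by rewrite conj_Creal// ger0_real// invr_ge0 ltW.
exists p; split; first split=> //.
- apply: cev_ext => i; rewrite rmorphM /= evp -scalerAl -scalerAr scalerA.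
  rewrite (trace_sum_sqr sN NZ w_norm wM chiC chiN uF F_sep F_supp rep_central chi_bound Es (irep i)).
  by rewrite scalerA -mulrA mulVf// mulr1.
- apply: (commutes_generated (@twisted_elements_generate _ _ _ _ _ _ rep_central) sp) => _ [x _ <-].
  apply: cev_ext => i; rewrite !rmorphM /= evp cev_group_element -scalerAl -scalerAr.
  congr (_ *: _); have := tc _ _ (irep i) [:: (1, coset_section x)].
  by rewrite /lin big_seq1 scale1r.
- by rewrite evp /= Es scalerA mulVf// scale1r.
- apply: corner_norm_dense => a; apply: cnorm_completion_le; first exact: cnorm_ge0.
  move=> i; rewrite rmorphM /= evp !cev_cst -scalerAl.
  exact: (trace_projection_norm sN NZ w_norm wM chiC chiN chiV chi1 uF F_sep F_supp rep_central
    chi_bound Es (irep i)).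
Qed.

End TraceCorner.
Theorem theorem4p0p6 (R : realType) (G : groupType)
    (H : completeNormedModType R[i]) (dot : {dot H for (@Num.conj R[i])})
    (pi : G -> H -> H)
    (H_hilbert : norm_of_dot dot)
    (G_fg : finitely_generated G)
    (G_nilpotent : nilpotent_group G)
    (pi_unitary : unitary_representation dot pi)
    (pi_irreducible : irreducible_representation pi)
    (pi_faithful : injective pi) :
  exists (N : normal_subgroup G)
         (sigma : quotient_group N -> quotient_group N -> R[i]),
    [/\ nsub_set N `<=` group_center G /\ torsion_free N,
        finite_index N (group_center G),
        cocycle sigma,
        cocycle_homotopic sigma (trivial_cocycle R (quotient_group N)) &
        exists (A : cstarAlgType R) (u : quotient_group N -> A) (p : A),
          [/\ is_twisted_group_cstar_algebra sigma u,
              central_projection p &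
              star_isomorphic dot [set p * a | a in [set: A]]
                (representation_cstar_algebra dot pi)]].
Proof.
have H_nontrivial := pi_irreducible.1.
have [S [/finite_seqP[l lS] genS]] := G_fg.
have growth (A : seq G) : poly_growth A by exact: nilpotent_poly_growth.
have [N0 [sN0 NZ tfN liftN fN]] := center_free_finite_index R G_fg G_nilpotent.
have nN0 x y : N0 x -> N0 (x ^ y)%g by move=> Nx; rewrite (center_conj y (NZ _ Nx)).
pose N := NormalSubgroup sN0 nN0.
have [v v1] := unit_vector_exists H_nontrivial.
pose w := central_char H_hilbert H_nontrivial pi_unitary v.
have w_norm g : N0 g -> `|w g| = 1.
  by move=> /NZ; exact: central_char_norm.
have wM g h : N0 g -> N0 h -> w (g * h)%g = w g * w h.
  by move=> /NZ Zg /NZ Zh; exact: central_charM.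
exists N, (fun x y => w (section_defect x y)).
have [r rP] := folner_radius_exists (growth l).
have [L HL] := generalized_limit_exists R.
have genl : generated_subgroup [set` l] = [set: G] by rewrite -lS.
pose rep := rep_op H_hilbert H_nontrivial pi_unitary.
have rep_central : central_rep N w rep.
  exact: (@Pi_central_rep _ _ _ _ _ H_hilbert H_nontrivial pi_unitary pi_irreducible v v1).
pose chi := rep_trace H_hilbert H_nontrivial pi_unitary v l r L.
have finFC := finite_conj_finite_mod genl sN0 tfN fN G_nilpotent.
have finZ : finite_mod (group_center G) (@finite_conj G).
  by have [T HT] := finFC; exists T => x /HT[t tT /NZ Zt]; exists t.
have chi_supp : finite_mod N [set g | chi g != 0].
  apply: finite_mod_sub finFC => g.
  exact: (rep_trace_support pi_irreducible pi_faithful v1 genl rP HL finZ G_nilpotent).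
have [p [cp phi_p p_norm]] := @trace_corner R G N NZ w w_norm wM _ rep rep_central chi
  (rep_traceC H_hilbert H_nontrivial pi_unitary v1 genl rP HL)
  (fun n g Nn => rep_trace_central H_hilbert H_nontrivial pi_unitary pi_irreducible v1 l r HL g (NZ _ Nn))
  (rep_traceV H_hilbert H_nontrivial pi_unitary v1 l r HL)
  (rep_trace1 H_hilbert H_nontrivial pi_unitary v1 l r HL)
  (rep_trace_bound H_hilbert H_nontrivial pi_unitary v1 l r HL) chi_supp
  (schur (pi_unitary := pi_unitary) pi_irreducible) growth.
split; [by split|exact: finite_mod_index|exact: section_cocycle|exact: section_cocycle_homotopic|].
exists (completion (central_formal_algebra rep_central)), (twisted_element rep_central), p.
split=> //; first exact: twisted_algebra_universal.
pose i : fa_index (central_formal_algebra rep_central) := rep_index rep_central.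
pose phi : {lrmorphism completion (central_formal_algebra rep_central) -> fa_alg i} := @cev R _ i.
apply: (@corner_isomorphism R G H dot pi H_hilbert H_nontrivial pi_unitary _
  (range (twisted_element rep_central)) phi p) => //.
- exact: (@twisted_elements_generate _ _ _ _ _ _ rep_central).
- exact: (@cev_star_homomorphism R _ i).
- by move=> a; exact: (@cnorm_cev R _ i).
- by move=> _ [x _ <-]; exists (coset_section x); exact: (cev_group_element i).
- by move=> g; exists (group_element rep_central g); exact: (cev_group_element i).
Qed.
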